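(* Let $\mathcal{C}=\{G_1,\dots,G_m\}$ be a set of blocks with hooks $h_1,\dots,h_m$ and probabilities $p_1,\dots,p_m$, and let $\mathcal{G}_0,\mathcal{G}_1,\mathcal{G}_2,\dots$ be a sequence of hooking networks grown from $\mathcal{C}$ using linear preferential attachment with parameters $\chi$ and $\rho$. Let $r$ be a positive integer and let $k_1<k_2<\dots<k_r$ be the first (smallest) $r$ essential degrees. Let $\mathcal{X}_n=(X_{n,1},\dots,X_{n,r})$, where $X_{n,i}$ is the number of vertices of degree $k_i$ in $\mathcal{G}_n$. With $w_k=\chi k+\rho$, define, for positive integers $k$, $$f(k)=\sum_{i=1}^m p_i\,\bigl|\{v\in V(G_i)\setminus\{h_i\}:\deg(v)=k\}\bigr|,\qquad g(k)=\sum_{i:\ \deg(h_i)=k}p_i,$$ $$\lambda_1=\sum_{k\ge1}\bigl(w_kf(k)+\chi k\,g(k)\bigr),$$ and define $\nu=(\nu_1,\dots,\nu_r)$ by $\nu_1=f(k_1)/(\lambda_1+w_{k_1})$ and, recursively for $i=2,\dots,r$, $$\nu_i=\frac{1}{\lambda_1+w_{k_i}}\Bigl(f(k_i)+\sum_{j=1}^{i-1}w_{k_j}\,g(k_i-k_j)\,\nu_j\Bigr).$$ For each block $G_i$ let $$s_i=\sum_{u\in V(G_i)}(\chi\deg(u)+\rho)-\rho=2\chi|E(G_i)|+\rho(|V(G_i)|-1).$$ Suppose that there exists a constant $s$ such that $s_i=s$ for all $i=1,\dots,m$. Then the convergence $$n^{-1/2}\bigl(\mathcal{X}_n-n\lambda_1\nu\bigr)\xrightarrow{d}\mathcal{N}(0,\Sigma)$$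 (for some covariance matrix $\Sigma$) holds together with convergence of all moments. In particular, $n^{-1/2}(\mathbb{E}\mathcal{X}_n-n\lambda_1\nu)\to0$, and so $n\lambda_1\nu$ can be replaced by $\mathbb{E}\mathcal{X}_n$ in this convergence.
   Context: Parameters: $\chi\ge0$ and $\rho\in\mathbb{R}$ are real numbers with $\chi+\rho>0$; $w_k:=\chi k+\rho$ for positive integers $k$. Blocks: $\mathcal{C}=\{G_1,\dots,G_m\}$ is a finite set of finite connected graphs (self-loops and multiple edges allowed), each with at least 2 vertices, and each with a distinguished vertex $h_i\in V(G_i)$ called its hook. $V(G_i)$ and $E(G_i)$ are the vertex set and edge set of $G_i$. Each block $G_i$ is assigned a probability $p_i>0$, with $p_1+\dots+p_m=1$. Degrees count edges with multiplicity, a loop contributing 2. Hooking networks: $\mathcal{G}_0$ is a copy of one of the blocks (chosen arbitrarily, deterministically or at random); the vertex of $\mathcal{G}_0$ corresponding to the hook of that block is called the master hook. For $n\ge1$, given $\mathcal{G}_{n-1}$, a vertex $v$ of $\mathcal{G}_{n-1}$ (the latch) is chosen with probability $\dfrac{\chi\deg(v)+\rho}{\sum_{u\in V(\mathcal{G}_{n-1})}(\chi\deg(u)+\rho)}$; then, independently of the latch and of the past, a block is chosen, $G_i$ being chosen with probability $p_i$. $\mathcal{G}_n$ is obtained by attaching a new copy of $G_i$ to $\mathcal{G}_{n-1}$ by fusing (identifying) the hook $h_i$ of the copy with $v$; so the degree of $v$ increases by $\deg(h_i)$ and the other vertices of the copy are added with their degrees in $G_i$. Essential degrees: a positive integer $k$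 is an essential degree if with positive probability there is some $n$ such that $\mathcal{G}_n$ has at least two vertices of degree $k$; otherwise $k$ is a nonessential degree. $\mathcal{N}(0,\Sigma)$ is the (possibly degenerate) multivariate normal distribution with mean $0$ and covariance matrix $\Sigma$. Convergence $Z_n\xrightarrow{d}Z$ of random vectors in $\mathbb{R}^r$ holds in all moments if in addition every (mixed) moment of $Z_n$ converges to the corresponding moment of $Z$. *)

(* Defs.v *)
From HB Require Import structures.
From mathcomp Require Import all_boot all_order all_algebra.
From mathcomp Require Import all_classical all_reals all_analysis.

Set Implicit Arguments.
Unset Strict Implicit.
Unset Printing Implicit Defensive.

Import Order.TTheory GRing.Theory Num.Theory.
Import numFieldNormedType.Exports.

Local Open Scope classical_set_scope.
Local Open Scope ring_scope.

(* Finite multigraph on the vertices 0, ..., nvert - 1. An edge is recorded by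
   its two endpoints, whose order is irrelevant; repeated entries of [edges]
   are multiple edges and an entry (v, v) is a loop. *)
Record mgraph := MGraph { nvert : nat; edges : seq (nat * nat) }.

Definition deg (G : mgraph) (v : nat) : nat :=
  (\sum_(e <- edges G) ((e.1 == v) + (e.2 == v)))%N.

Definition ndeg (G : mgraph) (k : nat) : nat :=
  #|[pred v : 'I_(nvert G) | deg G v == k]|.

Definition wf_mgraph (G : mgraph) : bool :=
  all (fun e => (e.1 < nvert G)%N && (e.2 < nvert G)%N) (edges G).

Definition adj (G : mgraph) : rel 'I_(nvert G) := fun x y =>
  ((val x, val y) \in edges G) || ((val y, val x) \in edges G).

Definition connected_mgraph (G : mgraph) : Prop :=
  forall x y : 'I_(nvert G), connect (@adj G) x y.

Record block := Block {
  block_graph :> mgraph;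
  hook : nat;
  block_wf : wf_mgraph block_graph;
  block_connected : connected_mgraph block_graph;
  block_size : (2 <= nvert block_graph)%N;
  hook_vertex : (hook < nvert block_graph)%N }.

(* Fusing the hook of a fresh copy of B with the vertex v of G: the other
   vertices of the copy become nvert G, nvert G + 1, ..., in the same order. *)
Definition fuse (G : mgraph) (v : nat) (B : block) (x : nat) : nat :=
  if x == hook B then v else (nvert G + unbump (hook B) x)%N.

Definition attach (G : mgraph) (v : nat) (B : block) : mgraph :=
  MGraph (nvert G + (nvert B).-1)%N
         (edges G ++ [seq (fuse G v B e.1, fuse G v B e.2) | e <- edges B]).

(* [latch n] and [blk n] are the choices that turn the n-th network into the
   (n+1)-st one. *)
Fixpoint network (T : Type) (m : nat) (C : 'I_m -> block) (init : T -> 'I_m)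
    (latch : nat -> T -> nat) (blk : nat -> T -> 'I_m) (n : nat) (t : T) :
    mgraph :=
  if n is n'.+1 then
    attach (network C init latch blk n' t) (latch n' t) (C (blk n' t))
  else C (init t).

(* All choices made before the passage from the n-th to the (n+1)-st network
   are as in the outcome t. *)
Definition same_past (T : Type) (m : nat) (init : T -> 'I_m)
    (latch : nat -> T -> nat) (blk : nat -> T -> 'I_m) (n : nat) (t : T) :
    set T :=
  [set u | init u = init t /\
    forall j, (j < n)%N -> latch j u = latch j t /\ blk j u = blk j t].

Section HookingNetworks.
Context {R : realType}.

Definition weight (chi rho : R) (k : nat) : R := chi * k%:R + rho.

Definition latch_prob (chi rho : R) (G : mgraph) (v : nat) : R :=
  if (v < nvert G)%N then
    weight chi rho (deg G v) / \sum_(u < nvert G) weight chi rho (deg G u)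
  else 0.

Record hooking_networks d (T : measurableType d) (P : probability T R)
    (m : nat) (C : 'I_m -> block) (p : 'I_m -> R) (chi rho : R) := {
  hn_init : T -> 'I_m;
  hn_latch : nat -> T -> nat;
  hn_block : nat -> T -> 'I_m;
  hn_init_meas : forall i, measurable (hn_init @^-1` [set i]);
  hn_latch_meas : forall n v, measurable (hn_latch n @^-1` [set v]);
  hn_block_meas : forall n i, measurable (hn_block n @^-1` [set i]);
  hn_latch_law : forall n t v,
    P (same_past hn_init hn_latch hn_block n t `&` hn_latch n @^-1` [set v]) =
    (P (same_past hn_init hn_latch hn_block n t) *
     (latch_prob chi rho (network C hn_init hn_latch hn_block n t) v)%:E)%E;
  hn_block_law : forall n t v i,
    P (same_past hn_init hn_latch hn_block n t `&` hn_latch n @^-1` [set v]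
       `&` hn_block n @^-1` [set i]) =
    (P (same_past hn_init hn_latch hn_block n t `&` hn_latch n @^-1` [set v]) *
     (p i)%:E)%E }.

Definition hn_graph d (T : measurableType d) (P : probability T R)
    (m : nat) (C : 'I_m -> block) (p : 'I_m -> R) (chi rho : R)
    (H : hooking_networks P C p chi rho) (n : nat) (t : T) : mgraph :=
  network C (hn_init H) (hn_latch H) (hn_block H) n t.

Definition essential d (T : measurableType d) (P : probability T R)
    (m : nat) (C : 'I_m -> block) (p : 'I_m -> R) (chi rho : R)
    (H : hooking_networks P C p chi rho) (k : nat) : Prop :=
  (0 < k)%N /\
  (0 < P [set t | exists n, (2 <= ndeg (hn_graph H n t) k)%N])%E.

Definition first_essentials d (T : measurableType d) (P : probability T R)
    (m : nat) (C : 'I_m -> block) (p : 'I_m -> R) (chi rho : R)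
    (H : hooking_networks P C p chi rho) (r : nat) (k : 'I_r -> nat) : Prop :=
  [/\ forall i j : 'I_r, (i < j)%N -> (k i < k j)%N,
      forall i, essential H (k i) &
      forall l, essential H l -> (exists i, l = k i) \/ forall i, (k i < l)%N].

Definition degree_vector d (T : measurableType d) (P : probability T R)
    (m : nat) (C : 'I_m -> block) (p : 'I_m -> R) (chi rho : R)
    (H : hooking_networks P C p chi rho) (r : nat) (k : 'I_r -> nat)
    (n : nat) (t : T) : 'rV[R]_r :=
  \row_i (ndeg (hn_graph H n t) (k i))%:R.

Section Coefficients.
Variables (m : nat) (C : 'I_m -> block) (p : 'I_m -> R) (chi rho : R).

Definition fcoef (k : nat) : R :=
  \sum_(i < m) p i *
    (#|[pred v : 'I_(nvert (C i)) |
         (val v != hook (C i)) && (deg (C i) v == k)]|)%:R.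

Definition gcoef (k : nat) : R :=
  \sum_(i < m | deg (C i) (hook (C i)) == k) p i.

(* The terms of the series vanish for k large. *)
Definition lambda1 : R :=
  \big[+%R/0]_(1 <= k <oo)
    (weight chi rho k * fcoef k + chi * k%:R * gcoef k).

(* The recursion determines nu; for the first index the sum is empty. *)
Definition nu_recursion (r : nat) (k : 'I_r -> nat) (nu : 'rV[R]_r) : Prop :=
  forall i : 'I_r,
    nu 0 i = (lambda1 + weight chi rho (k i))^-1 *
      (fcoef (k i) +
       \sum_(j < r | (j < i)%N)
          weight chi rho (k j) * gcoef (k i - k j) * nu 0 j).

Definition block_gain (i : 'I_m) : R :=
  \sum_(u < nvert (C i)) weight chi rho (deg (C i) u) - rho.

End Coefficients.

End HookingNetworks.

Section RandomVectors.
Context {R : realType}.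

Definition covariance_matrix (r : nat) (Sigma : 'M[R]_r) : Prop :=
  Sigma^T = Sigma /\ forall a : 'rV[R]_r, 0 <= (a *m Sigma *m a^T) 0 0.

(* The law N(m, s^2) on R, where N(m, 0) is the point mass at m (the value of
   [normal_prob m 0] is a junk one). *)
Definition normal_law (m s : R) (A : set R) : \bar R :=
  if s == 0 then \d_m A else normal_prob m s A.

(* Z has law N(0, Sigma), possibly degenerate: every linear combination
   a_1 Z_1 + ... + a_r Z_r has the univariate law N(0, a Sigma a^T). *)
Definition normal_vector d (T : measurableType d) (P : probability T R)
    (r : nat) (Sigma : 'M[R]_r) (Z : T -> 'rV[R]_r) : Prop :=
  (forall i, measurable_fun setT (fun t => Z t 0 i)) /\
  forall (a : 'rV[R]_r) (A : set R), measurable A ->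
    P [set t | A (\sum_i a 0 i * Z t 0 i)] =
    normal_law 0 (Num.sqrt ((a *m Sigma *m a^T) 0 0)) A.

Definition cvg_in_distribution d (T : measurableType d) (P : probability T R)
    d' (T' : measurableType d') (P' : probability T' R) (r : nat)
    (X : nat -> T -> 'rV[R]_r) (Z : T' -> 'rV[R]_r) : Prop :=
  forall F : 'rV[R]_r -> R, continuous F ->
    (exists M : R, forall x, `|F x| <= M) ->
    ('E_P[fun t => F (X n t)] @[n --> \oo] --> 'E_P'[fun t => F (Z t)])%E.

Definition cvg_moments d (T : measurableType d) (P : probability T R)
    d' (T' : measurableType d') (P' : probability T' R) (r : nat)
    (X : nat -> T -> 'rV[R]_r) (Z : T' -> 'rV[R]_r) : Prop :=
  forall q : 'I_r -> nat,
    ('E_P[fun t => (\prod_i X n t 0 i ^+ q i)%R] @[n --> \oo] -->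
     'E_P'[fun t => (\prod_i Z t 0 i ^+ q i)%R])%E.

Definition cvg_normal_moments d (T : measurableType d) (P : probability T R)
    (r : nat) (X : nat -> T -> 'rV[R]_r) (Sigma : 'M[R]_r) : Prop :=
  exists (d' : measure_display) (T' : measurableType d')
         (P' : probability T' R) (Z : T' -> 'rV[R]_r),
    [/\ normal_vector P' Sigma Z,
        cvg_in_distribution P P' X Z &
        cvg_moments P P' X Z].

Definition mean_vector d (T : measurableType d) (P : probability T R)
    (r : nat) (X : T -> 'rV[R]_r) : 'rV[R]_r :=
  \row_i fine 'E_P[fun t => X t 0 i].

End RandomVectors.

(* Main.v *)
Require Import Defs.
From HB Require Import structures.
From mathcomp Require Import all_boot all_order all_algebra.
From mathcomp Require Import all_classical all_reals all_analysis.
From mathcomp Require Import measurable_realfun ring lra.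

Set Implicit Arguments.
Unset Strict Implicit.
Unset Printing Implicit Defensive.

Import Order.TTheory GRing.Theory Num.Theory.
Import numFieldNormedType.Exports.

Local Open Scope classical_set_scope.
Local Open Scope ring_scope.

(** The proof follows characteristic functions through the recursion, step by step.

    Since all blocks have the same gain s, the total weight before step n + 1 is the
    deterministic number W = (n + 1) s + rho, and [lambda1] equals s
    ([lambda1_mean_gain], [reach_weight]). A nonessential degree is never carried by
    two vertices of a network of positive probability ([reach_rare]). Hence the mean
    of a function of the latch degree that is constant for large degrees is, up to
    O(1 / n), an affine function of the counts of the essential degrees ([averaging]). Let Y be the vector of these
    counts minus n s nu. The recursion that defines nu makes the constant part of the
    drift vanish ([limit_avg_psi1]), and so for a linear form a

      a . Y (n + 1) = a' . Y n + v,      a' = a + a A / W,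

    where A is triangular with negative diagonal, because degrees only grow, and
    where the jump v is bounded, has conditional mean O(|a| / n) and conditional
    second moment B(a) + O(|a|^2 (1 + |Y n|) / n) ([jump_mean_le], [jump_var_le]). The
    map a |-> a' does not increase the maximum norm as soon as W exceeds the weights
    of the degrees in question ([pulled_le]), so estimates for all forms of size kap
    can be proved by induction on n. They give in turn: exponential moments, hence
    Y = O(sqrt n) in every moment ([exp_moment], [abs_moment]); a mean
    bounded by n^(1/4) ([mean_le], [harmonic_sum_le]); and

      | E cos (a . Y n + b) exp (n sigma(a) / 2) - cos b |
          <= K (kap + kap h n + n kap^3),      h n = 1 + ... + 1 / n,

    as long as n kap^2 stays bounded ([char_le]). Here sigma(a) = a Sigma a^T must
    satisfy n sigma(a') + B(a) = (n + 1) sigma(a) up to O(|a|^2 / n). In first order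
    this is a Lyapunov equation with triangular coefficients, which has a symmetric
    solution ([lyapunov_exists], [limit_covariance]). With kap of order 1 / sqrt n
    the cosine moments of Y / sqrt n converge to those of the normal law with
    covariance Sigma; Sigma is positive semidefinite because characteristic functions
    are bounded by 1 ([sigma_ge0]).

    The general probability theory needed to conclude is developed first. Normal
    vectors are linear images of independent standard normal variables on a product
    space ([normal_vector_exists]). Their characteristic functions come from a
    differential equation ([Rintegral_cos_normal_pdf]). Characteristic functions
    determine weak limits of tight sequences, because on a box every continuous
    function is a uniform limit of trigonometric polynomials, namely of Bernstein
    operators in the variables (1 + sin x_i) / 2 ([trig_approx],
    [cvg_bounded_of_char]). Bounded moments of all orders upgrade weak convergence to
    convergence of moments ([cvg_moment], [cvg_normal_moments_of_char]). Finally, the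
    process almost surely takes finitely many values up to any time, so that
    expectations are finite sums to which the recursion applies ([expectation_graph], [ExS]); centring by the
    mean instead of n s nu is a vanishing shift ([cvg_normal_moments_shift]). *)

(** * Integrals against Gaussian densities *)

Section GaussIntegrals.
Context {R : realType}.
Local Notation mu := (@lebesgue_measure R).
Implicit Types (m s h t x : R) (f g : R -> R).

Lemma lebesgue_measure_shift h (A : set R) : measurable A ->
  pushforward mu ((fun x => x + h) : _ -> measurableTypeR R) A = mu A.
Proof.
move=> mA; apply/esym/lebesgue_measure_unique => //=.
  exact: measurable_funD.
move=> _ _ [[a b]] _ <-.
rewrite /pushforward /=.
rewrite (_ : _ @^-1` _ = `]a - h, b - h]%classic); last first.
  by apply/seteqP; split=> x /=; rewrite !in_itv/= ltrBlDr lerBrDr.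
rewrite !lebesgue_measure_itv/= !lte_fin ltrD2r; case: ifP => // _.
by rewrite -!EFinD; congr (_%:E); ring.
Qed.

Lemma ge0_integral_shift h (f : R -> \bar R) : measurable_fun setT f ->
  (forall x, (0 <= f x)%E) ->
  (\int[mu]_x f (x + h)%R = \int[mu]_x f x)%E.
Proof.
move=> mf f0; transitivity
  (\int[pushforward mu ((fun x => x + h)%R : _ -> measurableTypeR R)]_x f x)%E.
  rewrite ge0_integral_pushforward//=; exact: measurable_funD.
by apply: eq_measure_integral => [|? A mA AS];
  [exact: measurable_funD|exact/lebesgue_measure_shift].
Qed.

(** The density is the Radon-Nikodym derivative of the law, and boundedness makes
    the integrand integrable. *)
Lemma integral_normal_prob m s f M : measurable_fun setT f ->
  (forall x, `|f x| <= M) ->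
  (\int[normal_prob m s]_x (f x)%:E = \int[mu]_x (f x * normal_pdf m s x)%:E)%E.
Proof.
move=> mf fM.
have mfE : measurable_fun setT (EFin \o f) by exact/measurable_EFinP.
have fi : (normal_prob m s).-integrable setT (EFin \o f).
  apply: (@le_integrable _ _ _ (normal_prob m s) _ measurableT _ (cst M%:E)) => //.
    by move=> x _ /=; rewrite lee_fin (le_trans (fM x))// ler_norm.
  exact: finite_measure_integrable_cst.
rewrite -(Radon_Nikodym_change_of_variables (normal_prob_dominates m s))//=.
apply: ae_eq_integral => //.
- apply: emeasurable_funM => //; apply: (measurable_int mu).
  by apply: Radon_Nikodym_integrable; exact: normal_prob_dominates.
- apply/measurable_EFinP; apply: measurable_funM => //.
  exact: measurable_normal_pdf.
- under [X in ae_eq _ _ _ X]eq_fun do rewrite EFinM.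
  apply: ae_eqe_mul2l => /=.
  rewrite Radon_NikodymE//=; first exact: normal_prob_dominates.
  move=> abmu; case: cid => /= k [h1 h2 h3].
  apply: integral_ae_eq => //=.
  + by apply/measurable_EFinP; exact: measurable_normal_pdf.
  + by move=> E E01 mE; rewrite -h3.
Qed.

Lemma ge0_integral_opp (f : R -> \bar R) : measurable_fun setT f ->
  (forall x, (0 <= f x)%E) ->
  (\int[mu]_x f (- x)%R = \int[mu]_x f x)%E.
Proof.
move=> mf f0; transitivity
  (\int[pushforward mu (-%R : _ -> measurableTypeR R)]_x f x)%E.
  by rewrite ge0_integral_pushforward.
by apply: eq_measure_integral => A mA AS; exact/lebesgue_measureN.
Qed.

Lemma normal_pdfD m s x : s != 0 -> normal_pdf m s x = normal_pdf 0 s (x - m).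
Proof. by move=> s0; rewrite !normal_pdfE// /normal_fun subr0. Qed.

Lemma normal_pdfN s x : s != 0 -> normal_pdf 0 s (- x) = normal_pdf 0 s x.
Proof. by move=> s0; rewrite !normal_pdfE// /normal_fun !subr0 sqrrN. Qed.

(** Completing the square: an exponential factor shifts the mean. *)
Lemma normal_pdf_tilt s h x : s != 0 ->
  expR (h * x) * normal_pdf 0 s x =
  expR (h ^+ 2 * s ^+ 2 / 2) * normal_pdf (h * s ^+ 2) s x.
Proof.
move=> s0; rewrite !normal_pdfE// /normal_fun subr0 mulrCA [RHS]mulrCA.
by congr (_ * _); rewrite -!expRD; congr expR; field.
Qed.

Lemma normr_sin_le1 x : `|sin x| <= 1.
Proof. by rewrite ler_norml sin_geN1 sin_le1. Qed.

Lemma normr_cos_le1 x : `|cos x| <= 1.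
Proof. by rewrite ler_norml cos_geN1 cos_le1. Qed.

Lemma measurable_expRM h : measurable_fun setT (fun x : R => expR (h * x)).
Proof. by apply: measurableT_comp => //; exact: measurable_funM. Qed.

Lemma measurable_sinM t : measurable_fun setT (fun x : R => sin (t * x)).
Proof.
apply: (measurableT_comp (continuous_measurable_fun (@continuous_sin R))).
exact: measurable_funM.
Qed.

Lemma measurable_cosM t : measurable_fun setT (fun x : R => cos (t * x)).
Proof.
apply: (measurableT_comp (continuous_measurable_fun (@continuous_cos R))).
exact: measurable_funM.
Qed.

Section Fixed.
Variable s : R.
Hypothesis s0 : s != 0.
Let f := normal_pdf 0 s.

Let mf : measurable_fun setT f.
Proof. exact: measurable_normal_pdf. Qed.

Let f0 x : 0 <= f x.
Proof. exact: normal_pdf_ge0. Qed.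

Lemma integrable_exp_normal_pdf h :
  mu.-integrable setT (fun x => (expR (h * x) * f x)%:E).
Proof.
under eq_fun do rewrite normal_pdf_tilt// EFinM.
by apply: integrableZl => //; exact: integrable_normal_pdf.
Qed.

Lemma integrableM_normal_pdf (g : R -> R) c M : measurable_fun setT g ->
  (forall x, `|g x| <= M * (expR (c * x) + expR (- c * x))) ->
  mu.-integrable setT (fun x => (g x * f x)%:E).
Proof.
move=> mg gM.
apply: (@le_integrable _ _ _ mu _ measurableT _
  (fun x => M%:E * ((expR (c * x) * f x)%:E + (expR (- c * x) * f x)%:E))%E) => //.
- by apply/measurable_EFinP; exact: measurable_funM.
- move=> x _ /=; rewrite lee_fin normrM (ger0_norm (f0 x)) -mulrDl mulrA.
  by rewrite (le_trans _ (ler_norm _))// ler_wpM2r.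
- by apply: integrableZl => //; apply: integrableD => //;
    exact: integrable_exp_normal_pdf.
Qed.

Lemma integrableM_normal_pdf_bounded (g : R -> R) M : measurable_fun setT g ->
  (forall x, `|g x| <= M) -> mu.-integrable setT (fun x => (g x * f x)%:E).
Proof.
move=> mg gM; apply: (@integrableM_normal_pdf g 0 (M / 2)) => // x.
by rewrite oppr0 mul0r expR0 (le_trans (gM x))//; lra.
Qed.

Lemma Rintegral_normal_pdf1 : \int[mu]_x (f x) = 1 :> R.
Proof. by rewrite /Rintegral integral_normal_pdf. Qed.

Lemma integrable_sin_normal_pdf t :
  mu.-integrable setT (fun x => (sin (t * x) * f x)%:E).
Proof.
apply: (@integrableM_normal_pdf_bounded _ 1) => [|x].
  exact: measurable_sinM.
exact: normr_sin_le1.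
Qed.

Lemma integrable_cos_normal_pdf t :
  mu.-integrable setT (fun x => (cos (t * x) * f x)%:E).
Proof.
apply: (@integrableM_normal_pdf_bounded _ 1) => [|x].
  exact: measurable_cosM.
exact: normr_cos_le1.
Qed.

(** The changes of variables above apply to nonnegative integrands; adding the
    density to a bounded integrand makes it nonnegative. *)
Lemma Rintegral_1D_normal_pdf (g : R -> R) : measurable_fun setT g ->
  (forall x, `|g x| <= 1) ->
  \int[mu]_x ((1 + g x) * f x) = 1 + \int[mu]_x (g x * f x) :> R.
Proof.
move=> mg g1.
under eq_Rintegral do rewrite mulrDl mul1r.
rewrite RintegralD//; first by rewrite Rintegral_normal_pdf1.
  exact: integrable_normal_pdf.
exact: (@integrableM_normal_pdf_bounded _ 1).
Qed.

(** The integrand is odd. *)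
Lemma Rintegral_sin_normal_pdf t : \int[mu]_x (sin (t * x) * f x) = 0 :> R.
Proof.
have : \int[mu]_x ((1 + sin (t * x)) * f x) =
       \int[mu]_x ((1 + (- sin (t * x))) * f x) :> R.
  rewrite /Rintegral -ge0_integral_opp/=.
  - by under [X in fine X = _]eq_integral do rewrite mulrN sinN /f normal_pdfN//.
  - apply/measurable_EFinP; apply: measurable_funM => //.
    by apply: measurable_funD => //; exact: measurable_sinM.
  - by move=> x; rewrite lee_fin mulr_ge0.
have sin1 x : `|sin (t * x)| <= 1 by exact: normr_sin_le1.
rewrite (@Rintegral_1D_normal_pdf (fun x => sin (t * x)));
  [|exact: measurable_sinM|by []].
rewrite (@Rintegral_1D_normal_pdf (fun x => - sin (t * x))); first last.
- by move=> x; rewrite normrN.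
- by apply: measurableT_comp => //; exact: measurable_sinM.
under [X in _ = _ + X -> _]eq_Rintegral do rewrite mulNr -mulN1r.
rewrite (@RintegralZl _ _ _ mu setT (fun x => sin (t * x) * f x));
  [|by []|exact: integrable_sin_normal_pdf].
rewrite mulN1r => /addrI /eqP.
by rewrite -addr_eq0 -mulr2n mulrn_eq0 => /eqP.
Qed.

End Fixed.
End GaussIntegrals.

(** * The Gaussian characteristic function *)

#[local] Opaque normal_pdf expR sin cos.

Section GaussChar.
Context {R : realType}.
Local Notation mu := (@lebesgue_measure R).
Implicit Types (m h t x : R).
Variable s : R.
Hypothesis s0 : s != 0.
Let f := normal_pdf 0 s.

Let mf : measurable_fun setT f.
Proof. exact: measurable_normal_pdf. Qed.

Let f0 x : 0 <= f x.
Proof. exact: normal_pdf_ge0. Qed.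

Let F t : R := \int[mu]_x (cos (t * x) * f x).

(** The exponential factor amounts to a shift of the density by [h * s ^+ 2], and in
    the sine of the shifted argument only the even part survives. Comparing the
    derivatives of both sides at h = 0 will give a differential equation for [F]. *)
Lemma Rintegral_exp_sin_normal_pdf h t :
  \int[mu]_x (expR (h * x) * sin (t * x) * f x) =
  expR (h ^+ 2 * s ^+ 2 / 2) * sin (t * (h * s ^+ 2)) * F t.
Proof.
set c := h * s ^+ 2.
have E : \int[mu]_x ((1 + sin (t * x)) * f (x - c)) =
         \int[mu]_x ((1 + sin (t * (x + c))) * f x) :> R.
  rewrite /Rintegral -(@ge0_integral_shift _ c)/=.
  - by under [X in fine X = _]eq_integral do rewrite addrK.
  - apply/measurable_EFinP; apply: measurable_funM => //.
      by apply: measurable_funD => //; exact: measurable_sinM.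
    by apply: measurableT_comp => //; exact: measurable_funD.
  - by move=> x; rewrite lee_fin mulr_ge0.
have i1 : mu.-integrable setT (fun x => (f (x - c))%:E).
  have := integrable_normal_pdf c s; apply: (eq_integrable measurableT) => x _.
  by rewrite normal_pdfD.
have iexp : mu.-integrable setT
    (fun x => (expR (h * x) * sin (t * x) * f x)%:E).
  apply: (@integrableM_normal_pdf _ _ s0 _ h 1) => [|x].
    by apply: measurable_funM; [exact: measurable_expRM|exact: measurable_sinM].
  rewrite normrM (ger0_norm (expR_ge0 _)) mul1r.
  apply: (@le_trans _ _ (expR (h * x))); last by rewrite lerDl expR_ge0.
  by rewrite ler_piMr ?expR_ge0 ?normr_sin_le1.
have ish : mu.-integrable setT (fun x => (sin (t * x) * f (x - c))%:E).
  have := integrableZl measurableT (expR (- (h ^+ 2 * s ^+ 2 / 2))) iexp.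
  apply: (eq_integrable measurableT) => x _ /=.
  rewrite -EFinM /f -(normal_pdfD c x s0) [_ * _ * normal_pdf 0 s x]mulrAC.
  rewrite (normal_pdf_tilt h x s0) -/c.
  move: (normal_pdf c s x) (sin (t * x)) (h ^+ 2 * _ / 2) => N S u.
  congr EFin.
  by rewrite -mulrA [LHS]mulrA -expRD addNr expR0 mul1r mulrC.
have -> : \int[mu]_x (expR (h * x) * sin (t * x) * f x) =
  expR (h ^+ 2 * s ^+ 2 / 2) * \int[mu]_x (sin (t * x) * f (x - c)).
  rewrite -RintegralZl; [|by []|exact: ish].
  apply: eq_Rintegral => x _; rewrite mulrAC /f (normal_pdf_tilt h x s0) -/c -(normal_pdfD c x s0).
  by move: (sin _) (normal_pdf c s x) (expR (_ / 2)) => S N u; rewrite -mulrA [N * _]mulrC.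
rewrite -[RHS]mulrA; congr (_ * _).
move: E; rewrite Rintegral_1D_normal_pdf//; last first.
- by move=> x; exact: normr_sin_le1.
- apply: (measurableT_comp (continuous_measurable_fun (@continuous_sin R))).
  by apply: measurable_funM => //; exact: measurable_funD.
under eq_Rintegral do rewrite mulrDl mul1r.
rewrite RintegralD; [|by []|exact: i1|exact: ish].
rewrite (_ : \int[mu]_x (f (x - c)) = 1 :> R); last first.
  rewrite -(Rintegral_normal_pdf1 s) /Rintegral.
  rewrite -[in RHS](@ge0_integral_shift _ (- c)) => //=.
  exact/measurable_EFinP.
move=> /addrI ->.
under eq_Rintegral do rewrite mulrDr sinD mulrDl mulrAC [cos _ * _ * _]mulrAC.
have j1 : mu.-integrable setT (fun x => (sin (t * x) * f x * cos (t * c))%:E).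
  apply: (eq_integrable measurableT) (integrableZl measurableT (cos (t * c))
    (integrable_sin_normal_pdf s0 t)) => x _.
  by rewrite /= -EFinM mulrC.
have j2 : mu.-integrable setT (fun x => (cos (t * x) * f x * sin (t * c))%:E).
  apply: (eq_integrable measurableT) (integrableZl measurableT (sin (t * c))
    (integrable_cos_normal_pdf s0 t)) => x _.
  by rewrite /= -EFinM mulrC.
rewrite RintegralD; [|by []|exact: j1|exact: j2].
rewrite RintegralZr; [|by []|exact: integrable_sin_normal_pdf].
rewrite RintegralZr; [|by []|exact: integrable_cos_normal_pdf].
by rewrite (Rintegral_sin_normal_pdf s0) mul0r add0r mulrC.
Qed.

(** Differentiation under the integral sign, with a domination near [a]. *)
Let deriv_Rintegral (g dg : R -> R -> R) (a : R) (G : R -> R) :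
  (forall x y, is_derive x 1 (g^~ y) (dg x y)) ->
  (forall x, `|x - a| < 1 -> mu.-integrable setT (fun y => (g x y)%:E)) ->
  mu.-integrable setT (fun y => (G y)%:E) ->
  (forall x y, `|x - a| < 1 -> `|dg x y| <= G y) ->
  is_derive a 1 (fun x => \int[mu]_y g x y : R) (\int[mu]_y dg a y).
Proof.
move=> gdg ig iG dgG.
have I x : `]a - 1, a + 1[%classic x -> `|x - a| < 1.
  by rewrite /= in_itv/= ltr_norml => /andP[? ?]; apply/andP; split; lra.
have Ia : `]a - 1, a + 1[%classic a.
  by rewrite /= in_itv/=; apply/andP; split; lra.
have G0 y : 0 <= G y.
  by rewrite (le_trans _ (dgG a y _)) ?subrr ?normr0.
have dE x y : partial1of2 g x y = dg x y.
  by rewrite partial1of2E; exact: derive_val.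
have dg1 x y : `]a - 1, a + 1[%classic x -> setT y -> derivable (g ^~ y) x 1.
  by move=> _ _; exact: ex_derive.
have gG x y : `]a - 1, a + 1[%classic x -> setT y -> `|partial1of2 g x y| <= G y.
  by move=> /I xa _; rewrite dE dgG.
have ig' x : `]a - 1, a + 1[%classic x -> mu.-integrable setT (EFin \o g x).
  by move=> /I; exact: ig.
apply: DeriveDef.
  exact: (derivable_under_integral measurableT Ia ig' dg1 G0 iG gG).
rewrite -derive1E (differentiation_under_integral measurableT Ia ig' dg1 G0 iG gG).
by apply: eq_Rintegral => y _; rewrite dE.
Qed.

Let le_norm_exp (x : R) : `|x| <= expR x + expR (- x).
Proof.
have := expR_ge1Dx x; have := expR_ge1Dx (- x).
by have := expR_ge0 x; have := expR_ge0 (- x); case: (ler0P x) => _; lra.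
Qed.

Let dcos t : is_derive t 1 F (- (\int[mu]_x (x * sin (t * x) * f x))).
Proof.
have -> : - (\int[mu]_x (x * sin (t * x) * f x)) =
    \int[mu]_x (- (x * sin (t * x)) * f x) :> R.
  rewrite -mulN1r -RintegralZl//.
    by apply: eq_Rintegral => x _; rewrite mulN1r mulNr.
  apply: (@integrableM_normal_pdf _ _ s0 _ 1 1) => [|x].
    by apply: measurable_funM => //; exact: measurable_sinM.
  rewrite mul1r mul1r mulN1r (le_trans _ (le_norm_exp x))//.
  by rewrite normrM ler_piMr// normr_sin_le1.
apply: (@deriv_Rintegral (fun t x => cos (t * x) * f x)
  (fun u x => - (x * sin (u * x)) * f x) t (fun x => `|x| * f x)).
- move=> u x.
  have H : is_derive u 1 (fun v => cos (v * x)) (- sin (u * x) * x).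
    apply: (@is_derive1_comp _ cos (fun v => v * x)).
    by apply: is_derive_eq; rewrite scaler0 add0r /GRing.scale/= mulr1.
  have -> : - (x * sin (u * x)) * f x = f x *: (- sin (u * x) * x).
    by rewrite /GRing.scale/=; ring.
  have -> : (fun v => cos (v * x) * f x) = f x \*: (fun v => cos (v * x)).
    by apply/funext => v; rewrite /= mulrC.
  exact: is_deriveZ.
- by move=> u _; exact: integrable_cos_normal_pdf.
- apply: (@integrableM_normal_pdf _ _ s0 _ 1 1) => [|x]; first exact: normr_measurable.
  by rewrite normr_id mul1r mul1r mulN1r.
- move=> u x _; rewrite normrM normrN normrM (ger0_norm (f0 x)) ler_wpM2r//.
  by rewrite ler_piMr// normr_sin_le1.
Qed.
Let dexp t : is_derive (0 : R) (1 : R)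
  (fun h : R => \int[mu]_x (expR (h * x) * sin (t * x) * f x) : R)
  (\int[mu]_x (x * sin (t * x) * f x)).
Proof.
have -> : \int[mu]_x (x * sin (t * x) * f x) =
    \int[mu]_x (x * expR (0 * x) * sin (t * x) * f x) :> R.
  by apply: eq_Rintegral => x _; rewrite mul0r expR0 mulr1.
apply: (@deriv_Rintegral (fun h x => expR (h * x) * sin (t * x) * f x)
  (fun h x => x * expR (h * x) * sin (t * x) * f x) 0
  (fun x => (`|x| * expR `|x|) * f x)).
- move=> u x.
  have H : is_derive u 1 (fun v => expR (v * x)) (expR (u * x) * x).
    apply: (@is_derive1_comp _ expR (fun v => v * x)).
    by apply: is_derive_eq; rewrite scaler0 add0r /GRing.scale/= mulr1.
  have -> : x * expR (u * x) * sin (t * x) * f x =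
            (sin (t * x) * f x) *: (expR (u * x) * x).
    by rewrite /GRing.scale/=; ring.
  have -> : (fun v => expR (v * x) * sin (t * x) * f x) =
            (sin (t * x) * f x) \*: (fun v => expR (v * x)).
    by apply/funext => v; rewrite /= [RHS]mulrC mulrA.
  exact: is_deriveZ.
- move=> u _; apply: (@integrableM_normal_pdf _ _ s0 _ u 1) => [|x].
    by apply: measurable_funM; [exact: measurable_expRM|exact: measurable_sinM].
  rewrite normrM (ger0_norm (expR_ge0 _)) mul1r.
  apply: (@le_trans _ _ (expR (u * x))); last by rewrite lerDl expR_ge0.
  by rewrite ler_piMr ?expR_ge0 ?normr_sin_le1.
- apply: (@integrableM_normal_pdf _ _ s0 _ 2 1) => [|x].
    apply: measurable_funM; first exact: normr_measurable.
    by apply: measurableT_comp => //; exact: normr_measurable.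
  rewrite mul1r ger0_norm ?mulr_ge0 ?expR_ge0//.
  apply: (@le_trans _ _ (expR (2 * `|x|))).
    rewrite mulrDl mul1r expRD ler_wpM2r ?expR_ge0//.
    by rewrite (le_trans _ (expR_ge1Dx _))// lerDr.
  by rewrite mulNr; case: (ler0P x) => _; rewrite ?mulrN ?lerDl ?lerDr expR_ge0.
- move=> u x; rewrite subr0 => u1.
  rewrite normrM (ger0_norm (f0 x)) ler_wpM2r// normrM.
  apply: (@le_trans _ _ `|x * expR (u * x)|).
    by rewrite ler_piMr ?normr_sin_le1.
  rewrite normrM ler_wpM2l// (ger0_norm (expR_ge0 _)) ler_expR.
  rewrite (le_trans (ler_norm _))// normrM ler_piMl// ltW//.
Qed.

(** The derivative of [F] is minus the integral of x sin (t x), which is the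
    derivative at h = 0 of the tilted sine integral. *)
Let dF t : is_derive t 1 F (- (t * s ^+ 2 * F t)).
Proof.
suff <- : \int[mu]_x (x * sin (t * x) * f x) = t * s ^+ 2 * F t :> R by exact: dcos.
have H1 : is_derive (0 : R) (1 : R) (fun h => expR (h ^+ 2 * s ^+ 2 / 2)) 0.
  have : is_derive (0 : R) (1 : R) (fun h : R => h ^+ 2 * s ^+ 2 / 2) 0.
    apply: is_derive_eq.
    by rewrite !scaler0 !add0r /GRing.scale/= !(mulr0, mul0r, addr0, mulr1).
  move=> /(@is_derive1_comp _ expR _ _ _ _ (is_derive_expR _)).
  by rewrite mulr0.
have H2 : is_derive (0 : R) (1 : R) (fun h => sin (t * (h * s ^+ 2))) (t * s ^+ 2).
  have : is_derive (0 : R) (1 : R) (fun h : R => t * (h * s ^+ 2)) (t * s ^+ 2).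
    apply: is_derive_eq.
    by rewrite !scaler0 !add0r /GRing.scale/= !(mulr0, mul0r, addr0, mulr1).
  move=> /(@is_derive1_comp _ sin _ _ _ _ (is_derive_sin _)).
  by rewrite mul0r mulr0 cos0 mul1r.
have H3 := is_deriveM (is_deriveM H1 H2) (is_derive_cst (F t) (0 : R) 1).
have E : (fun h => \int[mu]_x (expR (h * x) * sin (t * x) * f x) : R) =
  (fun h => expR (h ^+ 2 * s ^+ 2 / 2)) * (fun h => sin (t * (h * s ^+ 2)))
  * cst (F t).
  by apply/funext => h; rewrite Rintegral_exp_sin_normal_pdf.
have := dexp t; rewrite E => H4.
have := @derive_val _ _ _ _ _ _ _ H3; rewrite (@derive_val _ _ _ _ _ _ _ H4) => ->.
rewrite !fctE /= /GRing.scale/= expr2 !(mul0r, mulr0, add0r, addr0, expR0, mul1r).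
by ring.
Qed.

(** By the differential equation the product of [F] with the inverse of the
    right-hand side is constant. *)
Lemma Rintegral_cos_normal_pdf t :
  \int[mu]_x (cos (t * x) * f x) = expR (- (t ^+ 2 * s ^+ 2 / 2)) :> R.
Proof.
pose e (u : R) : R := expR (u ^+ 2 * s ^+ 2 / 2).
have de (u : R) : is_derive u (1 : R) e (u * s ^+ 2 * e u).
  have : is_derive u (1 : R) (fun h : R => h ^+ 2 * s ^+ 2 / 2) (u * s ^+ 2).
    apply: is_derive_eq.
    by rewrite !scaler0 !add0r /GRing.scale/=; field.
  move=> /(@is_derive1_comp _ expR _ _ _ _ (is_derive_expR _)).
  by rewrite mulrC.
have FE : F t * e t = 1.
  transitivity ((F * e) t) => //; transitivity ((F * e) 0); last first.
    transitivity (F 0 * e 0) => //.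
    rewrite /e expr2 !mul0r expR0 mulr1 /F.
    under eq_Rintegral do rewrite mul0r cos0 mul1r.
    exact: Rintegral_normal_pdf1.
  apply: is_derive_0_is_cst => u.
  have := is_deriveM (dF u) (de u).
  have -> // : F u *: (u * s ^+ 2 * e u) + e u *: - (u * s ^+ 2 * F u) = 0.
  by rewrite /GRing.scale/=; ring.
have e0 : e t != 0 by rewrite gt_eqF// expR_gt0.
by rewrite expRN -[LHS](mulfK e0) FE mul1r.
Qed.

End GaussChar.

#[local] Transparent normal_pdf expR sin cos.

(** * Affine images and mixtures of normal laws *)

Section NormalLaws.
Context {R : realType}.
Local Notation mu := (@lebesgue_measure R).
Implicit Types (m h t x y b s : R).

Lemma ge0_integral_scale b (f : R -> \bar R) : 0 < b ->
  measurable_fun setT f -> (forall x, (0 <= f x)%E) ->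
  (b%:E * \int[mu]_x f (b * x)%R = \int[mu]_x f x)%E.
Proof.
move=> b0 mf f0.
have mb : measurable_fun [set: measurableTypeR R]
    ((fun x => b * x) : measurableTypeR R -> measurableTypeR R).
  exact: measurable_funM.
pose b' : {nonneg R} := NngNum (ltW b0).
have := @ge0_integral_pushforward _ _ _ _ R _ mb mu setT f measurableT mf.
rewrite preimage_setT => <-; last by move=> x _; exact: f0.
rewrite -[b in b%:E]/(b'%:num) -ge0_integral_mscale//.
apply: eq_measure_integral => A mA _.
apply/esym; apply: lebesgue_measure_unique => //= _ [[u v]] _ <-.
rewrite /mscale/= /pushforward.
rewrite (_ : _ @^-1` _ = `]u / b, v / b]%classic); last first.
  by apply/seteqP; split=> x /=; rewrite !in_itv/= ltr_pdivrMr// ler_pdivlMr// mulrC.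
rewrite !lebesgue_measure_itv/= !lte_fin ltr_pM2r ?invr_gt0//; case: ifP => _.
  by rewrite -!EFinD -EFinM -mulrBl mulrC divfK// gt_eqF.
by rewrite mule0.
Qed.

Lemma normal_probE m s (A : set R) : measurable A ->
  normal_prob m s A = (\int[mu]_x (\1_A x * normal_pdf m s x)%:E)%E.
Proof.
move=> mA; rewrite /normal_prob integral_mkcond; apply: eq_integral => x _.
by rewrite patchE indicE; case: ifP; rewrite ?mul1r ?mul0r.
Qed.

Lemma normal_pdf_sym m s x : normal_pdf m (- s) x = normal_pdf m s x.
Proof.
by rewrite /normal_pdf oppr_eq0 /normal_peak /normal_fun sqrrN.
Qed.

Lemma normal_probN m s : normal_prob m (- s) = normal_prob m s.
Proof.
by apply/funext => A; apply: eq_integral => x _; rewrite normal_pdf_sym.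
Qed.

Lemma normal_prob_norm m s : normal_prob m `|s| = normal_prob m s.
Proof. by have [_|_] := ler0P s; rewrite ?normal_probN. Qed.

Lemma normal_pdf_affine b x y : 0 < b ->
  normal_pdf 0 1 y = b * normal_pdf x b (b * y + x).
Proof.
move=> b0; have bN0 : b != 0 by rewrite gt_eqF.
rewrite !normal_pdfE ?oner_eq0// /normal_fun subr0 addrK mulrA; congr (_ * expR _).
  rewrite /normal_peak -[X in X / _]ger0_norm ?ltW// -sqrtr_sqr -sqrtrV; last first.
    by rewrite mulrn_wge0// mulr_ge0 ?sqr_ge0 ?pi_ge0.
  rewrite -sqrtrV; last by rewrite mulrn_wge0// mulr_ge0 ?sqr_ge0 ?pi_ge0.
  rewrite -sqrtrM ?sqr_ge0//; congr (Num.sqrt _).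
  have p0 : pi != 0 :> R by rewrite gt_eqF// pi_gt0.
  by move: (pi : R) p0 => q q0; field; rewrite q0 bN0.
by field.
Qed.

(** Change of variables for b > 0; the case b < 0 follows since the standard
    density is even. *)
Lemma normal_prob_affine b x (A : set R) : b != 0 -> measurable A ->
  normal_prob 0 1 [set y | A (b * y + x)] = normal_prob x b A.
Proof.
wlog b0 : b A / 0 < b => [H bN0 mA|_ mA].
  have [/H->//|b0] := ltP 0 b.
  have nb0 : 0 < - b by rewrite oppr_gt0 lt_neqAle bN0.
  have mA' : measurable [set y | A (b * y + x)].
    rewrite -[X in measurable X]setTI.
    have : measurable_fun setT (fun y => b * y + x).
      by apply: measurable_funD => //; exact: measurable_funM.
    exact.
  rewrite -[normal_prob x b]normal_probN -(H _ _ nb0) ?gt_eqF//.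
  have mA2 : measurable [set y | A (- b * y + x)].
    rewrite -[X in measurable X]setTI.
    have : measurable_fun setT (fun y => - b * y + x).
      by apply: measurable_funD => //; exact: measurable_funM.
    exact.
  rewrite (normal_probE _ _ mA') (normal_probE _ _ mA2).
  pose g y := (\1_[set y | A (b * y + x)] y * normal_pdf 0 1 y)%:E.
  have mg : measurable_fun setT g.
    apply/measurable_EFinP/measurable_funM; last exact: measurable_normal_pdf.
    exact: measurable_indic.
  have g0 y : (0 <= g y)%E by rewrite lee_fin mulr_ge0 ?normal_pdf_ge0.
  rewrite -(ge0_integral_opp mg g0); apply: eq_integral => y _.
  rewrite /g normal_pdfN ?oner_eq0// !indicE.
  have -> : (- y \in [set y | A (b * y + x)]) = (y \in [set y | A (- b * y + x)]).
    by apply/idP/idP => /set_mem/= H1; apply/mem_set; rewrite /= ?mulrN ?mulNr in H1 *.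
  by [].
have mA' : measurable [set y | A (b * y + x)].
  rewrite -[X in measurable X]setTI.
  have : measurable_fun setT (fun y => b * y + x).
    by apply: measurable_funD => //; exact: measurable_funM.
  exact.
rewrite (normal_probE _ _ mA') (normal_probE _ _ mA).
pose g z := (\1_A z * normal_pdf x b z)%:E.
have mg : measurable_fun setT g.
  by apply/measurable_EFinP/measurable_funM => //; exact: measurable_normal_pdf.
have g0 z : (0 <= g z)%E by rewrite lee_fin mulr_ge0 ?normal_pdf_ge0.
have mgx : measurable_fun setT (fun z : R => g (z + x)).
  by apply: (measurableT_comp mg); exact: measurable_funD.
have mgbx : measurable_fun setT (fun z : R => g (b * z + x)).
  by apply: (measurableT_comp mgx); exact: measurable_funM.
rewrite -(ge0_integral_shift x mg g0).
rewrite -(ge0_integral_scale b0 mgx (fun z => g0 (z + x))).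
rewrite -ge0_integralZl; first last.
- by rewrite lee_fin ltW.
- by move=> y _; exact: g0.
- exact: mgbx.
- by [].
apply: eq_integral => y _; rewrite -EFinM (normal_pdf_affine x y b0) mulrCA.
by rewrite !indicE.
Qed.

(** Bayes formula for a normal observation y with normal mean x: the joint density
    is the marginal density of y times the normal posterior density of x. *)
Lemma normal_pdf_conv b s x y : b != 0 -> s != 0 ->
  let r := Num.sqrt (b ^+ 2 + s ^+ 2) in
  normal_pdf x b y * normal_pdf 0 s x =
  normal_pdf 0 r y * normal_pdf (y * s ^+ 2 / r ^+ 2) (b * s / r) x.
Proof.
move=> b0 s0 r.
have bs0 : 0 < b ^+ 2 + s ^+ 2 by rewrite addr_gt0// exprn_even_gt0.
have r0 : r != 0 by rewrite gt_eqF// sqrtr_gt0.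
have rE : r ^+ 2 = b ^+ 2 + s ^+ 2 by rewrite sqr_sqrtr// ltW.
have bsN0 : b ^+ 2 + s ^+ 2 != 0 by rewrite gt_eqF.
rewrite !normal_pdfE ?mulf_neq0 ?invr_eq0// mulrACA [RHS]mulrACA.
have pk (u : R) : 0 <= u ^+ 2 * pi *+ 2.
  by rewrite mulrn_wge0// mulr_ge0 ?sqr_ge0 ?pi_ge0.
congr (_ * _).
  rewrite /normal_peak -!invfM -!sqrtrM//; congr (_ ^-1); congr (Num.sqrt _).
  by rewrite !exprMn exprVn; field.
rewrite /normal_fun -!expRD !subr0; congr expR.
by rewrite !exprMn exprVn rE; field; rewrite bsN0 s0 b0.
Qed.

Lemma measurable_indic_normal_pdf b (A : set R) : b != 0 -> measurable A ->
  measurable_fun setT (fun z : R * R => \1_A z.2 * normal_pdf z.1 b z.2).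
Proof.
move=> b0 mA; apply: measurable_funM.
  exact: (measurableT_comp (measurable_indic mA) measurable_snd).
rewrite (_ : (fun _ => _) = normal_pdf 0 b \o (fun z : R * R => z.2 - z.1)).
  apply: measurableT_comp; first exact: measurable_normal_pdf.
  by apply: measurable_funB; [exact: measurable_snd|exact: measurable_fst].
by apply/funext => z /=; rewrite normal_pdfD.
Qed.

(** After exchanging the integrals the posterior density integrates to 1. *)
Lemma normal_prob_conv b s (A : set R) : b != 0 -> s != 0 -> measurable A ->
  (\int[mu]_x (normal_prob x b A * (normal_pdf 0 s x)%:E) =
   normal_prob 0 (Num.sqrt (b ^+ 2 + s ^+ 2)) A)%E.
Proof.
move=> b0 s0 mA; pose r := Num.sqrt (b ^+ 2 + s ^+ 2).
pose h (z : R * R) : \bar R :=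
  (\1_A z.2 * normal_pdf z.1 b z.2 * normal_pdf 0 s z.1)%:E.
have mh : measurable_fun setT h.
  apply/measurable_EFinP/measurable_funM.
    exact: measurable_indic_normal_pdf.
  apply: measurableT_comp; first exact: measurable_normal_pdf.
  exact: measurable_fst.
have h0 z : (0 <= h z)%E.
  by rewrite lee_fin !mulr_ge0 ?normal_pdf_ge0.
transitivity (\int[mu]_x \int[mu]_y h (x, y))%E.
  apply: eq_integral => x _; rewrite normal_probE// -ge0_integralZr//.
  - by apply/measurable_EFinP/measurable_funM => //; exact: measurable_normal_pdf.
  - by move=> y _; rewrite lee_fin mulr_ge0 ?normal_pdf_ge0.
  - by rewrite lee_fin normal_pdf_ge0.
rewrite fubini_tonelli// normal_probE//; apply: eq_integral => y _.
transitivity (\int[mu]_x ((\1_A y * normal_pdf 0 r y)%:E *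
   (normal_pdf (y * s ^+ 2 / r ^+ 2) (b * s / r) x)%:E))%E.
  apply: eq_integral => x _; rewrite /h /= -mulrA normal_pdf_conv// -EFinM.
  by rewrite mulrA.
rewrite ge0_integralZl//.
- by rewrite integral_normal_pdf mule1.
- by apply/measurable_EFinP; exact: measurable_normal_pdf.
- by move=> x _; rewrite lee_fin normal_pdf_ge0.
- by rewrite lee_fin mulr_ge0 ?normal_pdf_ge0.
Qed.

Lemma fin_num_normal_prob m s (A : set R) : measurable A ->
  normal_prob m s A = (fine (normal_prob m s A))%:E.
Proof.
by move=> mA; rewrite fineK//; exact: (fin_num_measure (normal_prob m s) A mA).
Qed.

Lemma measurable_normal_prob_mean b (A : set R) : b != 0 -> measurable A ->
  measurable_fun setT (fun x => normal_prob x b A).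
Proof.
move=> b0 mA.
pose h (z : R * R) : \bar R := (\1_A z.2 * normal_pdf z.1 b z.2)%:E.
have mh : measurable_fun setT h.
  by apply/measurable_EFinP; exact: measurable_indic_normal_pdf.
have h0 z : (0 <= h z)%E by rewrite lee_fin mulr_ge0 ?normal_pdf_ge0.
have := @measurable_fun_fubini_tonelli_F _ _ _ _ _ mu h mh h0.
by congr measurable_fun; apply/funext => x; rewrite (normal_probE _ _ mA).
Qed.

End NormalLaws.

#[local] Opaque normal_prob normal_pdf.

Section IidNormals.
Context {R : realType}.
Local Notation mu := (@lebesgue_measure R).

(** Adding to a centred normal variable an independent multiple of a standard
    one: in the product space the law is the mixture of the normal laws with
    mean X, which the convolution formula for the densities evaluates. *)
Lemma normal_law_product d (T : measurableType d) (P : probability T R)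
    (X : T -> R) (sg b : R) : measurable_fun setT X ->
  (forall A, measurable A -> P [set t | A (X t)] = normal_law 0 sg A) ->
  forall A, measurable A ->
    (P \x normal_prob 0 1)%E [set z | A (b * z.2 + X z.1)] =
    normal_law 0 (Num.sqrt (b ^+ 2 + sg ^+ 2)) A.
Proof.
move=> mX lawX A mA.
have E : (P \x normal_prob 0 1)%E [set z | A (b * z.2 + X z.1)] =
    (\int[P]_t normal_prob 0 1 [set y | A (b * y + X t)%R])%E.
  apply: eq_integral => t _; congr (normal_prob 0 1 _).
  by apply/seteqP; split=> y /=; rewrite /xsection/= inE.
rewrite E; have [b0|b0] := eqVneq b 0.
  rewrite b0 expr0n add0r sqrtr_sqr.
  transitivity (P [set t | A (X t)]).
    have mXA : measurable [set t | A (X t)] by rewrite -[Y in measurable Y]setTI; exact: mX.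
    transitivity (\int[P]_t (\1_[set t | A (X t)] t)%:E)%E; last first.
      by rewrite (integral_indic P measurableT mXA) setIT.
    apply: eq_integral => t _; rewrite indicE.
    have [AX|AX] := pselect (A (X t)).
      rewrite (_ : [set y | _] = setT).
        by rewrite (@probability_setT _ _ _ (normal_prob 0 1)) mem_set.
      by apply/seteqP; split=> y //= _; rewrite mul0r add0r.
    rewrite (_ : [set y | _] = set0).
      by rewrite (@measure0 _ _ _ (normal_prob 0 1)) memNset.
    by apply/seteqP; split=> y //=; rewrite mul0r add0r.
  rewrite (lawX _ mA) /normal_law normr_eq0 normal_prob_norm.
  reflexivity.
have bN0 : b ^+ 2 + sg ^+ 2 != 0.
  apply: lt0r_neq0; apply: ltr_pwDl; last exact: sqr_ge0.
  by rewrite exprn_even_gt0.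
transitivity (\int[P]_t (fine (normal_prob (X t) b A))%:E)%E.
  apply: eq_integral => t _.
  by rewrite (normal_prob_affine _ b0 mA) (fin_num_normal_prob _ _ mA).
pose f x := fine (normal_prob x b A).
have mf : measurable_fun setT f.
  apply/measurable_EFinP; rewrite (_ : _ \o _ = fun x => normal_prob x b A).
    exact: measurable_normal_prob_mean.
  by apply/funext => x; rewrite /= -fin_num_normal_prob.
have f0 x : 0 <= f x by rewrite fine_ge0.
have f1 x : `|f x| <= 1.
  rewrite (ger0_norm (f0 x)) -lee_fin /f -(fin_num_normal_prob _ _ mA).
  exact: (@probability_le1 _ _ _ (normal_prob x b)).
have mX' : measurable_fun [set: T] (X : T -> measurableTypeR R) by exact: mX.
have := @ge0_integral_pushforward _ _ _ _ R _ mX' P setT (EFin \o f) measurableT.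
rewrite preimage_setT => <-; last 2 first.
- exact/measurable_EFinP.
- by move=> x _; rewrite /= lee_fin.
have [s0|s0] := eqVneq sg 0.
  transitivity (\int[\d_(0%R : measurableTypeR R)]_x (f x)%:E)%E.
    apply: eq_measure_integral => B mB _.
    transitivity (P [set t | B (X t)]) => //.
    by rewrite (lawX _ mB) /normal_law s0 eqxx.
  rewrite integral_dirac//=; last exact/measurable_EFinP.
  rewrite diracT mul1e /f -fin_num_normal_prob// s0 expr0n addr0 sqrtr_sqr.
  by rewrite /normal_law normr_eq0 (negbTE b0) normal_prob_norm.
transitivity (\int[normal_prob 0 sg]_x (f x)%:E)%E.
  apply: eq_measure_integral => B mB _.
  transitivity (P [set t | B (X t)]) => //.
  by rewrite (lawX _ mB) /normal_law (negbTE s0).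
rewrite (integral_normal_prob _ _ mf f1) /normal_law.
rewrite ifF; last first.
  by rewrite sqrtr_eq0 leNgt lt_neqAle eq_sym bN0 addr_ge0 ?sqr_ge0.
rewrite -normal_prob_conv//; apply: eq_integral => x _.
by rewrite EFinM /f -fin_num_normal_prob.
Qed.

End IidNormals.

(** * Existence of normal vectors *)

Section PsdFactor.
Context {R : realType}.

(** Lagrange reduction: the first coordinate is split off by completing the square.
    If the pivot vanishes, positivity forces the whole first column to vanish;
    otherwise the Schur complement is again positive semidefinite. *)
Lemma psd_factor (r : nat) (S : 'M[R]_r) : covariance_matrix S ->
  exists L : 'M[R]_r, S = L *m L^T.
Proof.
elim: r S => [|r IHr] S [symS posS].
  by exists 0; rewrite [S]flatmx0 [RHS]flatmx0.
have {}IHr := IHr.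
move: S symS posS; rewrite -[r.+1]/(1 + r)%N => S symS posS.
pose s := S 0 0; pose b : 'cV[R]_r := dlsubmx S; pose D : 'M[R]_r := drsubmx S.
have SE : S = block_mx s%:M b^T b D.
  rewrite -[S]submxK; congr block_mx.
    by apply/matrixP => i j; rewrite !ord1 !mxE eqxx !lshift0.
  by rewrite /b trmx_dlsub symS.
have symD : D^T = D by rewrite /D trmx_drsub symS.
have quad (y : R) (a : 'rV[R]_r) :
    0 <= s * y ^+ 2 + 2 * y * (a *m b) 0 0 + (a *m D *m a^T) 0 0.
  have := posS (row_mx y%:M a : 'rV_(1 + r)).
  have -> : (row_mx y%:M a : 'rV_(1 + r)) *m S *m (row_mx y%:M a)^T =
      (y * s * y)%:M + y *: (a *m b) + (y *: (a *m b)^T + a *m D *m a^T).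
    rewrite {1}SE mul_row_block tr_row_mx mul_row_col !mulmxDl tr_scalar_mx.
    by rewrite -!scalar_mxM mul_mx_scalar mul_scalar_mx -scalemxAl trmx_mul.
  set M := a *m D *m a^T; set u := a *m b.
  rewrite [X in 0 <= X]mxE [X in X + _]mxE [X in _ + X]mxE.
  rewrite [(_%:M) 0 0]mxE [(y *: u) 0 0]mxE [(y *: u^T) 0 0]mxE [u^T 0 0]mxE.
  rewrite eqxx mulr1n; move: (u 0 0 : R) (M 0 0 : R) (s : R) => v w q.
  by have -> : y * q * y + y * v + (y * v + w) = q * y ^+ 2 + 2 * y * v + w by ring.
have s0 : 0 <= s by have := quad 1 0; rewrite !mul0mx !mxE; lra.
have b0 : s = 0 -> b = 0.
  move=> sz; apply/colP => i; rewrite [RHS]mxE.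
  pose a : 'rV[R]_r := delta_mx 0 i.
  have ab : (a *m b) 0 0 = b i 0 by rewrite /a -rowE mxE.
  apply/eqP/negPn/negP => u0.
  (* without the pivot the form is affine in the first coordinate, and this value
     of it would give - 1 *)
  have := quad (- ((a *m D *m a^T) 0 0 + 1) / (2 * b i 0)) a.
  rewrite sz mul0r add0r ab; set v := ((_ *m _ *m _) 0 0 : R).
  move: u0; move: (b i 0 : R) (v : R) => u w u0.
  have -> : 2 * (- (w + 1) / (2 * u)) * u + w = - 1 by field.
  by rewrite lerNr oppr0 ler10.
pose D' := D - s^-1 *: (b *m b^T).
have [L' DL'] : exists L' : 'M[R]_r, D' = L' *m L'^T.
  apply: IHr; split; first by rewrite /D' linearB/= linearZ/= trmx_mul trmxK symD.
  move=> a; have := quad (- (s^-1 * (a *m b) 0 0)) a.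
  have -> : a *m D' *m a^T = a *m D *m a^T - s^-1 *: ((a *m b) *m (a *m b)^T).
    by rewrite /D' mulmxBr mulmxBl -scalemxAr -scalemxAl trmx_mul !mulmxA.
  set u := a *m b; set M := a *m D *m a^T.
  rewrite [X in _ -> 0 <= X]mxE [X in _ -> 0 <= _ + X]mxE.
  rewrite [X in _ -> 0 <= _ - X]mxE [X in _ -> 0 <= _ - _ * X]mxE big_ord1.
  rewrite [X in _ -> 0 <= _ - _ * (_ * X)]mxE.
  move: (u 0 0 : R) (M 0 0 : R) (s : R) => {}u v q.
  have [->|q0] := eqVneq q 0; first by rewrite invr0; lra.
  suff -> : v - q^-1 * (u * u) =
            q * (- (q^-1 * u)) ^+ 2 + 2 * (- (q^-1 * u)) * u + v by [].
  by field.
exists (block_mx (Num.sqrt s)%:M 0 ((Num.sqrt s)^-1 *: b) L' : 'M[R]_(1 + r, 1 + r)).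
rewrite tr_block_mx mulmx_block !tr_scalar_mx trmx0 linearZ/=.
rewrite !mul0mx !mulmx0 !addr0 -scalar_mxM -expr2 sqr_sqrtr//.
rewrite !mul_scalar_mx !mul_mx_scalar -scalemxAr -scalemxAl !scalerA.
have bs : b = s *: (s^-1 *: b).
  have [/[dup] sz /b0 ->|sN0] := eqVneq s 0; first by rewrite !scaler0.
  by rewrite scalerA divff// scale1r.
have bs' : Num.sqrt s * (Num.sqrt s)^-1 *: b = b.
  have [/[dup] sz /b0 ->|sN0] := eqVneq s 0; first by rewrite !scaler0.
  by rewrite divff ?scale1r// sqrtr_eq0 -ltNge lt_neqAle eq_sym sN0.
rewrite -linearZ/= bs' -DL' SE /D'; congr block_mx.
by rewrite -invfM -expr2 sqr_sqrtr// addrC subrK.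
Qed.

End PsdFactor.

Section NormalVectors.
Context {R : realType}.

(** The coordinates are adjoined one at a time by products with the standard normal
    law; only the laws of linear combinations have to be followed. *)
Lemma iid_normals (r : nat) :
  exists (d : measure_display) (T : measurableType d) (P : probability T R)
    (N : T -> 'rV[R]_r),
    (forall i, measurable_fun setT (fun t => N t 0 i)) /\
    forall (a : 'rV[R]_r) (A : set R), measurable A ->
      P [set t | A (\sum_i a 0 i * N t 0 i)] =
      normal_law 0 (Num.sqrt (\sum_i a 0 i ^+ 2)) A.
Proof.
elim: r => [|r [d [T [P [N [mN lawN]]]]]].
  exists _, (measurableTypeR R), (normal_prob 0 1), (fun=> 0); split.
    by move=> i; exact: measurable_cst.
  move=> a A mA; rewrite [X in Num.sqrt X]big_ord0 sqrtr0 /normal_law eqxx diracE.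
  have [A0|A0] := pselect (A 0).
    rewrite mem_set// (_ : [set _ | _] = setT); last first.
      by apply/seteqP; split=> x //= _; rewrite big_ord0.
    exact: (@probability_setT _ _ _ (normal_prob 0 1)).
  rewrite memNset// (_ : [set _ | _] = set0); last first.
    by apply/seteqP; split=> x //=; rewrite big_ord0.
  exact: (@measure0 _ _ _ (normal_prob 0 1)).
exists _, (T * measurableTypeR R)%type, (P \x normal_prob 0 1)%E,
  (fun z => \row_i if unlift ord0 i is Some j then N z.1 0 j else z.2).
split=> [i|a A mA].
  case: (unliftP ord0 i) => [j ->|->].
    rewrite (_ : (fun _ => _) = (fun t => N t 0 j) \o fst).
      exact: measurableT_comp (mN j) measurable_fst.
    by apply/funext => z; rewrite mxE liftK.
  rewrite (_ : (fun _ => _) = snd); first exact: measurable_snd.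
  by apply/funext => z; rewrite mxE unlift_none.
pose a' : 'rV[R]_r := \row_j a 0 (lift ord0 j).
have mX : measurable_fun setT (fun t => \sum_i a' 0 i * N t 0 i).
  by apply: measurable_sum => i; exact: measurable_funM.
have := normal_law_product (a 0 ord0) mX (lawN a') mA.
rewrite sqr_sqrtr; last by apply: sumr_ge0 => i _; exact: sqr_ge0.
have E z : \sum_i a 0 i * (\row_i (if unlift ord0 i is Some j
      then N z.1 0 j else z.2 : R)) 0 i =
    a 0 ord0 * z.2 + \sum_i a' 0 i * N z.1 0 i.
  rewrite big_ord_recl [X in _ * X + _]mxE unlift_none; congr (_ + _).
  by apply: eq_bigr => i _; rewrite [X in _ * X]mxE liftK [X in _ = X * _]mxE.
have -> : \sum_i a 0 i ^+ 2 = a 0 ord0 ^+ 2 + \sum_i a' 0 i ^+ 2.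
  rewrite big_ord_recl; congr (_ + _).
  by apply: eq_bigr => i _; rewrite [X in _ = X ^+ _]mxE.
move=> <-; congr (_ _); apply/seteqP; split=> z /=; rewrite E; exact.
Qed.

(** The image of independent standard normals under a factor L of S = L L^T. *)
Lemma normal_vector_exists (r : nat) (S : 'M[R]_r) : covariance_matrix S ->
  exists (d : measure_display) (T : measurableType d) (P : probability T R)
    (Z : T -> 'rV[R]_r), normal_vector P S Z.
Proof.
move=> /psd_factor[L ->].
have [d [T [P [N [mN lawN]]]]] := iid_normals r.
exists d, T, P, (fun t => N t *m L^T); split=> [i|a A mA].
  rewrite (_ : (fun _ => _) = fun t => \sum_j N t 0 j * L^T j i).
    by apply: measurable_sum => j; apply: measurable_funM.
  by apply/funext => t; rewrite mxE.
have E t : \sum_i a 0 i * (N t *m L^T) 0 i = \sum_j (a *m L) 0 j * N t 0 j.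
  transitivity ((a *m (N t *m L^T)^T) 0 0).
    by rewrite mxE; apply: eq_bigr => i _; rewrite [X in _ = _ * X]mxE.
  by rewrite trmx_mul trmxK mulmxA mxE;
    apply: eq_bigr => i _; rewrite [X in _ * X = _]mxE.
have -> : (a *m (L *m L^T) *m a^T) 0 0 = \sum_j (a *m L) 0 j ^+ 2.
  rewrite !mulmxA -mulmxA -trmx_mul mxE; apply: eq_bigr => i _.
  by rewrite [X in _ * X = _]mxE expr2.
rewrite -(lawN _ _ mA); congr (P _).
by apply/seteqP; split=> t /=; rewrite E.
Qed.

End NormalVectors.

(** * Uniform approximation by trigonometric polynomials *)

Section TrigApproximation.
Context {R : realType} {r : nat}.
Implicit Types (x y a : 'rV[R]_r) (F G : 'rV[R]_r -> R) (b c eps : R).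

Definition dot a x : R := \sum_i a 0 i * x 0 i.

(** The span of the real and imaginary parts of the characters of the additive
    group; the phase [b] covers both sine and cosine. *)
Inductive trig_poly : ('rV[R]_r -> R) -> Prop :=
| trig_cos a b : trig_poly (fun x => cos (dot a x + b))
| trig_add F G : trig_poly F -> trig_poly G -> trig_poly (fun x => F x + G x)
| trig_scale c F : trig_poly F -> trig_poly (fun x => c * F x).

Lemma trig_poly_cst c : trig_poly (fun=> c).
Proof.
rewrite (_ : (fun=> c) = fun x => c * cos (dot 0 x + 0)).
  exact/trig_scale/trig_cos.
apply/funext => x; rewrite /dot big1 ?addr0 ?cos0 ?mulr1// => i _.
by rewrite mxE mul0r.
Qed.

(** Products of cosines are sums of cosines. *)
Lemma trig_poly_mul F G : trig_poly F -> trig_poly G ->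
  trig_poly (fun x => F x * G x).
Proof.
move=> tF tG; elim: tF => [a b|F1 F2 _ IH1 _ IH2|c F1 _ IH1].
- elim: tG => [a' b'|G1 G2 _ IH1 _ IH2|c G1 _ IH1].
  + have -> : (fun x => cos (dot a x + b) * cos (dot a' x + b')) =
      (fun x => 2^-1 * (cos (dot (a + a') x + (b + b')) +
                        cos (dot (a - a') x + (b - b')))).
      apply/funext => x.
      have -> : dot (a + a') x + (b + b') = (dot a x + b) + (dot a' x + b').
        rewrite addrACA; congr (_ + _); rewrite /dot -big_split/=.
        by apply: eq_bigr => i _; rewrite mxE mulrDl.
      have -> : dot (a - a') x + (b - b') = (dot a x + b) - (dot a' x + b').
        rewrite opprD addrACA; congr (_ + _); rewrite /dot -sumrB.
        by apply: eq_bigr => i _; rewrite !mxE mulrBl.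
      move: (dot a x + b) (dot a' x + b') => u v.
      by rewrite cosD cosB; field.
    by apply: trig_scale; apply: trig_add; exact: trig_cos.
  + by under eq_fun do rewrite mulrDr; exact: trig_add.
  + by under eq_fun do rewrite mulrCA; exact: trig_scale.
- by under eq_fun do rewrite mulrDl; exact: trig_add.
- by under eq_fun do rewrite -mulrA; exact: trig_scale.
Qed.

Lemma trig_poly_sin i c : trig_poly (fun x => sin (c * x 0 i)).
Proof.
have -> : (fun x => sin (c * x 0 i)) =
    fun x => cos (dot (c *: delta_mx 0 i) x + - (pi / 2)).
  apply/funext => x; rewrite cosBpihalf; congr sin.
  rewrite /dot (bigD1 i)//= big1 ?addr0 => [|j ji]; rewrite !mxE eqxx/=.
    by rewrite eqxx mulr1.
  by rewrite (negbTE ji) mulr0 mul0r.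
exact: trig_cos.
Qed.

(** Expectation of [f] at the end of a walk on 'rV[R]_r that starts at [y] and,
    for each entry [i] of the list, moves by [h] in direction [i] with
    probability [u i]. With every direction occurring n times and h = 1 / n
    this is the r-dimensional Bernstein operator; the recursive form makes its
    moments immediate. *)
Fixpoint walk_mean (u : 'I_r -> R) (h : R) (s : seq 'I_r)
    (f : 'rV[R]_r -> R) (y : 'rV[R]_r) : R :=
  if s is i :: s' then
    u i * walk_mean u h s' f (y + h *: delta_mx 0 i) +
    (1 - u i) * walk_mean u h s' f y
  else f y.

Lemma walk_mean_linear u h s c (f g : 'rV[R]_r -> R) y :
  walk_mean u h s (fun z => c * f z + g z) y =
  c * walk_mean u h s f y + walk_mean u h s g y.
Proof. by elim: s y => //= i s IH y; rewrite !IH; ring. Qed.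

Lemma walk_mean_cst u h s c y : walk_mean u h s (fun=> c) y = c.
Proof. by elim: s y => //= i s IH y; rewrite !IH; ring. Qed.

Lemma walk_mean_sum u h s (J : finType) (f : J -> 'rV[R]_r -> R) y :
  walk_mean u h s (fun z => \sum_j f j z) y = \sum_j walk_mean u h s (f j) y.
Proof.
elim: s y => //= i s IH y; rewrite !IH !mulr_sumr -big_split/=.
exact: eq_bigr.
Qed.

Lemma walk_mean_le u h s (f g : 'rV[R]_r -> R) y :
  (forall i, 0 <= u i <= 1) -> (forall z, f z <= g z) ->
  walk_mean u h s f y <= walk_mean u h s g y.
Proof.
move=> u01 fg; elim: s y => //= i s IH y.
by have /andP[u0 u1] := u01 i; rewrite lerD// ler_wpM2l ?subr_ge0.
Qed.

(** Squared bias plus variance. *)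
Lemma walk_mean_variance u h s i c y :
  walk_mean u h s (fun z => (z 0 i - c) ^+ 2) y =
  (y 0 i + (count_mem i s)%:R * h * u i - c) ^+ 2 +
  (count_mem i s)%:R * h ^+ 2 * (u i * (1 - u i)).
Proof.
elim: s y => [|j s IH] y /=; first by rewrite !mul0r !addr0.
rewrite !IH !mxE eqxx /= [i == j]eq_sym.
case: eqVneq => [->|_]; rewrite /= ?mulr1 ?mulr0 ?add0n ?add1n; last by ring.
by rewrite -natr1; ring.
Qed.

Lemma trig_poly_walk_mean (u : 'I_r -> 'rV[R]_r -> R) h s f y :
  (forall i, trig_poly (u i)) ->
  trig_poly (fun x => walk_mean (u ^~ x) h s f y).
Proof.
move=> tu; elim: s y => [|i s IH] y /=; first exact: trig_poly_cst.
apply: trig_add; apply: trig_poly_mul => //.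
rewrite (_ : (fun _ => _) = fun x => 1 + -1 * u i x).
  by apply: trig_add; [exact: trig_poly_cst|exact: trig_scale].
by apply/funext => x; rewrite mulN1r.
Qed.

Lemma continuous_rV_dist F x eps : {for x, continuous F} -> 0 < eps ->
  exists2 del : R, 0 < del &
    forall y, (forall i, `|y 0 i - x 0 i| < del) -> `|F y - F x| < eps.
Proof.
move=> Fx e0; have /cvgrPdist_lt/(_ _ e0) := Fx.
rewrite nearE => /nbhs_ballP[del /= del0 H]; exists del => // y xy.
rewrite distrC; apply: H; split=> // i j; rewrite !ord1 /ball/= distrC.
exact: xy.
Qed.

(** Heine-Cantor with the first point only in the compact box. *)
Lemma unif_continuous_box F (L : R) eps : continuous F -> 0 < eps ->
  exists2 del : R, 0 < del & forall x y, (forall i, `|x 0 i| <= L) ->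
    (forall i, `|y 0 i - x 0 i| < del) -> `|F y - F x| < eps.
Proof.
move=> cF e0.
have K : compact [set x : 'rV[R]_r | forall i, `[- L, L]%classic (x 0 i)].
  apply: (@rV_compact R r (fun=> `[- L, L]%classic)) => i.
  exact: segment_compact.
move/compact_near_coveringP : K => /(_ _ (0^'+) (fun d x => forall y,
  (forall i, `|y 0 i - x 0 i| < d) -> `|F y - F x| < eps)).
have e20 : 0 < eps / 2 by rewrite divr_gt0.
case=> [x _|del /= del0 H].
- have [del del0 H] := continuous_rV_dist (cF x) e20.
  exists (ball x (del / 2), [set d | d < del / 2]).
    split; first by apply: nbhsx_ballx; rewrite divr_gt0.
    by apply: nbhs_right_lt; rewrite divr_gt0.
  move=> [x' d] /= [[_ xx'] dd] y yx'.
  have xx i : `|x' 0 i - x 0 i| < del / 2 by have := xx' 0 i; rewrite /ball/= distrC.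
  rewrite -(subrKA (F x)) (le_lt_trans (ler_normD _ _))// (splitr eps) ltrD//.
    apply: H => i; rewrite -(subrKA (x' 0 i)) (le_lt_trans (ler_normD _ _))//.
    by rewrite (splitr del) ltrD// (lt_trans (yx' i)).
  rewrite distrC; apply: H => i; rewrite (lt_trans (xx i))//.
  by rewrite ltr_pdivrMr// ltr_pMr// ltr1n.
exists (del / 2); first by rewrite divr_gt0.
move=> x y xL; apply: (H (del / 2)) => /=.
- rewrite /ball_/= sub0r normrN gtr0_norm ?divr_gt0//.
  by rewrite ltr_pdivrMr// ltr_pMr// ltr1n.
- by rewrite divr_gt0.
- by move=> i; rewrite /= in_itv/= -ler_norml.
Qed.

(** The derivative of the sine is at least [cos 1] on [-1, 1]. *)
Lemma sin_chord (x y : R) : -1 <= x <= 1 -> -1 <= y <= 1 ->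
  cos 1 * `|x - y| <= `|sin x - sin y|.
Proof.
wlog xy : x y / y <= x => [H Hx Hy|/andP[x1 x2] /andP[y1 y2]].
  have [/H->//|/ltW/H] := leP y x.
  by rewrite distrC [`|sin y - _|]distrC; apply.
have cs : {within `[y, x], continuous (@sin R)}.
  by apply: continuous_subspaceT; exact: continuous_sin.
have ds z : z \in `]y, x[ -> is_derive z (1 : R) sin (cos z) by move=> _; exact: is_derive_sin.
have [c /[!in_itv]/= /andP[c1 c2] ->] := MVT_segment xy ds cs.
rewrite normrM ler_wpM2r//.
have c0 : cos 1 <= cos c.
  have -> : cos c = cos `|c| by case: (ler0P c) => // _; rewrite cosN.
  have p2 := @pi_ge2 R.
  rewrite leNgt ltr_cos ?in_itv/= -?leNgt.
  - by rewrite ler_norml; apply/andP; split; lra.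
  - by apply/andP; split; lra.
  - rewrite normr_ge0/= (@le_trans _ _ 1)//; last lra.
    by rewrite ler_norml; apply/andP; split; lra.
by rewrite (le_trans c0)// ler_norm.
Qed.

(** A left inverse of y |-> (1 + sin y) / 2 on [-1, 1], extended by the endpoints
    outside the range; the inequality is its Lipschitz property. *)
Lemma clamped_arcsin : exists al : R -> R, forall v : R,
  -1 <= al v <= 1 /\ forall y : R, -1 <= y <= 1 ->
    cos 1 * `|al v - y| <= `|2 * v - 1 - sin y|.
Proof.
have H (v : R) : exists a : R, -1 <= a <= 1 /\ forall y : R, -1 <= y <= 1 ->
    cos 1 * `|a - y| <= `|2 * v - 1 - sin y|.
  set w := 2 * v - 1.
  have sN : sin (-1) = - sin 1 :> R by rewrite sinN.
  have smono (y z : R) : -1 <= y <= 1 -> -1 <= z <= 1 -> y <= z -> sin y <= sin z.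
    move=> /andP[y1 y2] /andP[z1 z2]; have p1 := @pihalf_ge1 R.
    rewrite !leNgt ltr_sin ?in_itv/=; first by [].
      by apply/andP; split; lra.
    by apply/andP; split; lra.
  have [w1|w1] := ltP w (sin (-1)).
    exists (-1); split; first by apply/andP; split; lra.
    move=> y Hy; rewrite (le_trans (sin_chord _ Hy))//; first by apply/andP; split; lra.
    case/andP: (Hy) => y1 _; have H1 : sin (-1) <= sin y.
      by apply: smono => //; apply/andP; split; lra.
    by rewrite !ler0_norm ?subr_le0 ?(le_trans (ltW w1))//; lra.
  have [w2|w2] := ltP (sin 1) w.
    exists 1; split; first by apply/andP; split; lra.
    move=> y Hy; rewrite (le_trans (sin_chord _ Hy))//; first by apply/andP; split; lra.
    case/andP: (Hy) => _ y1; have H1 : sin y <= sin 1.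
      by apply: smono => //; apply/andP; split; lra.
    by rewrite !ger0_norm ?subr_ge0 ?(le_trans H1 (ltW w2))//; lra.
  have [] := @IVT R sin (-1) 1 w.
  - lra.
  - by apply: continuous_subspaceT; exact: continuous_sin.
  - have H1 : sin (-1) <= sin 1 :> R.
      by apply: smono; [apply/andP; split; lra|apply/andP; split; lra|lra].
    by rewrite (min_idPl H1) (max_idPr H1) w1 w2.
  move=> a /[!in_itv]/= Ha <-; exists a; split=> // y; exact: sin_chord.
have [al Hal] := choice H.
by exists al.
Qed.

(** Uniform approximation on boxes. The coordinates u_i = (1 + sin (x_i / L)) / 2
    embed the box of half side L into the unit cube and are themselves
    trigonometric, so a Bernstein operator in the u_i produces trigonometric
    polynomials; being averages of values of F they inherit its bound outside
    the box too. *)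
Lemma trig_approx F (M L eps : R) : continuous F -> (forall x, `|F x| <= M) ->
  0 < L -> 0 < eps ->
  exists2 G, trig_poly G &
    (forall x, `|G x| <= M) /\
    forall x, (forall i, `|x 0 i| <= L) -> `|F x - G x| <= eps.
Proof.
move=> cF FM L0 e0.
have [al Hal] := clamped_arcsin.
have e20 : 0 < eps / 2 by rewrite divr_gt0.
have [del del0 Hdel] := @unif_continuous_box F L _ cF e20.
have M0 : 0 <= M by rewrite (le_trans _ (FM 0)).
have c1 : 0 < cos 1 :> R := cos1_gt0 R.
pose Phi (v : 'rV[R]_r) := F (\row_i (L * al (v 0 i))).
pose u i x : R := 2^-1 * (1 + sin (L^-1 * x 0 i)).
have u01 i x : 0 <= u i x <= 1.
  have := sin_geN1 (L^-1 * x 0 i); have := sin_le1 (L^-1 * x 0 i).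
  by rewrite /u => ? ?; apply/andP; split; lra.
pose Cc : R := 2 * M / del ^+ 2 * (L * (2 / cos 1)) ^+ 2.
have Cc0 : 0 <= Cc.
  by rewrite mulr_ge0 ?sqr_ge0// divr_ge0 ?sqr_ge0// mulr_ge0.
pose n := Num.bound (Cc * r%:R / (eps / 2)).
have nP : Cc * r%:R / (eps / 2) < n.+1%:R.
  apply: (@lt_trans _ _ n%:R); last by rewrite ltr_nat.
  apply: archi_boundP; apply: divr_ge0; last exact: ltW.
  by apply: mulr_ge0.
pose h : R := n.+1%:R^-1.
pose s := flatten [seq nseq n.+1 i | i <- enum 'I_r].
have sP i : count_mem i s = n.+1.
  rewrite count_flatten sumnE 2!big_map big_enum/= (bigD1 i)//= big1 ?addn0.
    by rewrite count_nseq/= eqxx mul1n.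
  by move=> j ji; rewrite count_nseq/= (negbTE ji).
have near_box x z : (forall i, `|x 0 i| <= L) ->
    `|F x - Phi z| <= eps / 2 + Cc * \sum_i (z 0 i - u i x) ^+ 2.
  move=> xL.
  have S0 : 0 <= \sum_i (z 0 i - u i x) ^+ 2 by apply: sumr_ge0 => i _; exact: sqr_ge0.
  have [H|] := pselect (forall i, `|L * al (z 0 i) - x 0 i| < del).
    rewrite distrC (@le_trans _ _ (eps / 2))//; last first.
      by rewrite lerDl mulr_ge0.
    by apply/ltW/(Hdel x) => // i; rewrite mxE.
  move=> /existsNP[i /negP]; rewrite -leNgt => Hi.
  have F2 : `|F x - Phi z| <= 2 * M.
    apply: (le_trans (ler_normB _ _)).
    by rewrite mulr_natl mulr2n; apply: lerD; exact: FM.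
  apply: (le_trans F2); apply: (@le_trans _ _ (Cc * (z 0 i - u i x) ^+ 2)).
    suff H2 : del ^+ 2 <= (L * (2 / cos 1)) ^+ 2 * (z 0 i - u i x) ^+ 2.
      rewrite /Cc -[leLHS]mulr1 -[leRHS]mulrA -[leRHS]mulrA.
      apply: ler_wpM2l; first exact: mulr_ge0.
      by rewrite mulrC ler_pdivlMr ?exprn_gt0// mul1r.
    rewrite -exprMn -[leRHS]real_normK ?num_real//.
    rewrite lerXn2r ?nnegrE ?(ltW del0)// (le_trans Hi)//.
    have x1 : -1 <= L^-1 * x 0 i <= 1.
      by rewrite -ler_norml normrM gtr0_norm ?invr_gt0// mulrC ler_pdivrMr// mul1r.
    have [_ /(_ _ x1)] := Hal (z 0 i).
    have -> : 2 * z 0 i - 1 - sin (L^-1 * x 0 i) = 2 * (z 0 i - u i x).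
      by rewrite /u; field.
    rewrite normrM (ger0_norm (ler0n _ 2)) => H1.
    have -> : L * al (z 0 i) - x 0 i = L * (al (z 0 i) - L^-1 * x 0 i).
      by rewrite mulrBr mulVKf// gt_eqF.
    have c2 : 0 < 2 / cos 1 :> R by rewrite divr_gt0.
    rewrite normrM [leRHS]normrM (gtr0_norm L0) (gtr0_norm (mulr_gt0 L0 c2)).
    rewrite -mulrA ler_wpM2l ?(ltW L0)//.
    by rewrite mulrAC ler_pdivlMr// mulrC.
  apply: (@le_trans _ _ (Cc * \sum_j (z 0 j - u j x) ^+ 2)).
    rewrite ler_wpM2l// (bigD1 i)//= lerDl; apply: sumr_ge0 => j _; exact: sqr_ge0.
  by rewrite lerDr ltW.
exists (fun x => walk_mean (u ^~ x) h s Phi 0).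
  apply: trig_poly_walk_mean => i; apply: trig_scale; apply: trig_add.
    exact: trig_poly_cst.
  exact: trig_poly_sin.
split=> [x|x xL].
  have PM z : - M <= Phi z <= M by rewrite -ler_norml FM.
  have W0 c := walk_mean_cst (u ^~ x) h s c 0.
  rewrite ler_norml; apply/andP; split.
    by rewrite -[leLHS](W0 (- M)); apply: walk_mean_le => // z; case/andP: (PM z).
  by rewrite -[leRHS](W0 M); apply: walk_mean_le => // z; case/andP: (PM z).
pose V (z : 'rV[R]_r) : R := \sum_i (z 0 i - u i x) ^+ 2.
have WV c : walk_mean (u ^~ x) h s (fun z => Cc * V z + c) 0 <= eps / 2 + c.
  rewrite walk_mean_linear walk_mean_cst lerD2r walk_mean_sum.
  rewrite (@le_trans _ _ (Cc * (r%:R * h)))//; last first.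
    by rewrite mulrA /h ler_pdivrMr ?ltr0Sn// [leRHS]mulrC -ler_pdivrMr// ltW.
  have -> : r%:R * h = \sum_(i < r) h by rewrite sumr_const card_ord mulr_natl.
  rewrite ler_wpM2l//; apply: ler_sum => i _; rewrite walk_mean_variance sP mxE.
  have n0 : n.+1%:R != 0 :> R by rewrite pnatr_eq0.
  have -> : (0 + n.+1%:R * h * u i x - u i x) ^+ 2 +
      n.+1%:R * h ^+ 2 * (u i x * (1 - u i x)) = h * (u i x * (1 - u i x)).
    by rewrite /h; move: (u i x) (n.+1%:R : R) n0 => w q q0; field.
  rewrite ler_piMr ?invr_ge0//.
  by have /andP[u0 u1] := u01 i x; rewrite mulr_ile1 ?subr_ge0// lerBlDl lerDr.
rewrite ler_norml; apply/andP; split.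
- rewrite lerBrDr -lerBrDl opprK.
  apply: (@le_trans _ _ (walk_mean (u ^~ x) h s (fun z => Cc * V z + (F x + eps / 2)) 0)).
    apply: walk_mean_le => // z; have := near_box x z xL.
    by rewrite ler_norml -/(V z) => /andP[]; lra.
  by rewrite (le_trans (WV _))//; lra.
- rewrite lerBlDl -lerBlDr.
  have : walk_mean (u ^~ x) h s (fun z => -1 * (Cc * V z + (- F x + eps / 2)) + 0) 0
      <= walk_mean (u ^~ x) h s Phi 0.
    apply: walk_mean_le => // z; have := near_box x z xL.
    by rewrite ler_norml -/(V z) => /andP[]; lra.
  rewrite walk_mean_linear walk_mean_cst.
  by have := WV (- F x + eps / 2); lra.
Qed.

End TrigApproximation.

(** * Elementary inequalities *)

Section TaylorBounds.
Context {R : realType}.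
Implicit Types (t v x : R).

(** Mean value theorem. *)
Lemma norm_le_deriv (f df : R -> R) t B : f 0 = 0 ->
  (forall x, is_derive x (1 : R) f (df x)) ->
  (forall x, `|x| <= `|t| -> `|df x| <= B) -> `|f t| <= B * `|t|.
Proof.
move=> f0 fd dB.
have cf a b : {within `[a, b], continuous f}.
  apply: continuous_subspaceT => x; apply: differentiable_continuous.
  exact/derivable1_diffP/ex_derive.
have [t0|t0] := leP 0 t.
  have [c /[!in_itv]/= /andP[c0 ct]] := MVT_segment t0 (fun x _ => fd x) (cf _ _).
  rewrite f0 !subr0 => ->; rewrite normrM ler_wpM2r//; apply: dB.
  by rewrite !ger0_norm.
have [c /[!in_itv]/= /andP[ct c0]] := MVT_segment (ltW t0) (fun x _ => fd x) (cf _ _).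
rewrite f0 !sub0r -normrN => ->; rewrite normrM normrN ler_wpM2r//; apply: dB.
by rewrite !ler0_norm ?lerN2// ltW.
Qed.

Lemma norm_sin_le t : `|sin t| <= `|t|.
Proof.
rewrite -[leRHS]mul1r; apply: (@norm_le_deriv sin cos) => [|x _].
- exact: sin0.
- by rewrite ler_norml cos_geN1 cos_le1.
Qed.

Lemma norm_cosD_le b t : `|cos (t + b) - cos b| <= `|t|.
Proof.
rewrite -[leRHS]mul1r.
apply: (@norm_le_deriv (fun t => cos (t + b) - cos b) (fun t => - sin (t + b))).
- by rewrite add0r subrr.
- move=> x; apply: is_derive_eq.
  by rewrite ?(oppr0, addr0, add0r, scaler1, scaler0) /GRing.scale/= ?(addr0, mul1r, mulr1).
- by move=> x _; rewrite normrN ler_norml sin_geN1 sin_le1.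
Qed.

Lemma norm_cos1_le t : `|cos t - 1| <= `|t| ^+ 2.
Proof.
rewrite expr2; apply: (@norm_le_deriv (fun x => cos x - 1) (fun x => - sin x)).
- by rewrite cos0 subrr.
- by move=> x; apply: is_derive_eq; rewrite ?(oppr0, addr0, add0r, scaler1, scaler0).
- by move=> x xt; rewrite normrN (le_trans (norm_sin_le x)).
Qed.

Lemma norm_sinB_le t : `|sin t - t| <= `|t| ^+ 3.
Proof.
rewrite exprSr; apply: (@norm_le_deriv (fun x => sin x - x) (fun x => cos x - 1)).
- by rewrite sin0 subrr.
- by move=> x xt; rewrite (le_trans (norm_cos1_le x))// lerXn2r ?nnegrE.
Qed.

Lemma norm_cosB_le t : `|cos t - 1 + t ^+ 2 / 2| <= `|t| ^+ 4.
Proof.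
pose f x : R := cos x - 1 + x ^+ 2 / 2.
have df x : is_derive x (1 : R) f (- (sin x - x)).
  apply: is_derive_eq; rewrite ?(oppr0, addr0, add0r, scaler1, scaler0).
  by rewrite /GRing.scale/=; field.
rewrite [leRHS]exprSr; apply: (@norm_le_deriv f _ t _ _ df).
- by rewrite /f cos0 subrr add0r expr0n mul0r.
- by move=> x xt; rewrite normrN (le_trans (norm_sinB_le x))// lerXn2r ?nnegrE.
Qed.

Lemma norm_sinB_le2 t : `|t - sin t| <= 2 * t ^+ 2.
Proof.
have s1 := sin_le1 t; have s2 := sin_geN1 t.
rewrite -[t ^+ 2]real_normK ?num_real//.
have [t1|t1] := leP `|t| 1.
  rewrite distrC (le_trans (norm_sinB_le t))// exprSr -[leLHS]mulr1.
  rewrite -mulrA mulrC ler_wpM2r ?sqr_ge0//.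
  by rewrite mulr1 (le_trans t1)// ler1n.
rewrite (le_trans (ler_normB _ _))//.
have : `|sin t| <= 1 by rewrite ler_norml s1 s2.
have : 1 <= `|t| ^+ 2 by rewrite exprn_ege1// ltW.
have : `|t| <= `|t| ^+ 2 by rewrite expr2 ler_peMl// ltW.
by lra.
Qed.

Lemma expR_le_taylor v : `|v| <= 1 -> expR v <= 1 + v + expR 1 * v ^+ 2.
Proof.
move=> v1.
have E1 x : `|x| <= 1 -> `|expR x - 1| <= expR 1 * `|x|.
  move=> x1; apply: (@norm_le_deriv (fun x => expR x - 1) expR).
  - by rewrite expR0 subrr.
  - by move=> y; apply: is_derive_eq; rewrite ?(oppr0, addr0, add0r, scaler1, scaler0).
  - move=> y yx; rewrite ger0_norm ?expR_ge0// ler_expR.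
    by rewrite (le_trans (ler_norm _))// (le_trans yx).
have : `|expR v - 1 - v| <= (expR 1 * `|v|) * `|v|.
  apply: (@norm_le_deriv (fun x => expR x - 1 - x) (fun x => expR x - 1)).
  - by rewrite expR0 !subr0 subrr.
  - by move=> y; apply: is_derive_eq; rewrite ?(oppr0, addr0, add0r, scaler1, scaler0).
  - move=> y yv; rewrite (le_trans (E1 _ (le_trans yv v1)))//.
    by rewrite ler_wpM2l// expR_ge0.
rewrite -mulrA -expr2 real_normK ?num_real// => H.
by have := ler_norm (expR v - 1 - v); lra.
Qed.

(** The expansion, in the increment [v], of the cosine at a point reached by one
    more jump. *)
Lemma cosD_taylor u v : `|v| <= 1 ->
  `|cos (u + v) - (cos u - v * sin u - v ^+ 2 / 2 * cos u)| <= 2 * `|v| ^+ 3.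
Proof.
move=> v1; rewrite cosD.
have -> : cos u * cos v - sin u * sin v - (cos u - v * sin u - v ^+ 2 / 2 * cos u)
  = cos u * (cos v - 1 + v ^+ 2 / 2) - sin u * (sin v - v) by field.
rewrite (le_trans (ler_normB _ _))// !normrM mulr_natl mulr2n lerD//.
  rewrite (@le_trans _ _ (1 * `|v| ^+ 4))//; last first.
    by rewrite mul1r exprS ler_piMl// exprn_ge0.
  by rewrite ler_pM ?norm_cosB_le// ler_norml cos_geN1 cos_le1.
rewrite (@le_trans _ _ (1 * `|v| ^+ 3))//; last by rewrite mul1r.
by rewrite ler_pM ?norm_sinB_le// ler_norml sin_geN1 sin_le1.
Qed.

(** One term of the exponential series; it turns exponential moments into moments. *)
Lemma exprn_le_expD x n : `|x| ^+ n <= n`!%:R * (expR x + expR (- x)).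
Proof.
have E : `|x| ^+ n <= n`!%:R * expR `|x|.
  case: n => [|n]; first by rewrite expr0 mul1r -[leLHS]expR0 ler_expR.
  have := @expR_ge1Dxn R `|x| n (normr_ge0 x).
  have n0 : 0 < (n.+1)`!%:R :> R by rewrite ltr0n fact_gt0.
  rewrite -ler_pdivrMl// mulrC => H.
  by rewrite (le_trans _ H)// lerDr.
apply: (le_trans E); rewrite ler_wpM2l//.
by case: (ler0P x) => _; rewrite ?lerDl ?lerDr expR_ge0.
Qed.

End TaylorBounds.

(** * Weak convergence from characteristic functions *)

Section MethodOfCharacters.
Context {R : realType} {r : nat}.
Implicit Types (F G : 'rV[R]_r -> R) (x a : 'rV[R]_r) (c b M : R).

(** An abstract expectation, so that laws given by finite weighted sums need
    not be turned into measures. *)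
Definition mean_functional (E : ('rV[R]_r -> R) -> R) : Prop :=
  [/\ E (fun=> 1) = 1, (forall F G, E (fun x => F x + G x) = E F + E G),
      (forall c F, E (fun x => c * F x) = c * E F) &
      forall F G, (forall x, F x <= G x) -> E F <= E G].

Lemma mean_dist E F G H : mean_functional E ->
  (forall x, `|F x - G x| <= H x) -> `|E F - E G| <= E H.
Proof.
move=> [E1 ED EZ Ele] FGH.
have EN F' : E (fun x => - F' x) = - E F'.
  by rewrite -mulN1r -EZ; congr E; apply/funext => x; rewrite mulN1r.
rewrite ler_norml; apply/andP; split.
  by rewrite -EN -EN -ED; apply: Ele => x; have := FGH x; rewrite ler_norml => /andP[].
by rewrite -EN -ED; apply: Ele => x; have := FGH x; rewrite ler_norml => /andP[].
Qed.

Lemma mean_cst E c : mean_functional E -> E (fun=> c) = c.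
Proof.
move=> [E1 _ EZ _]; rewrite -[RHS]mulr1 -E1 -EZ.
by congr E; apply/funext => x; rewrite mulr1.
Qed.

Lemma mean_sum E (I : Type) (s : seq I) (F : I -> 'rV[R]_r -> R) :
  mean_functional E ->
  E (fun x => \sum_(i <- s) F i x) = \sum_(i <- s) E (F i).
Proof.
move=> mE; case: (mE) => _ ED _ _; elim: s => [|i s IH].
  by rewrite big_nil -[RHS](mean_cst 0 mE); congr E; apply/funext => x; rewrite big_nil.
by rewrite big_cons -IH -ED; congr E; apply/funext => x; rewrite big_cons.
Qed.

Lemma trig_poly_bounded F : trig_poly F -> exists M, forall x, `|F x| <= M.
Proof.
elim=> [a b|{}F G _ [M1 H1] _ [M2 H2]|c {}F _ [M H]].
- by exists 1 => x; rewrite ler_norml cos_geN1 cos_le1.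
- by exists (M1 + M2) => x; rewrite (le_trans (ler_normD _ _))// lerD.
- by exists (`|c| * M) => x; rewrite normrM ler_wpM2l.
Qed.

Lemma trig_seq F M : continuous F -> (forall x, `|F x| <= M) ->
  exists G : nat -> 'rV[R]_r -> R, forall k,
    [/\ trig_poly (G k), (forall x, `|G k x| <= M) &
      forall x, (forall i, `|x 0 i| <= k.+1%:R) -> `|F x - G k x| <= k.+1%:R^-1].
Proof.
move=> cF FM.
have H (k : nat) : exists g : 'rV[R]_r -> R, [/\ trig_poly g,
    (forall x, `|g x| <= M) &
    forall x, (forall i, `|x 0 i| <= k.+1%:R) -> `|F x - g x| <= k.+1%:R^-1].
  have k0 : 0 < k.+1%:R :> R by rewrite ltr0Sn.
  have k1 : 0 < k.+1%:R^-1 :> R by rewrite invr_gt0.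
  by have [g tg [gM gF]] := trig_approx cF FM k0 k1; exists g.
by have [G HG] := choice H; exists G.
Qed.

Lemma trig_seq_cvg F (G : nat -> 'rV[R]_r -> R) x :
  (forall k x, (forall i, `|x 0 i| <= k.+1%:R) -> `|F x - G k x| <= k.+1%:R^-1) ->
  G k x @[k --> \oo] --> F x.
Proof.
move=> H; apply/cvgrPdist_le => /= e e0; near=> k.
have xk : forall i, `|x 0 i| <= k.+1%:R.
  have : \sum_i `|x 0 i| <= k%:R by near: k; apply: nbhs_infty_ger.
  move=> S i; rewrite (@le_trans _ _ k%:R) ?ler_nat// (le_trans _ S)//.
  by rewrite (bigD1 i)//= lerDl sumr_ge0.
rewrite (le_trans (H _ _ xk))// invf_ple ?posrE// ?ltr0Sn//.
rewrite (@le_trans _ _ k%:R) ?ler_nat//; near: k; exact: nbhs_infty_ger.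
Unshelve. all: by end_near. Qed.

Section LimitLaw.
Context d (T : measurableType d) (P : probability T R) (Z : T -> 'rV[R]_r).
Hypothesis mZ : forall i, measurable_fun setT (fun t => Z t 0 i).

Lemma measurable_dot a : measurable_fun setT (fun t => dot a (Z t)).
Proof. by apply: measurable_sum => i; exact: measurable_funM. Qed.

Lemma measurable_trig_poly F : trig_poly F -> measurable_fun setT (F \o Z).
Proof.
elim=> [a b|{}F G _ H1 _ H2|c {}F _ H].
- apply: (measurableT_comp (continuous_measurable_fun (@continuous_cos R))).
  by apply: measurable_funD => //; exact: measurable_dot.
- exact: measurable_funD.
- exact: measurable_funM.
Qed.

(** Measurable coordinates suffice because F is a pointwise limit of trigonometric
    polynomials. *)
Lemma measurable_continuous_rV F M : continuous F -> (forall x, `|F x| <= M) ->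
  measurable_fun setT (F \o Z).
Proof.
move=> cF FM; have [G HG] := trig_seq cF FM.
apply: (@measurable_fun_cvg _ _ _ _ (fun k => G k \o Z)) => [k|t _].
  by case: (HG k) => tG _ _; exact: measurable_trig_poly.
by apply: trig_seq_cvg => k x; case: (HG k) => _ _; exact.
Qed.

Lemma integrable_bounded (f : T -> R) M : measurable_fun setT f ->
  (forall t, `|f t| <= M) -> P.-integrable setT (EFin \o f).
Proof.
move=> mf fM; apply: (@le_integrable _ _ _ P _ measurableT _ (cst M%:E)).
- exact/measurable_EFinP.
- by move=> t _ /=; rewrite lee_fin (le_trans (fM t))// ler_norm.
- exact: finite_measure_integrable_cst.
Qed.

Let EZ F : R := \int[P]_t F (Z t).

Lemma integral_Rintegral F M : measurable_fun setT (F \o Z) ->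
  (forall x, `|F x| <= M) -> (\int[P]_t (F (Z t))%:E = (EZ F)%:E)%E.
Proof.
move=> mF FM; rewrite fineK//; apply: integrable_fin_num => //.
by apply: (integrable_bounded mF) => t; exact: FM.
Qed.

Lemma cvg_EZ F M (G : nat -> 'rV[R]_r -> R) :
  measurable_fun setT (F \o Z) -> (forall k, measurable_fun setT (G k \o Z)) ->
  (forall x, `|F x| <= M) -> (forall k x, `|G k x| <= M) ->
  (forall x, G k x @[k --> \oo] --> F x) ->
  EZ (G k) @[k --> \oo] --> EZ F.
Proof.
move=> mF mG FM GM GF.
apply: (@fine_cvg _ _ _ _ (fun k => \int[P]_t (G k (Z t))%:E)%E).
rewrite -(integral_Rintegral mF FM).
apply: (@dominated_cvg _ _ _ P setT measurableT _ _ (cst M%:E)).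
- by move=> k; apply/measurable_EFinP; exact: mG.
- by move=> t _; apply: cvg_EFin; [exact: nearW|exact: GF].
- by [].
- exact: finite_measure_integrable_cst.
- by move=> k t _; rewrite /= lee_fin.
Qed.

(** Convergence of characteristic functions gives convergence for trigonometric
    polynomials. These approximate F on a large box, and the second moments bound
    the contribution of the complement of the box uniformly in n. *)
Theorem cvg_bounded_of_char (E : nat -> ('rV[R]_r -> R) -> R) (K : R) :
  (forall n, mean_functional (E n)) ->
  (forall a b, E n (fun x => cos (dot a x + b)) @[n --> \oo] -->
               EZ (fun x => cos (dot a x + b))) ->
  (forall n, E n (fun x => \sum_i x 0 i ^+ 2) <= K) ->
  forall F M, continuous F -> (forall x, `|F x| <= M) ->
    E n F @[n --> \oo] --> EZ F.
Proof.
move=> mE chE tight F M cF FM; have [G HG] := trig_seq cF FM.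
have tG k : trig_poly (G k) by case: (HG k).
have K0 : 0 <= K.
  rewrite (le_trans _ (tight 0%N))// -[leLHS](mean_cst 0 (mE 0%N)).
  case: (mE 0%N) => _ _ _; apply=> x; apply: sumr_ge0 => i _; exact: sqr_ge0.
have M0 : 0 <= M by rewrite (le_trans _ (FM 0)).
have Etrig g : trig_poly g -> E n g @[n --> \oo] --> EZ g.
  elim=> [a b|f1 f2 tf1 H1 tf2 H2|c f tf H]; first exact: chE.
  - have -> : EZ (fun x => f1 x + f2 x) = EZ f1 + EZ f2.
      have [M1 B1] := trig_poly_bounded tf1; have [M2 B2] := trig_poly_bounded tf2.
      apply: RintegralD => //.
        by apply: (integrable_bounded (measurable_trig_poly tf1)) => t; exact: B1.
      by apply: (integrable_bounded (measurable_trig_poly tf2)) => t; exact: B2.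
    have -> : (fun n => E n (fun x => f1 x + f2 x)) = (fun n => E n f1 + E n f2).
      by apply/funext => n; case: (mE n).
    exact: (cvgD H1 H2).
  - have -> : EZ (fun x => c * f x) = c * EZ f.
      have [M1 B1] := trig_poly_bounded tf.
      apply: RintegralZl => //.
      by apply: (integrable_bounded (measurable_trig_poly tf)) => t; exact: B1.
    have -> : (fun n => E n (fun x => c * f x)) = (fun n => c * E n f).
      by apply/funext => n; case: (mE n).
    exact: (cvgM (cvg_cst c) H).
have EG n k : `|E n F - E n (G k)| <= (1 + 2 * M * K) / k.+1%:R.
  pose H x : R := k.+1%:R^-1 * (1 + 2 * M * \sum_i x 0 i ^+ 2).
  rewrite (le_trans (@mean_dist _ _ _ H (mE n) _))//.
    move=> x; rewrite /H.
    have S0 : 0 <= \sum_i x 0 i ^+ 2 by apply: sumr_ge0 => i _; exact: sqr_ge0.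
    have [_ GM GF] := HG k.
    have [/GF Hx|/existsNP[i /negP]] := pselect (forall i, `|x 0 i| <= k.+1%:R).
      by rewrite (le_trans Hx)// ler_peMr ?invr_ge0// lerDl !mulr_ge0.
    rewrite -ltNge => ki; rewrite (@le_trans _ _ (2 * M))//.
      by rewrite (le_trans (ler_normB _ _))// mulr_natl mulr2n lerD.
    rewrite ler_pdivlMl ?ltr0Sn// mulrC (@le_trans _ _ (2 * M * \sum_i x 0 i ^+ 2))//.
      rewrite ler_wpM2l ?mulr_ge0// (@le_trans _ _ (x 0 i ^+ 2))//.
        rewrite -real_normK ?num_real// (@le_trans _ _ (`|x 0 i|))//; first exact: ltW.
        by rewrite expr2 ler_peMl// (le_trans _ (ltW ki))// ler1n.
      by rewrite (bigD1 i)//= lerDl; apply: sumr_ge0 => j _; exact: sqr_ge0.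
    by rewrite lerDr.
  case: (mE n) => E1 ED EZ' _; rewrite /H EZ' ED E1 EZ' mulrC ler_wpM2r ?invr_ge0//.
  by rewrite lerD2l ler_wpM2l ?mulr_ge0.
have GZ : EZ (G k) @[k --> \oo] --> EZ F.
  apply: (@cvg_EZ F M) => [|k|//|k x|x].
  - exact: measurable_continuous_rV cF FM.
  - exact: measurable_trig_poly.
  - by case: (HG k).
  - by apply: trig_seq_cvg => k y; case: (HG k) => _ _; exact.
apply/cvgrPdist_le => /= e e0.
have e30 : 0 < e / 3 by rewrite divr_gt0.
have [k [k1 k2]] : exists k, `|EZ F - EZ (G k)| <= e / 3 /\
    (1 + 2 * M * K) / k.+1%:R <= e / 3.
  move/cvgrPdist_le: GZ => /(_ _ e30) GZ.
  near \oo => k; exists k; split; first by near: k; exact: GZ.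
  rewrite ler_pdivrMr ?ltr0Sn// [leRHS]mulrC -ler_pdivrMr//.
  rewrite (@le_trans _ _ k%:R) ?ler_nat//; near: k; exact: nbhs_infty_ger.
have /cvgrPdist_le/(_ _ e30) Hk := Etrig _ (tG k).
near=> n.
have -> : EZ F - E n F = (EZ F - EZ (G k)) + (EZ (G k) - E n (G k))
   + (E n (G k) - E n F) by ring.
rewrite (le_trans (ler_normD _ _))// (_ : e = e / 3 + e / 3 + e / 3); last by field.
rewrite lerD//; last by rewrite distrC (le_trans (EG _ _)).
rewrite (le_trans (ler_normD _ _))// lerD//.
by near: n.
Unshelve. all: by end_near. Qed.

End LimitLaw.

End MethodOfCharacters.

(** * Convergence of moments *)

Section Moments.
Context {R : realType} {r : nat}.
Implicit Types (F G h : 'rV[R]_r -> R) (x a : 'rV[R]_r).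
Context d (T : measurableType d) (P : probability T R) (Z : T -> 'rV[R]_r).
Hypothesis mZ : forall i, measurable_fun setT (fun t => Z t 0 i).
Let EZ F : R := \int[P]_t F (Z t).

(** Convergence of expectations passes from bounded continuous functions to
    continuous h with bounded second moments: m sin (h / m) is bounded, smaller
    than h in absolute value, and differs from h by at most 2 h^2 / m. *)
Lemma cvg_moment (E : nat -> ('rV[R]_r -> R) -> R) h K :
  (forall n, mean_functional (E n)) ->
  (forall F M, continuous F -> (forall x, `|F x| <= M) ->
    E n F @[n --> \oo] --> EZ F) ->
  continuous h -> (forall n, E n (fun x => h x ^+ 2) <= K) ->
  P.-integrable setT (fun t => (h (Z t))%:E) /\ E n h @[n --> \oo] --> EZ h.
Proof.
move=> mE cvE ch hK.
pose g (k : nat) x : R := k.+1%:R * sin (h x / k.+1%:R).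
have k0 (k : nat) : 0 < k.+1%:R :> R by rewrite ltr0Sn.
have gb k x : `|g k x| <= k.+1%:R.
  rewrite normrM ger0_norm ?ler0n// ler_piMr ?ler0n//.
  by rewrite ler_norml sin_geN1 sin_le1.
have gh k x : `|g k x| <= `|h x|.
  rewrite normrM ger0_norm ?ler0n// -ler_pdivlMl// (le_trans (norm_sin_le _))//.
  by rewrite normrM [X in _ * X]ger0_norm ?invr_ge0// mulrC.
have hg k x : `|h x - g k x| <= 2 / k.+1%:R * h x ^+ 2.
  have := norm_sinB_le2 (h x / k.+1%:R).
  rewrite -(ler_pM2l (k0 k)) -[X in X * `|_|]ger0_norm ?ler0n// -normrM mulrBr.
  have -> : k.+1%:R * (h x / k.+1%:R) = h x by rewrite mulrCA divff ?mulr1// gt_eqF.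
  suff -> : k.+1%:R * (2 * (h x / k.+1%:R) ^+ 2) = 2 / k.+1%:R * h x ^+ 2 by [].
  by field; rewrite addrC natr1 gt_eqF.
have cg k : continuous (g k).
  move=> x.
  have H1 : h y / k.+1%:R @[y --> x] --> h x / k.+1%:R.
    exact: (cvgM (ch x) (cvg_cst _)).
  have H2 : sin (h y / k.+1%:R) @[y --> x] --> sin (h x / k.+1%:R).
    by apply: (cvg_comp _ _ H1); exact: continuous_sin.
  exact: (cvgM (cvg_cst _) H2).
have gcvg x : g k x @[k --> \oo] --> h x.
  apply/cvgrPdist_le => /= e e0; near=> k.
  rewrite (le_trans (hg k x))// mulrAC ler_pdivrMr// -ler_pdivrMl//.
  rewrite (@le_trans _ _ k%:R) ?ler_nat//; near: k; exact: nbhs_infty_ger.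
have mg k : measurable_fun setT (g k \o Z) by exact: (measurable_continuous_rV mZ (cg k) (gb k)).
have mh : measurable_fun setT (h \o Z).
  by apply: (@measurable_fun_cvg _ _ _ _ (fun k => g k \o Z)) => // t _; exact: gcvg.
have g2b k x : `|g k x ^+ 2| <= k.+1%:R ^+ 2.
  by rewrite normrX lerXn2r ?nnegrE.
have cg2 k : continuous (fun x => g k x ^+ 2).
  by move=> x; exact: (cvgM (cg k x) (cg k x)).
have mg2 k : measurable_fun setT ((fun x => g k x ^+ 2) \o Z).
  exact: (measurable_continuous_rV mZ (cg2 k) (g2b k)).
have K0 : 0 <= K.
  rewrite (le_trans _ (hK 0%N))// -[leLHS](mean_cst 0 (mE 0%N)).
  by case: (mE 0%N) => _ _ _; apply=> x; exact: sqr_ge0.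
have EZg2 k : EZ (fun x => g k x ^+ 2) <= K.
  have H := cvE _ _ (cg2 k) (g2b k).
  rewrite -(cvg_lim _ H)//; apply: limr_le; first by apply/cvg_ex; exists (EZ (fun x => g k x ^+ 2)).
  apply: nearW => n; rewrite (le_trans _ (hK n))//.
  case: (mE n) => _ _ _; apply=> x.
  by rewrite -[leLHS]real_normK ?num_real// -[leRHS]real_normK ?num_real// lerXn2r ?nnegrE.
have h2 : (\int[P]_t ((h (Z t)) ^+ 2)%:E <= K%:E)%E.
  have -> : (\int[P]_t ((h (Z t)) ^+ 2)%:E =
      \int[P]_t limn_einf (fun k => (g k (Z t) ^+ 2)%:E))%E.
    apply: eq_integral => t _; apply/esym.
    have H : ((g k (Z t)) ^+ 2)%:E @[k --> \oo] --> ((h (Z t)) ^+ 2)%:E.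
      apply: cvg_EFin; first exact: nearW.
      exact: (cvgM (gcvg (Z t)) (gcvg (Z t))).
    rewrite is_cvg_limn_einfE; last by apply/cvg_ex; exists ((h (Z t)) ^+ 2)%:E.
    exact/cvg_lim.
  apply: (le_trans (@fatou _ _ _ P setT measurableT (fun k t => (g k (Z t) ^+ 2)%:E) _ _)).
  - by move=> k; apply/measurable_EFinP; exact: mg2.
  - by move=> k t _; rewrite lee_fin sqr_ge0.
  rewrite limn_einf_lim; apply: lime_le; first exact: is_cvg_einfs.
  apply: nearW => k; apply: (@le_trans _ _ (\int[P]_t (g k (Z t) ^+ 2)%:E)%E).
    by apply: ereal_inf_lbound; exists k => /=.
  by rewrite (integral_Rintegral P (mg2 k) (g2b k)) lee_fin; exact: EZg2.
have ih2 : P.-integrable setT (fun t => (h (Z t) ^+ 2)%:E).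
  apply/integrableP; split.
    by apply/measurable_EFinP; apply: measurable_funX.
  under eq_integral do rewrite gee0_abs ?lee_fin ?sqr_ge0//.
  by rewrite (le_lt_trans h2)// ltry.
have ih : P.-integrable setT (fun t => (h (Z t))%:E).
  apply: (@le_integrable _ _ _ P setT measurableT _
    (fun t => 1%:E + (h (Z t) ^+ 2)%:E)%E).
  - exact/measurable_EFinP.
  - move=> t _ /=; rewrite lee_fin [leRHS]ger0_norm ?addr_ge0 ?sqr_ge0//.
    rewrite -[X in 1 + X]real_normK ?num_real//.
    by have := sqr_ge0 (`|h (Z t)| - 2^-1); nra.
  - by apply: integrableD => //; exact: finite_measure_integrable_cst.
split=> //.
have Rh2 : EZ (fun x => h x ^+ 2) <= K.
  rewrite -lee_fin; apply: le_trans h2.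
  by rewrite /EZ /Rintegral fineK//; exact: integrable_fin_num.
have EZhg k : `|EZ h - EZ (g k)| <= 2 / k.+1%:R * K.
  have igk : P.-integrable setT (EFin \o (g k \o Z)).
    by apply: (integrable_bounded P (mg k)) => t; exact: gb.
  have ihg : P.-integrable setT (EFin \o (fun t => h (Z t) - g k (Z t))).
    by rewrite /comp; under eq_fun do rewrite EFinB; exact: integrableB.
  rewrite /EZ -RintegralB//.
  apply: (le_trans (le_normr_Rintegral _ _)) => //.
  apply: (@le_trans _ _ (\int[P]_t (2 / k.+1%:R * h (Z t) ^+ 2))).
    apply: le_Rintegral => //.
    - exact: (integrable_norm ihg).
    - apply: (eq_integrable measurableT)
        (integrableZl measurableT (2 / k.+1%:R) ih2) => t _.
      by rewrite /= -EFinM.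
  rewrite RintegralZl// ler_wpM2l// divr_ge0//.
have Ehg n k : `|E n h - E n (g k)| <= 2 / k.+1%:R * K.
  rewrite (le_trans (mean_dist (mE n) (hg k)))//.
  by case: (mE n) => _ _ -> _; rewrite ler_wpM2l// divr_ge0.
apply/cvgrPdist_le => /= e e0.
have e30 : 0 < e / 3 by rewrite divr_gt0.
have [k kP] : exists k : nat, 2 / k.+1%:R * K <= e / 3.
  near \oo => k; exists k.
  rewrite mulrAC ler_pdivrMr// -ler_pdivrMl//.
  rewrite (@le_trans _ _ k%:R) ?ler_nat//; near: k; exact: nbhs_infty_ger.
have /cvgrPdist_le/(_ _ e30) Hk := cvE _ _ (cg k) (gb k).
near=> n.
have -> : EZ h - E n h = (EZ h - EZ (g k)) + (EZ (g k) - E n (g k))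
   + (E n (g k) - E n h) by ring.
rewrite (le_trans (ler_normD _ _))// (_ : e = e / 3 + e / 3 + e / 3); last by field.
rewrite lerD//; last by rewrite distrC (le_trans (Ehg _ _)).
rewrite (le_trans (ler_normD _ _))// lerD//.
  exact: le_trans (EZhg k) kP.
by near: n.
Unshelve. all: by end_near. Qed.

End Moments.

(** * The criterion for a normal limit *)

Section NormalCharacter.
Context {R : realType} {r : nat}.
Implicit Types (a : 'rV[R]_r).

Lemma Rintegral_cos_normal_prob (s b : R) : s != 0 ->
  (\int[normal_prob 0 s]_x (cos (x + b))%:E = (cos b * expR (- (s ^+ 2 / 2)))%:E)%E.
Proof.
move=> s0.
have mc : measurable_fun setT (fun x : R => cos (x + b)).
  apply: (measurableT_comp (continuous_measurable_fun (@continuous_cos R))).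
  exact: measurable_funD.
have c1 (x : R) : `|cos (x + b)| <= 1 :> R by rewrite ler_norml cos_geN1 cos_le1.
rewrite (integral_normal_prob _ _ mc c1).
have i1 := integrableZl measurableT (cos b) (integrable_cos_normal_pdf s0 1).
have i2 := integrableZl measurableT (sin b) (integrable_sin_normal_pdf s0 1).
transitivity (\int[lebesgue_measure]_x
  ((cos b)%:E * (cos (1 * x) * normal_pdf 0 s x)%:E
   - (sin b)%:E * (sin (1 * x) * normal_pdf 0 s x)%:E))%E.
  apply: eq_integral => x _; rewrite -!EFinM -EFinB cosD mul1r; congr EFin.
  by move: (normal_pdf 0 s x) (cos x) (sin x) => *; ring.
rewrite (integralB measurableT i1 i2).
rewrite (integralZl measurableT (integrable_cos_normal_pdf s0 1)).
rewrite (integralZl measurableT (integrable_sin_normal_pdf s0 1)).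
have -> : (\int[lebesgue_measure]_x (cos (1 * x) * normal_pdf 0 s x)%:E =
           (expR (- (1 ^+ 2 * s ^+ 2 / 2)))%:E)%E.
  rewrite -(Rintegral_cos_normal_pdf s0 1) fineK; first by [].
  exact: (integrable_fin_num measurableT (integrable_cos_normal_pdf s0 1)).
have -> : (\int[lebesgue_measure]_x (sin (1 * x) * normal_pdf 0 s x)%:E = 0%:E)%E.
  rewrite -[X in _ = X%:E](Rintegral_sin_normal_pdf s0 1) fineK; first by [].
  exact: (integrable_fin_num measurableT (integrable_sin_normal_pdf s0 1)).
by rewrite -!EFinM -EFinB mulr0 subr0 expr1n mul1r.
Qed.

(** The cosine only sees one linear combination, whose law is known. *)
Lemma normal_vector_char d (T : measurableType d) (P : probability T R)
    (S : 'M[R]_r) (Z : T -> 'rV[R]_r) a b :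
  covariance_matrix S -> normal_vector P S Z ->
  \int[P]_t cos (dot a (Z t) + b) = cos b * expR (- ((a *m S *m a^T) 0 0 / 2)).
Proof.
move=> [_ posS] [mZ lawZ].
pose q : R := (a *m S *m a^T) 0 0.
have q0 : 0 <= q by exact: posS.
have mX : measurable_fun [set: T] ((fun t => dot a (Z t)) : T -> measurableTypeR R).
  exact: measurable_dot.
have mc : measurable_fun setT (fun x : R => cos (x + b)).
  apply: (measurableT_comp (continuous_measurable_fun (@continuous_cos R))).
  exact: measurable_funD.
have lawX A : measurable A -> P [set t | A (dot a (Z t))] = normal_law 0 (Num.sqrt q) A.
  by move=> mA; rewrite -lawZ.
pose f (x : R) : \bar R := (cos (x + b))%:E.
have mf : measurable_fun [set: measurableTypeR R] (f : measurableTypeR R -> \bar R).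
  exact/measurable_EFinP.
have intf : P.-integrable
    ((fun t => dot a (Z t)) @^-1` setT) (f \o (fun t => dot a (Z t))).
  rewrite preimage_setT.
  apply: (@integrable_bounded _ _ _ P (fun t => cos (dot a (Z t) + b)) 1) => [|t].
    exact: (measurableT_comp mc mX).
  by rewrite ler_norml cos_geN1 cos_le1.
have H := integral_pushforward mX mf intf measurableT.
rewrite preimage_setT in H.
rewrite (_ : \int[P]_t cos (dot a (Z t) + b) = fine (\int[pushforward P
  ((fun t => dot a (Z t)) : T -> measurableTypeR R)]_x f x)%E); last by rewrite H.
have [s0|s0] := eqVneq (Num.sqrt q) 0.
  have q00 : q = 0 by rewrite -(sqr_sqrtr q0) s0 expr0n.
  transitivity (fine (\int[\d_(0%R : measurableTypeR R)]_x f x)%E).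
    congr fine; apply: eq_measure_integral => B mB _.
    transitivity (P [set t | B (dot a (Z t))]) => //.
    by rewrite (lawX _ mB) /normal_law s0 eqxx.
  rewrite (integral_dirac _ measurableT mf) diracT mul1e /f /= add0r.
  by rewrite -/q q00 mul0r oppr0 expR0 mulr1.
transitivity (fine (\int[normal_prob 0 (Num.sqrt q)]_x f x)%E).
  congr fine; apply: eq_measure_integral => B mB _.
  transitivity (P [set t | B (dot a (Z t))]) => //.
  by rewrite (lawX _ mB) /normal_law (negbTE s0).
by rewrite (Rintegral_cos_normal_prob b s0)/= sqr_sqrtr.
Qed.

Lemma continuous_coord (i : 'I_r) : continuous (fun x : 'rV[R]_r => x 0 i).
Proof. exact: coord_continuous. Qed.

Lemma continuous_monomial (q : 'I_r -> nat) :
  continuous (fun x : 'rV[R]_r => \prod_i x 0 i ^+ q i).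
Proof.
elim: (index_enum _) => [|i s IH].
  rewrite (_ : (fun _ => _) = cst 1); first exact: cst_continuous.
  by apply/funext => x; rewrite big_nil.
rewrite (_ : (fun _ => _) = fun x : 'rV[R]_r =>
    x 0 i ^+ q i * \prod_(j <- s) x 0 j ^+ q j); last first.
  by apply/funext => x; rewrite big_cons.
move=> x.
have H : {for x, continuous (fun y : 'rV[R]_r => y 0 i ^+ q i)}.
  apply: (@continuous_comp _ _ _ (fun y : 'rV[R]_r => y 0 i) (fun u => u ^+ q i)).
    exact: continuous_coord.
  exact: exprn_continuous.
exact: (cvgM H (IH x)).
Qed.

(** The largest coordinate bounds all of them, and its power is one of the terms of
    the sum. *)
Lemma monomial_sqr_le (q : 'I_r -> nat) (x : 'rV[R]_r) :
  (\prod_i x 0 i ^+ q i) ^+ 2 <=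
  1 + \sum_i x 0 i ^+ (2 * \sum_i q i)%N.
Proof.
set Q := (\sum_i q i)%N.
pose m : R := \big[Num.max/0]_i `|x 0 i|.
have xm i : `|x 0 i| <= m by rewrite /m (bigD1 i)//= le_max lexx.
have m0 : 0 <= m by rewrite /m; elim/big_rec: _ => // i y _ y0; rewrite le_max y0 orbT.
have S0 : 0 <= \sum_i x 0 i ^+ (2 * Q) by apply: sumr_ge0 => i _; rewrite exprM exprn_ge0// sqr_ge0.
have mB : m ^+ (2 * Q) <= 1 + \sum_i x 0 i ^+ (2 * Q).
  rewrite /m; elim/big_ind: _ => [|u v Hu Hv|i _].
  - rewrite (@le_trans _ _ 1)// ?lerDl// expr0n; case: (_ == _) => //.
  - by case: (leP u v).
  - rewrite (bigD1 i)//= exprM real_normK ?num_real// -exprM.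
    rewrite addrCA lerDl addr_ge0//; apply: sumr_ge0 => j _.
    by rewrite exprM exprn_ge0// sqr_ge0.
apply: le_trans mB.
rewrite -prodrXl /Q big_distrr/= -prodrXr; apply: ler_prod => i _.
rewrite sqr_ge0/= exprAC [leRHS]exprM lerXn2r ?nnegrE ?sqr_ge0//.
by rewrite -real_normK ?num_real// lerXn2r ?nnegrE.
Qed.

(** Characteristic functions determine the limit law, and bounded even moments
    of every order upgrade it to convergence of moments. *)
Theorem cvg_normal_moments_of_char d (T : measurableType d) (P : probability T R)
    (X : nat -> T -> 'rV[R]_r) (E : nat -> ('rV[R]_r -> R) -> R) (S : 'M[R]_r) :
  (forall n, mean_functional (E n)) ->
  (forall n F, 'E_P[fun t => F (X n t)] = (E n F)%:E)%E ->
  (forall a b, E n (fun x => cos (dot a x + b)) @[n --> \oo] -->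
               cos b * expR (- ((a *m S *m a^T) 0 0 / 2))) ->
  (forall (p : nat) i, exists K, forall n, E n (fun x => x 0 i ^+ (2 * p)) <= K) ->
  covariance_matrix S -> cvg_normal_moments P X S.
Proof.
move=> mE linkE chE momE covS.
have [d' [T' [P' [Z nZ]]]] := normal_vector_exists covS.
exists d', T', P', Z; case: (nZ) => mZ _.
have mom p : exists K, forall n, E n (fun x => \sum_i x 0 i ^+ (2 * p)) <= K.
  have [K HK] := choice (momE p); exists (\sum_i K i) => n.
  by rewrite mean_sum//; apply: ler_sum => i _; exact: HK.
have bnd F M : continuous F -> (forall x, `|F x| <= M) ->
    E n F @[n --> \oo] --> (\int[P']_t F (Z t) : R).
  have [K HK] := mom 1%N.
  apply: (cvg_bounded_of_char mZ mE _ HK) => a b.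
  by rewrite (normal_vector_char _ _ covS nZ).
split=> //.
- move=> F cF [M FM].
  under eq_fun do rewrite linkE.
  have -> : 'E_P'[fun t => F (Z t)]%E = (\int[P']_t F (Z t))%:E.
    rewrite unlock (integral_Rintegral P' (measurable_continuous_rV mZ cF FM) FM).
    by [].
  by apply: cvg_EFin; [exact: nearW|exact: bnd cF FM].
- move=> q.
  pose h (x : 'rV[R]_r) : R := \prod_i x 0 i ^+ q i.
  have [K HK] := mom (\sum_i q i)%N.
  have h2 n : E n (fun x => h x ^+ 2) <= 1 + K.
    case: (mE n) => E1 ED EZ Ele.
    by rewrite (le_trans (Ele _ _ (monomial_sqr_le q)))// ED E1 lerD2l.
  have [ih Hc] := cvg_moment mZ mE bnd (@continuous_monomial q) h2.
  under eq_fun do rewrite (linkE _ h).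
  have -> : 'E_P'[fun t => (\prod_i Z t 0 i ^+ q i)%R]%E = (\int[P']_t h (Z t))%:E.
    by rewrite unlock fineK//; exact: integrable_fin_num ih.
  by apply: cvg_EFin; [exact: nearW|exact: Hc].
Qed.

End NormalCharacter.

(** * The Lyapunov equation *)

Section Lyapunov.
Context {R : realType} {r : nat}.

(** The Sylvester map is injective because triangularity lets an entry of the
    kernel be computed from entries with a smaller sum of indices. *)
Lemma lyapunov_exists (M B : 'M[R]_r) :
  (forall i j : 'I_r, (i < j)%N -> M i j = 0) -> (forall i, 0 < M i i) ->
  B^T = B -> exists S : 'M[R]_r, S^T = S /\ M *m S + S *m M^T = B.
Proof.
move=> Mtrig Mpos symB.
pose N := lin_mx (mulmx M) + lin_mx (mulmxr M^T) : 'M[R]_(r * r).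
have NE A : mxvec A *m N = mxvec (M *m A + A *m M^T).
  by rewrite mulmxDr !mul_vec_lin/= linearD.
have ker A : M *m A + A *m M^T = 0 -> forall n (i j : 'I_r), (i + j < n)%N -> A i j = 0.
  move=> A0; elim=> // n IH i j ijn.
  have := congr1 (fun C : 'M[R]_r => C i j) A0.
  rewrite 3!mxE [X in X = _ -> _](_ : _ = (M i i + M j j) * A i j).
    rewrite mxE => /eqP; rewrite mulf_eq0 gt_eqF ?addr_gt0//= => /eqP //.
  rewrite (bigD1 i)//= big1 ?addr0 => [|k ki]; last first.
    have [ik|] := ltnP i k; first by rewrite Mtrig// mul0r.
    rewrite leq_eqVlt val_eqE (negbTE ki) /= => ki'.
    by rewrite IH ?mulr0//; apply: leq_trans (ijn : (i + j <= n)%N); rewrite ltn_add2r.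
  rewrite (bigD1 j)//= big1 ?addr0 => [|k kj]; last first.
    rewrite mxE; have [jk|] := ltnP j k; first by rewrite Mtrig// mulr0.
    rewrite leq_eqVlt val_eqE (negbTE kj) /= => kj'.
    by rewrite IH ?mul0r//; apply: leq_trans (ijn : (i + j <= n)%N); rewrite ltn_add2l.
  by rewrite mxE mulrDl [A i j * _]mulrC.
have uN : N \in unitmx.
  rewrite -row_free_unit; apply: inj_row_free => v.
  rewrite -[v]vec_mxK NE => /eqP; rewrite -[X in _ == X](linear0 mxvec).
  rewrite (can_eq mxvecK) => /eqP A0.
  rewrite (_ : vec_mx v = 0) ?linear0//.
  by apply/matrixP => i j; rewrite (ker _ A0 (i + j).+1)// mxE.
pose S := vec_mx (mxvec B *m invmx N).
have SB : M *m S + S *m M^T = B.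
  apply: (can_inj mxvecK); rewrite -NE /S vec_mxK -mulmxA mulVmx// mulmx1.
  by [].
exists (2^-1 *: (S + S^T)); split.
  by rewrite linearZ/= linearD/= trmxK addrC.
have SB' : M *m S^T + S^T *m M^T = B.
  by rewrite -[RHS]symB -SB linearD/= !trmx_mul trmxK addrC.
rewrite -scalemxAr -scalemxAl -scalerDr mulmxDr mulmxDl addrACA SB SB'.
by rewrite -mulr2n -[B *+ 2]scaler_nat scalerA mulVf ?scale1r// pnatr_eq0.
Qed.

End Lyapunov.

(** * Expectations as finite sums over histories *)

Section Histories.
Context {R : realType} d (T : measurableType d) (P : probability T R).
Variables (m : nat) (C : 'I_m -> block) (p : 'I_m -> R) (chi rho : R).
Variable H : hooking_networks P C p chi rho.

(** All choices made so far, hence a value that determines the network; almost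
    surely it is one of the finitely many entries of [hists n]. *)
Definition hist (n : nat) (t : T) : 'I_m * seq (nat * 'I_m) :=
  (hn_init H t, [seq (hn_latch H j t, hn_block H j t) | j <- iota 0 n]).

Definition graph_of (h : 'I_m * seq (nat * 'I_m)) : mgraph :=
  foldl (fun G vi => attach G vi.1 (C vi.2)) (C h.1) h.2.

Definition extend (h : 'I_m * seq (nat * 'I_m)) (vi : nat * 'I_m) :=
  (h.1, rcons h.2 vi).

Lemma graph_of_extend h vi :
  graph_of (extend h vi) = attach (graph_of h) vi.1 (C vi.2).
Proof. by rewrite /graph_of /= foldl_rcons. Qed.

Lemma histS n t : hist n.+1 t = extend (hist n t) (hn_latch H n t, hn_block H n t).
Proof. by rewrite /hist /extend -addn1 iotaD map_cat cats1. Qed.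

Lemma hn_graphE n t : hn_graph H n t = graph_of (hist n t).
Proof.
rewrite /hn_graph; elim: n => [//|n IH].
by rewrite histS graph_of_extend -IH.
Qed.

Definition at_hist n h : set T := [set t | hist n t = h].

Lemma same_pastE n t :
  same_past (hn_init H) (hn_latch H) (hn_block H) n t = at_hist n (hist n t).
Proof.
apply/seteqP; split=> u /= => [[i0 E]|].
  rewrite /at_hist /= /hist i0; congr pair; apply/eq_in_map => j.
  by rewrite mem_iota add0n => /andP[_ /E[-> ->]].
rewrite /at_hist/= /hist => -[i0 /eq_in_map E]; split=> // j jn.
by have := E j; rewrite mem_iota add0n leq0n jn => /(_ isT)[-> ->].
Qed.

Lemma extend_inj h h' vi vi' : extend h vi = extend h' vi' -> h = h' /\ vi = vi'.
Proof. by case: h h' => [i s] [i' s'] [-> /rcons_inj[-> ->]]. Qed.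

(** The event that a history is realised is an intersection of the events to which
    the conditional laws of latch and block apply. *)
Lemma at_histS n h vi : at_hist n.+1 (extend h vi) =
  at_hist n h `&` hn_latch H n @^-1` [set vi.1] `&` hn_block H n @^-1` [set vi.2].
Proof.
apply/seteqP; split=> t; rewrite /at_hist /= histS.
  by move=> /extend_inj[-> <-].
by case: vi => v i /= [[-> ->] ->].
Qed.

Lemma measurable_at_hist n h : measurable (at_hist n h).
Proof.
elim: n h => [|n IH] [i s].
  case: s => [|vi s].
    rewrite (_ : at_hist _ _ = hn_init H @^-1` [set i]); first exact: hn_init_meas.
    by apply/seteqP; split=> t; rewrite /at_hist /hist/=; [by case|by move=> ->].
  rewrite (_ : at_hist _ _ = set0)//.
  by apply/seteqP; split=> t; rewrite /at_hist /hist/=.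
case/lastP: s => [|s vi].
  have -> : at_hist n.+1 (i, [::]) = set0.
    by apply/seteqP; split=> t //; rewrite /at_hist/=; case.
  exact: measurable0.
rewrite (at_histS n (i, s) vi); apply: measurableI; last exact: hn_block_meas.
by apply: measurableI; [exact: IH|exact: hn_latch_meas].
Qed.

Lemma measurable_hist n (Q : 'I_m * seq (nat * 'I_m) -> Prop) :
  measurable [set t | Q (hist n t)].
Proof.
rewrite (_ : [set _ | _] =
  \bigcup_h (if `[< Q h >] then at_hist n h else set0)).
  apply: countable_bigcupT_measurable; first exact: countableP.
  by move=> h; case: asboolP => // _; exact: measurable_at_hist.
apply/seteqP; split=> [t Qt|t [h _]].
  by exists (hist n t) => //; rewrite asboolT.
by case: asboolP => // Qh; rewrite /at_hist/= => ->.
Qed.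

Definition pr n h : R := fine (P (at_hist n h)).

Lemma prE n h : P (at_hist n h) = (pr n h)%:E.
Proof. by rewrite /pr fineK// fin_num_measure//; exact: measurable_at_hist. Qed.

Lemma pr_ge0 n h : 0 <= pr n h.
Proof. by rewrite fine_ge0. Qed.

Lemma pr_extend n h v i : pr n.+1 (extend h (v, i)) =
  pr n h * latch_prob chi rho (graph_of h) v * p i.
Proof.
have [[t Ht]|ne] := pselect (exists t, hist n t = h); last first.
  have h0 : at_hist n h = set0.
    by apply/seteqP; split=> t //; rewrite /at_hist/= => E; apply: ne; exists t.
  by rewrite /pr at_histS h0 !set0I measure0/= !mul0r.
apply: EFin_inj; rewrite -prE at_histS -Ht -same_pastE.
rewrite (hn_block_law H n t v i) (hn_latch_law H n t v) same_pastE prE.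
by rewrite -[network _ _ _ _ _ _]/(hn_graph H n t) hn_graphE.
Qed.

Lemma integral_hists n (s : seq ('I_m * seq (nat * 'I_m))) g :
  (\int[P]_t (\sum_(h <- s) g h * \1_(at_hist n h) t)%:E =
   (\sum_(h <- s) g h * pr n h)%:E)%E.
Proof.
have i1 h : P.-integrable setT (fun t => (\1_(at_hist n h) t)%:E).
  apply: (@le_integrable _ _ _ P _ measurableT _ (cst 1%:E)).
  - by apply/measurable_EFinP/measurable_indic; exact: measurable_at_hist.
  - by move=> t _ /=; rewrite lee_fin normr1 indicE; case: (_ \in _); rewrite ?normr1 ?normr0.
  - exact: finite_measure_integrable_cst.
have i2 h : P.-integrable setT (fun t => (g h * \1_(at_hist n h) t)%:E).
  by under eq_fun do rewrite EFinM; exact: integrableZl.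
elim: s => [|h s IH].
  rewrite big_nil; under eq_integral do rewrite big_nil.
  by rewrite integral0.
rewrite big_cons EFinD -IH.
under eq_integral do rewrite big_cons EFinD.
rewrite integralD//.
  congr (_ + _)%E; under eq_integral do rewrite EFinM.
  rewrite integralZl// integral_indic//; last exact: measurable_at_hist.
  by rewrite setIT EFinM -prE.
elim: s {IH} => [|h' s IH].
  by under eq_fun do rewrite big_nil; exact: integrable0.
by under eq_fun do rewrite big_cons EFinD; exact: integrableD.
Qed.

Lemma sum_hists n (s : seq ('I_m * seq (nat * 'I_m))) g t : uniq s ->
  \sum_(h <- s) g h * \1_(at_hist n h) t =
  if hist n t \in s then g (hist n t) else 0 :> R.
Proof.
have E h : \1_(at_hist n h) t = (h == hist n t)%:R :> R.
  rewrite indicE; congr ((nat_of_bool _)%:R); apply/idP/eqP => [/set_mem <-//|->].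
  exact: mem_set.
move=> us; case: ifPn => [ts|ts].
  rewrite (bigD1_seq (hist n t))//= E eqxx mulr1 big1 ?addr0// => h ht.
  by rewrite E (negbTE ht) mulr0.
rewrite big_seq big1// => h hs; rewrite E (_ : h == _ = false) ?mulr0//.
by apply/negbTE; apply: contra ts => /eqP <-.
Qed.

Fixpoint hists (n : nat) : seq ('I_m * seq (nat * 'I_m)) :=
  if n is n'.+1 then
    [seq extend h vi | h <- hists n',
      vi <- [seq (v, i) | v <- iota 0 (nvert (graph_of h)), i <- enum 'I_m]]
  else [seq (i, [::]) | i <- enum 'I_m].

Lemma hists_uniq n : uniq (hists n).
Proof.
elim: n => [|n IH] /=.
  by rewrite map_inj_uniq ?enum_uniq// => i j [].
apply: allpairs_uniq_dep => //.
  move=> h _; apply: allpairs_uniq; rewrite ?iota_uniq ?enum_uniq//.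
  by move=> [v i] [v' i'] _ _ [-> ->].
move=> [h vi] [h' vi'] /= _ _ /extend_inj[-> E].
by rewrite E.
Qed.

Definition Ex n (f : mgraph -> R) : R := \sum_(h <- hists n) pr n h * f (graph_of h).

Definition step_mean (f : mgraph -> R) (G : mgraph) : R :=
  \sum_(v < nvert G) latch_prob chi rho G v * \sum_i p i * f (attach G v (C i)).

(** Conditioning on the past. *)
Lemma ExS n f : Ex n.+1 f = Ex n (step_mean f).
Proof.
rewrite /Ex /= big_allpairs_dep; apply: eq_bigr => h _.
rewrite big_allpairs_dep /step_mean -(big_mkord xpredT (fun v => latch_prob chi rho
  (graph_of h) v * \sum_i p i * f (attach (graph_of h) v (C i)))).
rewrite /index_iota subn0 mulr_sumr; apply: eq_bigr => v _.
rewrite mulrA mulr_sumr big_enum/=; apply: eq_bigr => i _.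
by rewrite pr_extend graph_of_extend/= !mulrA.
Qed.

(** The networks of positive probability; only these have the degree statistics
    that the essential degrees describe. *)
Definition reach n (G : mgraph) : Prop :=
  exists h, [/\ h \in hists n, 0 < pr n h & G = graph_of h].

Lemma reach0 G : reach 0 G -> exists i, G = C i.
Proof. by move=> [h [/mapP[i _ ->] _ ->]]; exists i. Qed.

Lemma reachS n G : reach n.+1 G ->
  exists G' v i, [/\ reach n G', (v < nvert G')%N & G = attach G' v (C i)].
Proof.
move=> [_ [/allpairsPdep[h [vi [hh /allpairsP[[v i]/= [vh _ ->]] ->]]] ph ->]].
exists (graph_of h), v, i; split; last by rewrite graph_of_extend.
  exists h; split=> //; rewrite lt_neqAle pr_ge0 andbT eq_sym.
  by apply/eqP => p0; move: ph; rewrite pr_extend p0 !mul0r ltxx.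
by move: vh; rewrite mem_iota add0n.
Qed.

Lemma Ex_le n f g : (forall G, reach n G -> f G <= g G) -> Ex n f <= Ex n g.
Proof.
move=> fg; rewrite /Ex !big_seq; apply: ler_sum => h hh.
have := pr_ge0 n h; rewrite le_eqVlt => /predU1P[<-|p0]; first by rewrite !mul0r.
by rewrite ler_wpM2l ?(ltW p0)//; apply: fg; exists h.
Qed.

Lemma Ex_eq n f g : (forall G, reach n G -> f G = g G) -> Ex n f = Ex n g.
Proof.
by move=> fg; apply/eqP; rewrite eq_le; apply/andP; split; apply: Ex_le => G /fg ->.
Qed.

Lemma ExD n f g : Ex n (fun G => f G + g G) = Ex n f + Ex n g.
Proof. by rewrite /Ex -big_split/=; apply: eq_bigr => h _; rewrite mulrDr. Qed.

Lemma ExZ n c f : Ex n (fun G => c * f G) = c * Ex n f.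
Proof. by rewrite /Ex mulr_sumr; apply: eq_bigr => h _; rewrite mulrCA. Qed.

Hypothesis p_sum1 : \sum_i p i = 1.
Hypothesis mass1 : forall n G, reach n G ->
  \sum_(v < nvert G) latch_prob chi rho G v = 1.

Lemma Ex1 n : Ex n (fun=> 1) = 1.
Proof.
elim: n => [|n IH]; last first.
  rewrite ExS -[RHS]IH; apply: Ex_eq => G /mass1 G1; rewrite /step_mean -[RHS]G1.
  by apply: eq_bigr => v _; under eq_bigr do rewrite mulr1; rewrite p_sum1 mulr1.
apply: EFin_inj; rewrite /Ex; under eq_bigr do rewrite mulrC.
rewrite -integral_hists; transitivity (\int[P]_t 1)%E.
  apply: eq_integral => t _; rewrite sum_hists ?hists_uniq// ifT//.
  by apply/mapP; exists (hn_init H t); rewrite ?mem_enum.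
by rewrite integral_cst//= mul1e; exact: probability_setT.
Qed.

(** The histories in [hists n] carry the total mass 1 by [Ex1], so that almost
    surely a function of the network takes finitely many values. *)
Lemma expectation_graph n f : 'E_P[fun t => f (hn_graph H n t)]%E = (Ex n f)%:E.
Proof.
pose F g t := \sum_(h <- hists n) g h * \1_(at_hist n h) t : R.
have FE g t : F g t = if hist n t \in hists n then g (hist n t) else 0.
  by rewrite /F sum_hists ?hists_uniq.
pose U := [set t | hist n t \in hists n].
have mU : measurable U by exact: (measurable_hist n (fun h => h \in hists n)).
have PU : P U = 1%E.
  transitivity (\int[P]_t (F (fun=> 1) t)%:E)%E.
    transitivity (\int[P]_t (\1_U t)%:E)%E.
      by rewrite (integral_indic P measurableT mU) setIT.
    apply: eq_integral => t _; rewrite FE indicE; case: ifPn => [tn|tn].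
      by rewrite mem_set.
    by rewrite memNset//; apply/negP.
  rewrite integral_hists -[RHS](congr1 EFin (Ex1 n)) /Ex.
  by under eq_bigr do rewrite mulrC.
rewrite unlock; transitivity (\int[P]_t (F (fun h => f (graph_of h)) t)%:E)%E.
  apply: ae_eq_integral => //.
  - apply/measurable_EFinP => _ B mB; rewrite setTI.
    rewrite (_ : _ @^-1` _ = [set t | B (f (graph_of (hist n t)))]).
      exact: (measurable_hist n (fun h => B (f (graph_of h)))).
    by apply/seteqP; split=> t /=; rewrite hn_graphE.
  - apply/measurable_EFinP; apply: measurable_sum => h.
    apply: measurable_funM => //; apply: measurable_indic.
    exact: measurable_at_hist.
  - exists (~` U); split; first exact: measurableC.
      by transitivity (1 - P U)%E; [exact: probability_setC|rewrite PU subee].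
    move=> t /= tU Ut; apply: tU => _.
    by rewrite FE Ut hn_graphE.
rewrite integral_hists /Ex; congr EFin; apply: eq_bigr => h _.
by rewrite mulrC.
Qed.

(** A single reachable network has positive probability. *)
Lemma reach_essential n G l : reach n G -> (0 < l)%N -> (2 <= ndeg G l)%N ->
  essential H l.
Proof.
move=> [h [_ ph ->]] l0 Gl; split=> //.
rewrite (@lt_le_trans _ _ (P (at_hist n h)))//; first by rewrite prE lte_fin.
apply: le_measure; rewrite ?inE.
- exact: measurable_at_hist.
- rewrite (_ : [set _ | _] = \bigcup_k [set t | (2 <= ndeg (graph_of (hist k t)) l)%N]).
    by apply: bigcupT_measurable => k;
      exact: (measurable_hist k (fun h => (2 <= ndeg (graph_of h) l)%N)).
  apply/seteqP; split=> [t [k tk]|t [k _ tk]].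
    by exists k => //=; rewrite -hn_graphE.
  by exists k; rewrite hn_graphE.
- by move=> t E; exists n; rewrite hn_graphE E.
Qed.

End Histories.

(** * Degrees under attachment *)

Section Graphs.

(** The invariants of the networks that make attachment transparent for degrees. *)
Definition sound (G : mgraph) : Prop :=
  wf_mgraph G /\ forall u, (u < nvert G)%N -> (0 < deg G u)%N.

Lemma deg_gt0 (G : mgraph) u e : e \in edges G -> (e.1 == u) || (e.2 == u) ->
  (0 < deg G u)%N.
Proof.
move=> eG eu; rewrite /deg (big_rem e)//= addn_gt0.
by case/orP: eu => ->; rewrite ?addn_gt0 ?orbT.
Qed.

Lemma block_deg_gt0 (B : block) u : (u < nvert B)%N -> (0 < deg B u)%N.
Proof.
move=> uB; pose x := Ordinal uB.
have [y yx] : exists y : 'I_(nvert B), y != x.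
  have B1 : (1 < nvert B)%N by exact: block_size.
  have B0 : (0 < nvert B)%N by exact: ltnW.
  have [u0|u0] := eqVneq u 0%N.
    by exists (Ordinal B1); rewrite -val_eqE/= u0.
  by exists (Ordinal B0); rewrite -val_eqE/= eq_sym.
have /connectP[[|z s] /=] := block_connected x y; first by move=> _ E; rewrite E eqxx in yx.
move=> /andP[xz _] _; move: xz; rewrite /adj/= => /orP[] /deg_gt0; apply => /=.
  by rewrite eqxx.
by rewrite eqxx orbT.
Qed.

Lemma block_sound (B : block) : sound B.
Proof. by split; [exact: block_wf|move=> u; exact: block_deg_gt0]. Qed.

Lemma deg_attach (G : mgraph) v (B : block) u : deg (attach G v B) u =
  (deg G u + \sum_(e <- edges B) ((fuse G v B e.1 == u) + (fuse G v B e.2 == u)))%N.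
Proof. by rewrite /deg /= big_cat/= big_map. Qed.

Lemma deg_attach_old (G : mgraph) v (B : block) u : (u < nvert G)%N ->
  deg (attach G v B) u = (deg G u + (u == v) * deg B (hook B))%N.
Proof.
move=> uG; rewrite deg_attach; congr addn; rewrite /deg big_distrr/=.
have E x : (fuse G v B x == u) = (u == v) && (x == hook B).
  rewrite /fuse; case: (x == hook B); rewrite ?andbT ?andbF 1?eq_sym//.
  by apply/negbTE; rewrite neq_ltn (leq_trans uG) ?leq_addr.
by apply: eq_bigr => e _; rewrite !E mulnDr !mulnb.
Qed.

Lemma deg_attach_new (G : mgraph) v (B : block) x : wf_mgraph G -> (v < nvert G)%N ->
  deg (attach G v B) (nvert G + x) = deg B (bump (hook B) x).
Proof.
move=> wG vG; rewrite deg_attach {1}/deg big_seq big1 ?add0n => [|e eG]; last first.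
  have /allP/(_ _ eG)/andP[e1 e2] := wG.
  by rewrite !ltn_eqF// (leq_trans _ (leq_addr _ _)).
have E y : (fuse G v B y == (nvert G + x)%N) = (y == bump (hook B) x).
  rewrite /fuse; case: (eqVneq y (hook B)) => [->|yh].
    by rewrite (ltn_eqF (leq_trans vG (leq_addr _ _))) (negbTE (neq_bump _ _)).
  rewrite eqn_add2l; apply/eqP/eqP => [<-|->]; first by rewrite unbumpK.
  by rewrite bumpK.
by apply: eq_bigr => e _; rewrite !E.
Qed.

Lemma attach_sound (G : mgraph) v (B : block) : sound G -> (v < nvert G)%N ->
  sound (attach G v B).
Proof.
move=> [wG pG] vG.
have hB := hook_vertex B.
have fB y : (y < nvert B)%N -> (fuse G v B y < nvert G + (nvert B).-1)%N.
  move=> yB; rewrite /fuse; case: eqVneq => [_|yh].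
    exact: leq_trans vG (leq_addr _ _).
  rewrite ltn_add2l /unbump; move: yB hB yh; case: (nvert B) => //= n.
  case: (ltnP (hook B) y) => [hy yn hn _|yh' yn hn yh].
    by rewrite subn1 -ltnS prednK//; exact: leq_ltn_trans hy.
  by rewrite subn0; apply: leq_trans (_ : hook B <= n)%N => //; rewrite ltn_neqAle yh.
split.
  apply/allP => e; rewrite mem_cat => /orP[eG|/mapP[e' eB ->]] /=.
    have /allP/(_ _ eG)/andP[e1 e2] := wG.
    by rewrite !(leq_trans _ (leq_addr _ _)).
  by have /allP/(_ _ eB)/andP[e1 e2] := block_wf B; rewrite !fB.
move=> u /= uN; have [uG|Gu] := ltnP u (nvert G).
  by rewrite deg_attach_old// addn_gt0 pG.
rewrite -(subnKC Gu) deg_attach_new//; apply: block_deg_gt0.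
have : (u - nvert G < (nvert B).-1)%N by rewrite ltn_subLR.
have : (0 < nvert B)%N by exact: leq_ltn_trans hB.
rewrite /bump; case: (nvert B) => //= n _ un.
by case: (hook B <= _)%N; rewrite ?add1n ?add0n ltnS// ltnW.
Qed.

Variable V : zmodType.

Definition degsum (f : nat -> V) (G : mgraph) : V := \sum_(u < nvert G) f (deg G u).

Definition newsum (f : nat -> V) (B : block) : V :=
  \sum_(x < nvert B | val x != hook B) f (deg B x).

Lemma degsum_block f (B : block) :
  degsum f B = f (deg B (hook B)) + newsum f B.
Proof.
by rewrite /degsum (bigD1 (Ordinal (hook_vertex B)))//=.
Qed.

(** Old vertices other than the latch keep their degrees, and a new vertex has no
    edges outside the copy of the block. *)
Lemma degsum_attach f (G : mgraph) v (B : block) : wf_mgraph G -> (v < nvert G)%N ->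
  degsum f (attach G v B) = degsum f G - f (deg G v) +
    f (deg G v + deg B (hook B))%N + newsum f B.
Proof.
move=> wG vG; rewrite /degsum big_split_ord/=; congr (_ + _).
  rewrite (bigD1 (Ordinal vG))//= [in RHS](bigD1 (Ordinal vG))//=.
  rewrite deg_attach_old// eqxx mul1n [f (deg G v) + _]addrC addrK [RHS]addrC; congr (_ + _).
  by apply: eq_bigr => u uv; rewrite deg_attach_old// -[val u == v]/(u == Ordinal vG) (negbTE uv) mul0n addn0.
transitivity (\sum_(x < (nvert B).-1) f (deg B (bump (hook B) x))).
  by apply: eq_bigr => x _; rewrite deg_attach_new.
rewrite /newsum; have hB := hook_vertex B; move: hB.
case: (nvert B) => // n hB /=.
apply: (@addrI _ (f (deg B (hook B)))).
transitivity (\sum_(x < n.+1) f (deg B x)).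
  by rewrite (bigD1_ord (Ordinal hB))//=.
by rewrite (bigD1 (Ordinal hB))//=.
Qed.

End Graphs.

Section Weights.
Context {R : realType} (m : nat) (C : 'I_m -> block) (chi rho : R).

Lemma weight_gt0 k : 0 <= chi -> 0 < chi + rho -> (0 < k)%N -> 0 < weight chi rho k.
Proof.
move=> c0 cr0 k0; rewrite /weight (lt_le_trans cr0)// lerD2r ler_peMr//.
by rewrite ler1n.
Qed.

Lemma weight_block (i : 'I_m) : degsum (weight chi rho) (C i) =
  block_gain C chi rho i + rho.
Proof. by rewrite /block_gain subrK. Qed.

Lemma weight_attach (G : mgraph) v (i : 'I_m) : wf_mgraph G -> (v < nvert G)%N ->
  degsum (weight chi rho) (attach G v (C i)) =
  degsum (weight chi rho) G + block_gain C chi rho i.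
Proof.
move=> wG vG; rewrite degsum_attach// /block_gain -/(degsum _ _) degsum_block.
by rewrite /weight natrD; ring.
Qed.

Lemma block_gain_gt0 (i : 'I_m) : 0 <= chi -> 0 < chi + rho ->
  0 < block_gain C chi rho i.
Proof.
move=> c0 cr0; rewrite /block_gain -/(degsum _ _) degsum_block.
have h0 : (0 < deg (C i) (hook (C i)))%N by apply: block_deg_gt0; exact: hook_vertex.
have w0 x : (x < nvert (C i))%N -> 0 < weight chi rho (deg (C i) x).
  by move=> xi; apply: weight_gt0 => //; exact: block_deg_gt0.
have [x xh] : exists x : 'I_(nvert (C i)), val x != hook (C i).
  have B1 : (1 < nvert (C i))%N by exact: block_size.
  have [->|u0] := eqVneq (hook (C i)) 0%N; first by exists (Ordinal B1).
  by exists (Ordinal (ltnW B1)); rewrite eq_sym.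
rewrite /newsum (bigD1 x)//=.
have S0 : 0 <= \sum_(j < nvert (C i) | (val j != hook (C i)) && (j != x))
    weight chi rho (deg (C i) j).
  by apply: sumr_ge0 => j _; rewrite ltW// w0.
have := w0 _ (ltn_ord x); set wx := weight _ _ (deg _ x).
have : 0 <= chi * (deg (C i) (hook (C i)))%:R by rewrite mulr_ge0.
move: S0; rewrite {2}/weight; lra.
Qed.

Lemma ndegE (G : mgraph) k : (ndeg G k)%:R = degsum (fun d => (d == k)%:R : R) G.
Proof.
rewrite /ndeg -sum1_card natr_sum /degsum big_mkcond/=.
by apply: eq_bigr => u _; rewrite inE; case: eqP.
Qed.

Lemma card_newsum (i : 'I_m) k :
  (#|[pred v : 'I_(nvert (C i)) | (val v != hook (C i)) && (deg (C i) v == k)]|)%:R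
  = newsum (fun d => (d == k)%:R : R) (C i).
Proof.
rewrite -sum1_card natr_sum /newsum [RHS]big_mkcond [LHS]big_mkcond/=.
by apply: eq_bigr => u _; rewrite inE; case: (_ != _); case: eqP.
Qed.

End Weights.

(** * Harmonic sums and error terms *)

Section Harmonic.
Context {R : realType}.

Definition harmonic_sum (n : nat) : R := \sum_(j < n) j.+1%:R^-1.

Lemma harmonic_sum_ge0 n : 0 <= harmonic_sum n.
Proof. by apply: sumr_ge0 => j _; rewrite invr_ge0. Qed.

Lemma harmonic_sumS n : harmonic_sum n.+1 = harmonic_sum n + n.+1%:R^-1.
Proof. by rewrite /harmonic_sum big_ord_recr. Qed.

(** The fourth roots x and y of n and n + 1 satisfy y - x >= 1 / (4 y^3), and y^3 is at
    most n + 1. *)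
Lemma harmonic_sum_le n : harmonic_sum n <= 4 * Num.sqrt (Num.sqrt n%:R).
Proof.
elim: n => [|n IH]; first by rewrite /harmonic_sum big_ord0 mulr_ge0// sqrtr_ge0.
rewrite harmonic_sumS; apply: (le_trans (lerD IH (lexx _))).
set x := Num.sqrt (Num.sqrt n%:R); set y := Num.sqrt (Num.sqrt n.+1%:R).
have x0 : 0 <= x by exact: sqrtr_ge0.
have y0 : 0 < y by rewrite !sqrtr_gt0 ltr0Sn.
have x4 : x ^+ 4 = n%:R by rewrite (exprM x 2 2) !sqr_sqrtr// sqrtr_ge0.
have y4 : y ^+ 4 = n.+1%:R by rewrite (exprM y 2 2) !sqr_sqrtr// sqrtr_ge0.
have xy : x <= y by rewrite !ler_sqrt ?sqrtr_ge0// ler_nat.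
have y1 : 1 <= y.
  by rewrite /y -[X in X <= _]sqrtr1 ler_sqrt ?ler01// -[X in X <= _]sqrtr1 ler_sqrt ?ler01// ler1n.
have E : y ^+ 4 - x ^+ 4 = 1 by rewrite x4 y4 -natr1; ring.
rewrite -y4 -lerBrDl -mulrBr -[X in X <= _]mul1r ler_pdivrMr ?exprn_gt0//.
rewrite [leLHS](_ : 1 = (y - x) * (y ^+ 3 + y ^+ 2 * x + y * x ^+ 2 + x ^+ 3));
  last by rewrite -E; ring.
rewrite (mulrC 4) -[leRHS]mulrA ler_wpM2l ?subr_ge0//.
have x2 : x ^+ 2 <= y ^+ 2 by rewrite lerXn2r ?nnegrE ?(ltW y0).
have x3 : x ^+ 3 <= y ^+ 3 by rewrite lerXn2r ?nnegrE ?(ltW y0).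
have a1 : y ^+ 2 * x <= y ^+ 3 by rewrite [y ^+ 3]exprSr ler_wpM2l ?sqr_ge0.
have a2 : y * x ^+ 2 <= y ^+ 3 by rewrite [y ^+ 3]exprS ler_wpM2l ?(ltW y0).
have a3 : y ^+ 3 <= y ^+ 4 by rewrite [y ^+ 4]exprS ler_peMl// exprn_ge0// ltW.
by lra.
Qed.

Lemma near_sqrt4 (c : R) : \forall n \near \oo, c <= Num.sqrt (Num.sqrt n%:R).
Proof.
have c0 : 0 <= `|c| by [].
near=> n; rewrite (le_trans (ler_norm c))//.
rewrite -[leLHS]ger0_norm// -sqrtr_sqr ler_sqrt ?sqrtr_ge0//.
rewrite -[leLHS]ger0_norm ?sqr_ge0// -sqrtr_sqr ler_sqrt//.
by near: n; exact: nbhs_infty_ger.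
Unshelve. all: by end_near. Qed.

Lemma invr_sqrt4_cvg0 (c : R) :
  c / Num.sqrt (Num.sqrt n%:R) @[n --> \oo] --> (0 : R).
Proof.
apply/cvgr0Pnorm_le => /= e e0; near=> n.
have n0 : 0 < Num.sqrt (Num.sqrt n%:R) :> R.
  by rewrite !sqrtr_gt0 ltr0n; near: n; exact: nbhs_infty_gt.
rewrite normrM normfV (gtr0_norm n0) ler_pdivrMr// -ler_pdivrMl//.
by rewrite mulrC; near: n; exact: near_sqrt4.
Unshelve. all: by end_near. Qed.

Lemma cvg0_le_sqrt4 (u : nat -> R) (c : R) :
  (\forall n \near \oo, `|u n| <= c / Num.sqrt (Num.sqrt n%:R)) ->
  u n @[n --> \oo] --> (0 : R).
Proof.
move=> uc; apply/norm_cvg0P; apply: (@squeeze_cvgr _ _ _ _ (fun=> 0)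
  (fun n => c / Num.sqrt (Num.sqrt n%:R))).
- by near=> n; rewrite normr_ge0/=; near: n.
- exact: cvg_cst.
- exact: invr_sqrt4_cvg0.
Unshelve. all: by end_near. Qed.

Lemma norm_expRB_le (y : R) : `|expR y - 1| <= `|y| * expR `|y|.
Proof.
have [y0|y0] := leP 0 y.
  rewrite (ger0_norm y0) ger0_norm; last by rewrite subr_ge0 -expR0 ler_expR.
  have := expR_ge1Dx (- y); rewrite expRN => H.
  have ey := expR_gt0 y.
  have : (1 - y) * expR y <= 1 by rewrite -ler_pdivlMr// mul1r.
  by lra.
have E : expR y <= 1 by rewrite -expR0 ler_expR ltW.
rewrite (ltr0_norm y0) ler0_norm ?subr_le0//.
have := expR_ge1Dx y; have : 1 <= expR (- y) by rewrite -expR0 ler_expR oppr_ge0 ltW.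
by move: (expR (- y)) => u u1 H; nra.
Qed.

End Harmonic.

(** * A central limit theorem for nearly linear recursions *)

(** The vector [Y n G] is a statistic of the state [G] after [n] steps, [Ex n] the mean
    over the states and [good] their support. One step changes the linear form
    [dot a Y] into [dot (A' n a) Y] plus a jump, whose conditional law is [J n G a]. Up
    to errors of order (1 + |Y|) / n the jumps are centred and have variance
    [beta a], and [sigma] is the quadratic form that is compatible with [A'] and
    [beta]. The map [A' n] does not increase the maximum norm once n >= [n0]. All
    estimates are uniform in the linear forms with entries bounded by [kap]. *)
Section AbstractClt.
Context {R : realType} {r : nat} (S : Type).
Variables (Ex : nat -> (S -> R) -> R) (good : nat -> S -> Prop).
Variables (Y : nat -> S -> 'rV[R]_r) (A' : nat -> 'rV[R]_r -> 'rV[R]_r).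
Variable J : nat -> S -> 'rV[R]_r -> (R -> R) -> R.
Variables (beta sigma : 'rV[R]_r -> R) (K : R) (n0 : nat).
Implicit Types (a : 'rV[R]_r) (kap : R) (n : nat) (G : S).

Definition entries_le kap a : Prop := forall i, `|a 0 i| <= kap.

Hypothesis K1 : 1 <= K.
Hypothesis Ex1 : forall n, Ex n (fun=> 1) = 1.
Hypothesis ExD : forall n f g, Ex n (fun G => f G + g G) = Ex n f + Ex n g.
Hypothesis ExZ : forall n c f, Ex n (fun G => c * f G) = c * Ex n f.
Hypothesis Ex_le : forall n f g,
  (forall G, good n G -> f G <= g G) -> Ex n f <= Ex n g.
Hypothesis J1 : forall n G a, good n G -> J n G a (fun=> 1) = 1.
Hypothesis JD : forall n G a f g,
  J n G a (fun v => f v + g v) = J n G a f + J n G a g.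
Hypothesis JZ : forall n G a c f, J n G a (fun v => c * f v) = c * J n G a f.
Hypothesis J_le : forall n G a kap f g, good n G -> entries_le kap a ->
  (forall v, `|v| <= kap * K -> f v <= g v) -> J n G a f <= J n G a g.
Hypothesis J_mean : forall n G a kap, good n G -> entries_le kap a ->
  `|J n G a id| <= kap * K / n.+1%:R.
Hypothesis J_var : forall n G a kap, good n G -> entries_le kap a ->
  `|J n G a (fun v => v ^+ 2) - beta a| <=
  kap ^+ 2 * K * (1 + \sum_l `|Y n G 0 l|) / n.+1%:R.
Hypothesis step : forall n a (f : R -> R),
  Ex n.+1 (fun G => f (dot a (Y n.+1 G))) =
  Ex n (fun G => J n G a (fun v => f (dot (A' n a) (Y n G) + v))).
Hypothesis A'_le : forall n a kap, (n0 <= n)%N -> entries_le kap a ->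
  entries_le kap (A' n a).
Hypothesis Y_le : forall n G l, good n G -> `|Y n G 0 l| <= K * n.+1%:R.
Hypothesis beta_le : forall a kap, entries_le kap a -> `|beta a| <= kap ^+ 2 * K.
Hypothesis sigma_le : forall a kap, entries_le kap a -> `|sigma a| <= kap ^+ 2 * K.
Hypothesis sigmaZ : forall a c, sigma (c *: a) = c ^+ 2 * sigma a.
Hypothesis lyapunov : forall n a kap, (n0 <= n)%N -> entries_le kap a ->
  `|n%:R * sigma (A' n a) + beta a - n.+1%:R * sigma a| <= kap ^+ 2 * K / n.+1%:R.

Let K_gt0 : 0 < K. Proof. exact: lt_le_trans K1. Qed.
Let K_ge0 : 0 <= K. Proof. exact: ltW. Qed.

Let ExN n f : Ex n (fun G => - f G) = - Ex n f.
Proof.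
rewrite -mulN1r -ExZ; congr (Ex n _).
by apply/funext => G; rewrite mulN1r.
Qed.

Let Ex_cst n c : Ex n (fun=> c) = c.
Proof.
rewrite -[RHS]mulr1 -(Ex1 n) -ExZ; congr (Ex n _).
by apply/funext => G; rewrite mulr1.
Qed.

Let Ex_norm n f : `|Ex n f| <= Ex n (fun G => `|f G|).
Proof.
rewrite ler_norml; apply/andP; split; last by apply: Ex_le => G _; exact: ler_norm.
by rewrite -ExN; apply: Ex_le => G _; rewrite lerNl -normrN ler_norm.
Qed.

Let ExB n f g : Ex n (fun G => f G - g G) = Ex n f - Ex n g.
Proof. by rewrite ExD ExN. Qed.

Let Ex_dist n f g h : (forall G, good n G -> `|f G - g G| <= h G) ->
  `|Ex n f - Ex n g| <= Ex n h.
Proof.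
move=> H; rewrite -ExB (le_trans (Ex_norm _ _))//; exact: Ex_le.
Qed.

Let JN n G a f : J n G a (fun v => - f v) = - J n G a f.
Proof.
rewrite -mulN1r -JZ; congr (J n G a _).
by apply/funext => v; rewrite mulN1r.
Qed.

Let J_cst n G a c : good n G -> J n G a (fun=> c) = c.
Proof.
move=> gG; rewrite -[RHS]mulr1 -(J1 a gG) -JZ; congr (J n G a _).
by apply/funext => v; rewrite mulr1.
Qed.

Let J_dist n G a kap f g h : good n G -> entries_le kap a ->
  (forall v, `|v| <= kap * K -> `|f v - g v| <= h v) ->
  `|J n G a f - J n G a g| <= J n G a h.
Proof.
move=> gG ak H; rewrite -JN -JD ler_norml; apply/andP; split.
  rewrite -JN; apply: (J_le gG ak) => v /H; rewrite ler_norml => /andP[]; lra.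
by apply: (J_le gG ak) => v /H; rewrite ler_norml => /andP[]; lra.
Qed.

Lemma entries_le_ge0 kap a : (0 < r)%N -> entries_le kap a -> 0 <= kap.
Proof. by move=> r0 /(_ (Ordinal r0)); exact: le_trans. Qed.

Lemma dot_le kap a n G : 0 <= kap -> good n G -> entries_le kap a ->
  `|dot a (Y n G)| <= kap * (r%:R * K * n.+1%:R).
Proof.
move=> k0 gG ak; rewrite /dot (le_trans (ler_norm_sum _ _ _))//.
rewrite (@le_trans _ _ (\sum_(i < r) kap * (K * n.+1%:R)))//.
  by apply: ler_sum => i _; rewrite normrM ler_pM// Y_le.
rewrite sumr_const card_ord -[X in X <= _]mulr_natl.
by rewrite le_eqVlt; apply/orP; left; apply/eqP; ring.
Qed.

Let K0 := r%:R * K * n0.+1%:R.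
Let K0_ge0 : 0 <= K0. Proof. by rewrite !mulr_ge0. Qed.

Let dot_early kap a n G : 0 <= kap -> (n <= n0)%N -> good n G -> entries_le kap a ->
  `|dot a (Y n G)| <= kap * K0.
Proof.
move=> k0 nn gG ak; rewrite (le_trans (dot_le k0 gG ak))// ler_wpM2l//.
by rewrite /K0 ler_wpM2l ?mulr_ge0// ler_nat.
Qed.

Let e1 : R := expR 1.
Let e1_ge0 : 0 <= e1. Proof. exact: expR_ge0. Qed.

(** Exponential moments: conditionally on the past the mean of the jump is
    O(kap / n) and its square is O(kap^2), so each step costs a factor
    1 + O(kap / n + kap^2). *)
Lemma exp_moment n a kap : 0 <= kap -> kap * K <= 1 -> entries_le kap a ->
  Ex n (fun G => expR (dot a (Y n G))) <=
  expR (kap * K0 + (kap * K * @harmonic_sum R n + n%:R * (e1 * (kap * K) ^+ 2))).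
Proof.
move=> k0 kK; elim: n a => [|n IH] a ak.
  rewrite -[leRHS](Ex_cst 0); apply: Ex_le => G gG.
  rewrite /harmonic_sum big_ord0 mulr0 mul0r !addr0 ler_expR.
  by rewrite (le_trans (ler_norm _))// dot_early.
have [nn|nn] := leqP n.+1 n0.
  rewrite -[leRHS](Ex_cst n.+1); apply: Ex_le => G gG.
  rewrite ler_expR (le_trans (ler_norm _))// (le_trans (dot_early k0 nn gG ak))//.
  by rewrite lerDl addr_ge0 ?mulr_ge0 ?harmonic_sum_ge0 ?sqr_ge0.
rewrite step.
pose c := kap * K / n.+1%:R + e1 * (kap * K) ^+ 2.
have Jexp G : good n G -> J n G a (fun v => expR (dot (A' n a) (Y n G) + v)) <=
    expR c * expR (dot (A' n a) (Y n G)).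
  move=> gG; set u := dot _ _.
  have -> : (fun v => expR (u + v)) = (fun v => expR u * expR v).
    by apply/funext => v; rewrite expRD.
  rewrite JZ mulrC ler_wpM2r ?expR_ge0//.
  apply: (@le_trans _ _ (J n G a (fun v => (1 + v) + e1 * (kap * K) ^+ 2))).
    apply: (J_le gG ak) => v vk; rewrite (le_trans (expR_le_taylor (le_trans vk kK)))//.
    rewrite lerD2l ler_wpM2l// -real_normK ?num_real// lerXn2r ?nnegrE//.
    by rewrite mulr_ge0.
  rewrite JD J_cst// JD J1// (le_trans _ (expR_ge1Dx _))// -addrA lerD2l lerD2r.
  exact: le_trans (ler_norm _) (J_mean gG ak).
apply: (le_trans (Ex_le Jexp)); rewrite ExZ.
rewrite (le_trans (ler_wpM2l (expR_ge0 _) (IH _ (A'_le nn ak))))//.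
rewrite -expRD ler_expR harmonic_sumS /c -natr1.
by rewrite le_eqVlt; apply/orP; left; apply/eqP; ring.
Qed.

Let M1 : R := expR (K0 + (4 + e1)).

Let sqrtn (n : nat) : R := Num.sqrt n.+1%:R.
Let sqrtn_ge1 n : 1 <= sqrtn n.
Proof. by rewrite /sqrtn -[X in X <= _]sqrtr1 ler_sqrt ?ler01// ler1n. Qed.
Let sqrtn_gt0 n : 0 < sqrtn n. Proof. exact: lt_le_trans (sqrtn_ge1 n). Qed.

Let exp_moment_scaled n l (eps : R) : `|eps| <= 1 ->
  Ex n (fun G => expR (eps * (Y n G 0 l / (K * sqrtn n)))) <= M1.
Proof.
move=> eps1; have s0 := sqrtn_gt0 n; have s1 := sqrtn_ge1 n.
pose kap := (K * sqrtn n)^-1.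
have kap0 : 0 <= kap by rewrite invr_ge0 mulr_ge0// ltW.
have kapK : kap * K = (sqrtn n)^-1.
  by rewrite /kap invfM mulrAC mulVf ?mul1r// gt_eqF.
have kap1 : kap <= 1.
  rewrite invf_le1 ?mulr_gt0// -[X in X <= _]mulr1 ler_pM//.
pose a : 'rV[R]_r := (eps * kap) *: delta_mx 0 l.
have ak : entries_le kap a.
  move=> i; rewrite !mxE eqxx /= normrM; case: (_ == _); rewrite ?normr0 ?mulr0//.
  by rewrite normr1 mulr1 normrM (ger0_norm kap0) ler_piMl.
have aY G : dot a (Y n G) = eps * (Y n G 0 l / (K * sqrtn n)).
  rewrite /dot (bigD1 l)//= big1 ?addr0 => [|i il]; rewrite !mxE eqxx/=.
    by rewrite eqxx mulr1 -mulrA; congr (_ * _); rewrite mulrC.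
  by rewrite (negbTE il) mulr0 mul0r.
have k1 : kap * K <= 1 by rewrite kapK invf_le1.
have := exp_moment n kap0 k1 ak.
have -> : Ex n (fun G => expR (dot a (Y n G))) =
    Ex n (fun G => expR (eps * (Y n G 0 l / (K * sqrtn n)))).
  by congr (Ex n _); apply/funext => G; rewrite aY.
move=> /le_trans; apply; rewrite /M1 ler_expR; apply: lerD.
  by rewrite ler_piMl.
apply: lerD.
  rewrite kapK mulrC ler_pdivrMr// (le_trans (harmonic_sum_le _))// ler_wpM2l//.
  rewrite /sqrtn ler_sqrt ?ler0n// (@le_trans _ _ (Num.sqrt n.+1%:R)).
  - by [].
  - by rewrite ler_sqrt ?ler0n// ler_nat.
  - rewrite -[leRHS]sqr_sqrtr ?ler0n// expr2 ler_peMl ?sqrtr_ge0//.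
rewrite kapK exprVn /sqrtn sqr_sqrtr ?ler0n// mulrCA ler_piMr//.
by rewrite ler_pdivrMr ?ltr0Sn// mul1r ler_nat.
Qed.

(** The exponential moment bound for forms of size 1 / sqrt n, where its exponent
    stays bounded. *)
Lemma abs_moment n l q : Ex n (fun G => `|Y n G 0 l| ^+ q) <=
  (q`!%:R * (M1 + M1) * K ^+ q) * sqrtn n ^+ q.
Proof.
have s0 := sqrtn_gt0 n.
have H : Ex n (fun G => `|Y n G 0 l / (K * sqrtn n)| ^+ q) <= q`!%:R * (M1 + M1).
  apply: (@le_trans _ _ (Ex n (fun G => q`!%:R *
     (expR (1 * (Y n G 0 l / (K * sqrtn n))) +
      expR (-1 * (Y n G 0 l / (K * sqrtn n))))))).
    by apply: Ex_le => G _; rewrite mul1r mulN1r; exact: exprn_le_expD.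
  rewrite ExZ ler_wpM2l// ExD lerD//; apply: exp_moment_scaled.
    by rewrite normr1.
  by rewrite normrN normr1.
have Ks0 : 0 < K * sqrtn n by rewrite mulr_gt0.
have -> : Ex n (fun G => `|Y n G 0 l| ^+ q) =
    (K * sqrtn n) ^+ q * Ex n (fun G => `|Y n G 0 l / (K * sqrtn n)| ^+ q).
  rewrite -ExZ; congr (Ex n _); apply/funext => G.
  by rewrite -exprMn -[X in X * _](gtr0_norm Ks0) -normrM mulrC divfK// gt_eqF.
by rewrite -[leRHS]mulrA -exprMn [leRHS]mulrC ler_wpM2l// exprn_ge0// ltW.
Qed.

(** The conditional means of the jumps add up to a harmonic sum. *)
Lemma mean_le n a kap : 0 <= kap -> entries_le kap a ->
  `|Ex n (fun G => dot a (Y n G))| <= kap * (K0 + K * @harmonic_sum R n).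
Proof.
move=> k0; elim: n a => [|n IH] a ak.
  rewrite /harmonic_sum big_ord0 mulr0 addr0 (le_trans (Ex_norm _ _))//.
  rewrite -[leRHS](Ex_cst 0); apply: Ex_le => G gG; exact: dot_early.
have [nn|nn] := leqP n.+1 n0.
  rewrite (le_trans (Ex_norm _ _))// -[leRHS](Ex_cst n.+1); apply: Ex_le => G gG.
  rewrite (le_trans (dot_early k0 nn gG ak))// ler_wpM2l// lerDl.
  by rewrite mulr_ge0// harmonic_sum_ge0.
rewrite (step n a id).
have : `|Ex n (fun G => J n G a (fun v => id (dot (A' n a) (Y n G) + v))) -
         Ex n (fun G => dot (A' n a) (Y n G))| <= kap * K / n.+1%:R.
  rewrite -[leRHS](Ex_cst n); apply: Ex_dist => G gG.
  by rewrite JD J_cst// addrC addKr; exact: J_mean.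
have := IH _ (A'_le nn ak).
set x := Ex n _; set y := Ex n _ => H1 H2.
rewrite -(subrK x y) (le_trans (ler_normD _ _))// (le_trans (lerD H2 H1))//.
rewrite harmonic_sumS le_eqVlt; apply/orP; left; apply/eqP.
by ring.
Qed.

Let M2 : R := (M1 + M1) * K.
Let M2_ge0 : 0 <= M2. Proof. by rewrite mulr_ge0// addr_ge0 ?expR_ge0. Qed.

Let Ex_abs n : Ex n (fun G => \sum_l `|Y n G 0 l|) <= r%:R * M2 * sqrtn n.
Proof.
have Exsum (I : Type) (s : seq I) (f : I -> S -> R) :
    Ex n (fun G => \sum_(l <- s) f l G) = \sum_(l <- s) Ex n (f l).
  elim: s => [|i s IH].
    by rewrite big_nil -[RHS](Ex_cst n 0); congr (Ex n _); apply/funext => G; rewrite big_nil.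
  rewrite big_cons -IH -ExD; congr (Ex n _); apply/funext => G; exact: big_cons.
rewrite Exsum; apply: (@le_trans _ _ (\sum_(l < r) M2 * sqrtn n)).
  apply: ler_sum => l _; have := abs_moment n l 1.
  by rewrite (_ : 1`!%N = 1%N) // mul1r !expr1.
by rewrite sumr_const card_ord -[X in X <= _]mulr_natl mulrA.
Qed.

Let K5 : R := 2 * K ^+ 3 + K + K * (1 + r%:R * M2).

(** Second order expansion in the jump: the characteristic function is multiplied by
    1 - beta / 2. The variance error is of order kap^2 / sqrt n because Y has order
    sqrt n. *)
Let jump_cos n a kap b : (n0 <= n)%N -> 0 <= kap -> kap * K <= 1 -> entries_le kap a ->
  `|Ex n.+1 (fun G => cos (dot a (Y n.+1 G) + b)) -
    (1 - beta a / 2) * Ex n (fun G => cos (dot (A' n a) (Y n G) + b))| <=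
  K5 * (kap ^+ 3 + kap / n.+1%:R).
Proof.
move=> nn k0 kK ak; rewrite (step n a (fun x => cos (x + b))).
have sq0 := sqrtn_gt0 n.
have N0 : 0 < n.+1%:R :> R by rewrite ltr0Sn.
have N1 : n.+1%:R^-1 = (sqrtn n)^-1 ^+ 2 by rewrite exprVn sqr_sqrtr// ler0n.
rewrite -ExZ.
pose h G := (2 * (kap * K) ^+ 3 + kap * K / n.+1%:R) +
   (kap ^+ 2 * K / n.+1%:R) * (1 + \sum_l `|Y n G 0 l|).
apply: (@le_trans _ _ (Ex n h)).
  apply: Ex_dist => G gG; set u := dot _ _ + b.
  have -> : (fun v => cos (dot (A' n a) (Y n G) + v + b)) = (fun v => cos (u + v)).
    by apply/funext => v; rewrite /u addrAC.
  have T : `|J n G a (fun v => cos (u + v)) -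
      J n G a (fun v => cos u + ((- sin u) * v + (- (cos u / 2)) * v ^+ 2))| <=
      2 * (kap * K) ^+ 3.
    rewrite -[leRHS](J_cst a _ gG); apply: (J_dist gG ak) => v vk.
    have := cosD_taylor u (le_trans vk kK).
    have -> : cos u - v * sin u - v ^+ 2 / 2 * cos u =
      cos u + (- sin u * v + - (cos u / 2) * v ^+ 2) by ring.
    move=> /le_trans; apply; rewrite ler_wpM2l// lerXn2r// nnegrE//.
    by rewrite mulr_ge0.
  move: T; rewrite JD J_cst// JD !JZ => T.
  have T1 := J_mean gG ak; have T2 := J_var gG ak.
  rewrite -/id in T1.
  have T1' : `|- sin u * J n G a (fun v => v)| <= kap * K / n.+1%:R.
    rewrite normrM normrN -[leRHS]mul1r ler_pM//; exact: normr_sin_le1.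
  have T2' : `|- (cos u / 2) * (J n G a (fun v => v ^+ 2) - beta a)| <=
      kap ^+ 2 * K / n.+1%:R * (1 + \sum_l `|Y n G 0 l|).
    rewrite normrM -[leRHS]mul1r ler_pM//.
      rewrite normrN normrM (_ : `|2^-1| = 2^-1 :> R); last by rewrite ger0_norm ?invr_ge0.
      have := normr_cos_le1 u; lra.
    by rewrite (le_trans T2)// le_eqVlt; apply/orP; left; apply/eqP; ring.
  move: T T1' T2'; rewrite /h.
  set j0 := J _ _ _ _; set j1 := J _ _ _ _; set j2 := J _ _ _ _; set B := beta a.
  set z := \sum_l _; move=> T T1' T2'.
  have -> : j0 - (1 - B / 2) * cos u =
    (j0 - (cos u + (- sin u * j1 + - (cos u / 2) * j2))) +
    - sin u * j1 + - (cos u / 2) * (j2 - B) by ring.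
  by rewrite (le_trans (ler_normD _ _))// lerD// (le_trans (ler_normD _ _))// lerD.
rewrite /h ExD Ex_cst ExZ ExD Ex1.
have c0 : 0 <= kap ^+ 2 * K / n.+1%:R by rewrite !mulr_ge0// ?sqr_ge0// invr_ge0 ltW.
have H1 : 1 + Ex n (fun G => \sum_l `|Y n G 0 l|) <= (1 + r%:R * M2) * sqrtn n.
  rewrite mulrDl mul1r lerD//; exact: sqrtn_ge1.
rewrite (le_trans (lerD (lexx _) (ler_wpM2l c0 H1)))//.
(* 2 x y <= x^2 + y^2 with x = kap and y = 1 / sqrt (n + 1) *)
have H2 : kap ^+ 2 / n.+1%:R * sqrtn n <= kap ^+ 3 + kap / n.+1%:R.
  rewrite N1 [kap ^+ 2]expr2.
  have -> : kap * kap * (sqrtn n)^-1 ^+ 2 * sqrtn n = kap * (kap * (sqrtn n)^-1).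
    by rewrite expr2 -!mulrA mulVf ?mulr1// gt_eqF.
  have -> : kap ^+ 3 + kap * (sqrtn n)^-1 ^+ 2 = kap * (kap ^+ 2 + (sqrtn n)^-1 ^+ 2).
    by ring.
  rewrite ler_wpM2l//; move: (_^-1) => y.
  have := sqr_ge0 (kap - y); have := sqr_ge0 (kap + y); rewrite !expr2; lra.
rewrite /K5 [leRHS]mulrDl [X in _ <= X + _]mulrDl.
apply: lerD; first apply: lerD.
- rewrite (_ : 2 * (kap * K) ^+ 3 = 2 * K ^+ 3 * kap ^+ 3); last by ring.
  rewrite ler_wpM2l ?mulr_ge0 ?exprn_ge0//.
  by rewrite lerDl mulr_ge0// invr_ge0 ltW.
- by rewrite [kap * K]mulrC -mulrA ler_wpM2l// lerDr exprn_ge0.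
- have -> : kap ^+ 2 * K / n.+1%:R * ((1 + r%:R * M2) * sqrtn n) =
    K * (1 + r%:R * M2) * (kap ^+ 2 / n.+1%:R * sqrtn n) by ring.
  by rewrite ler_wpM2l// mulr_ge0// addr_ge0// mulr_ge0.
Qed.

Let ncos n a b := Ex n (fun G => cos (dot a (Y n G) + b)).

Let ncos_le1 n a b : `|ncos n a b| <= 1.
Proof.
rewrite (le_trans (Ex_norm _ _))// -[leRHS](Ex_cst n); apply: Ex_le => G _.
exact: normr_cos_le1.
Qed.

Let K6 (L : R) : R := K0 + n0%:R * expR (L * K) + expR (L * K) * (K5 + e1 * K + e1).

(** Multiplied by the inverse of the expected Gaussian characteristic function the
    cosine moments are almost constant: one step changes the form from [a] to
    [A' n a] and the factor by exp (beta / 2), and both changes cancel the factor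
    1 - beta / 2 of the jump up to summable errors. *)
Lemma char_le n a kap b L : 0 <= kap -> kap * K <= 1 -> n%:R * kap ^+ 2 <= L ->
  entries_le kap a ->
  `|ncos n a b * expR (n%:R * sigma a / 2) - cos b| <=
  K6 L * (kap + kap * @harmonic_sum R n + n%:R * kap ^+ 3).
Proof.
move=> k0 kK; have K5_ge0 : 0 <= K5.
  by rewrite /K5 !addr_ge0// !mulr_ge0// ?exprn_ge0// addr_ge0// mulr_ge0.
have rest_ge0 : 0 <= expR (L * K) * (K5 + e1 * K + e1).
  rewrite mulr_ge0 ?expR_ge0//; apply: addr_ge0 => //; apply: addr_ge0 => //.
  exact: mulr_ge0.
have K6_ge0 : 0 <= K6 L.
  apply: addr_ge0 => //; apply: addr_ge0 => //.
have k1 : kap <= 1 by rewrite (le_trans _ kK)// ler_peMr.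
have sig_le j x : j%:R * kap ^+ 2 <= L -> entries_le kap x ->
    `|j%:R * sigma x / 2| <= L * K.
  move=> jL xk; rewrite -mulrA normrM ger0_norm// normrM [`|2^-1|]ger0_norm ?invr_ge0//.
  apply: (@le_trans _ _ (j%:R * kap ^+ 2 * K)); last by rewrite ler_wpM2r.
  rewrite -mulrA ler_wpM2l//; have := sigma_le xk; have := normr_ge0 (sigma x); lra.
have pos0 j : 0 <= kap + kap * @harmonic_sum R j + j%:R * kap ^+ 3.
  by rewrite !addr_ge0// ?mulr_ge0 ?harmonic_sum_ge0 ?exprn_ge0.
have early j x : (j <= n0)%N -> j%:R * kap ^+ 2 <= L -> entries_le kap x ->
    `|ncos j x b * expR (j%:R * sigma x / 2) - cos b| <=
    K6 L * (kap + kap * @harmonic_sum R j + j%:R * kap ^+ 3).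
  move=> jn jL xk; set y := j%:R * sigma x / 2.
  have y1 : `|y| <= L * K by exact: sig_le.
  have y2 : `|y| <= n0%:R * kap.
    rewrite /y -mulrA normrM ger0_norm// normrM [`|2^-1|]ger0_norm ?invr_ge0//.
    rewrite ler_pM ?ler_nat// ?mulr_ge0 ?invr_ge0//.
    have s1 := sigma_le xk; have : kap ^+ 2 * K <= kap.
      by rewrite expr2 -mulrA ler_piMr.
    have := normr_ge0 (sigma x); lra.
  have -> : ncos j x b * expR y - cos b =
    (ncos j x b - cos b) + ncos j x b * (expR y - 1) by ring.
  rewrite (le_trans (ler_normD _ _))//.
  have H1 : `|ncos j x b - cos b| <= kap * K0.
    rewrite -(Ex_cst j (cos b)) -[leRHS](Ex_cst j); apply: Ex_dist => G gG.
    apply: le_trans (dot_early k0 jn gG xk).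
    exact: norm_cosD_le.
  have H2 : `|ncos j x b * (expR y - 1)| <= n0%:R * kap * expR (L * K).
    rewrite normrM -[leRHS]mul1r ler_pM// (le_trans (norm_expRB_le _))//.
    by rewrite ler_pM ?expR_ge0// ler_expR.
  rewrite (le_trans (lerD H1 H2))//.
  apply: (@le_trans _ _ (K6 L * kap)).
    rewrite /K6 [leRHS]mulrDl [X in _ <= X + _]mulrDl.
    rewrite [kap * K0]mulrC [n0%:R * kap * _]mulrAC lerDl.
    exact: mulr_ge0.
  rewrite ler_wpM2l//.
  by rewrite -addrA lerDl addr_ge0// mulr_ge0 ?harmonic_sum_ge0 ?exprn_ge0.
elim: n a => [|n IH] a nL ak; first exact: early.
have [nn|nn] := leqP n.+1 n0; first exact: early.
have N0 : 0 < n.+1%:R :> R by rewrite ltr0Sn.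
have nL' : n%:R * kap ^+ 2 <= L.
  by apply: le_trans nL; rewrite ler_wpM2r ?sqr_ge0// ler_nat.
have a'k := A'_le nn ak.
have kN : 0 <= kap / n.+1%:R by rewrite divr_ge0.
have kN1 : kap / n.+1%:R <= 1.
  by rewrite ler_pdivrMr// mul1r (le_trans k1)// ler1n.
set eps := kap ^+ 3 + kap / n.+1%:R.
have eps0 : 0 <= eps by rewrite addr_ge0// exprn_ge0.
have S1 : `|ncos n.+1 a b - (1 - beta a / 2) * ncos n (A' n a) b| <= K5 * eps.
  exact: jump_cos.
have B1 := beta_le ak.
have kk : kap ^+ 2 * K <= kap by rewrite expr2 -mulrA ler_piMr.
have S2 : `|expR (- (beta a / 2)) - (1 - beta a / 2)| <= e1 * K * kap ^+ 3.
  have b1 : `|- (beta a / 2)| <= 1.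
    rewrite normrN normrM [`|2^-1|]ger0_norm ?invr_ge0//.
    have := normr_ge0 (beta a); lra.
  have u1 := expR_le_taylor b1; have l1 := expR_ge1Dx (- (beta a / 2)).
  rewrite ger0_norm; last by rewrite subr_ge0.
  rewrite lerBlDl (le_trans u1)// lerD2l -/e1 -mulrA ler_wpM2l//.
  rewrite sqrrN -real_normK ?num_real// normrM [`|2^-1|]ger0_norm ?invr_ge0//.
  apply: (@le_trans _ _ ((kap ^+ 2 * K) ^+ 2)).
    rewrite lerXn2r ?nnegrE ?mulr_ge0 ?invr_ge0 ?sqr_ge0//.
    have := normr_ge0 (beta a); lra.
  have -> : (kap ^+ 2 * K) ^+ 2 = (kap * K) * (K * kap ^+ 3) by ring.
  by rewrite ler_piMl// mulr_ge0// exprn_ge0.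
set E1 := expR (n.+1%:R * sigma a / 2).
set E0 := expR (n%:R * sigma (A' n a) / 2).
have E1_le : E1 <= expR (L * K).
  by rewrite ler_expR (le_trans (ler_norm _))// sig_le.
have E0_le : E0 <= expR (L * K).
  by rewrite ler_expR (le_trans (ler_norm _))// sig_le.
have S3 : `|expR (- (beta a / 2)) * E1 - E0| <= expR (L * K) * (e1 * eps).
  pose dl := (n.+1%:R * sigma a - n%:R * sigma (A' n a) - beta a) / 2.
  have -> : expR (- (beta a / 2)) * E1 = E0 * expR dl.
    by rewrite /E1 /E0 -!expRD; congr expR; rewrite /dl; field.
  have d1 : `|dl| <= kap / n.+1%:R.
    have ly := lyapunov nn ak.
    have kn : kap ^+ 2 * K / n.+1%:R <= kap / n.+1%:R.
      by rewrite ler_wpM2r// invr_ge0 ltW.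
    have -> : dl = - (n%:R * sigma (A' n a) + beta a - n.+1%:R * sigma a) / 2.
      by rewrite /dl; field.
    rewrite normrM normrN [`|2^-1|]ger0_norm ?invr_ge0//.
    move: (le_trans ly kn); set z := `|_|; have : 0 <= z by exact: normr_ge0.
    by move: kN; set y := kap / _; lra.
  rewrite -[X in _ - X]mulr1 -mulrBr normrM ger0_norm ?expR_ge0//.
  rewrite ler_pM ?expR_ge0// (le_trans (norm_expRB_le _))// mulrC.
  rewrite ler_pM ?expR_ge0// ?ler_expR ?(le_trans d1)//.
  by rewrite lerDr exprn_ge0.
have {}IH := IH _ nL' a'k.
move: S1 IH; set x1 := ncos n.+1 a b; set x0 := ncos n (A' n a) b => S1 IH.
have x0_1 : `|x0| <= 1 by exact: ncos_le1.
have D : `|x1 * E1 - x0 * E0| <= expR (L * K) * (K5 + e1 * K + e1) * eps.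
  have -> : x1 * E1 - x0 * E0 =
     (x1 - (1 - beta a / 2) * x0) * E1 +
     x0 * (- (expR (- (beta a / 2)) - (1 - beta a / 2))) * E1 +
     x0 * (expR (- (beta a / 2)) * E1 - E0) by ring.
  rewrite [leRHS](_ : _ = K5 * eps * expR (L * K) + 1 * (e1 * K * eps) * expR (L * K) +
      1 * (expR (L * K) * (e1 * eps))); last by ring.
  rewrite (le_trans (ler_normD _ _))// lerD//; last by rewrite normrM ler_pM.
  rewrite (le_trans (ler_normD _ _))// lerD//.
    by rewrite normrM ler_pM// ger0_norm ?expR_ge0.
  rewrite normrM ler_pM//; last by rewrite ger0_norm ?expR_ge0.
  rewrite normrM ler_pM// normrN (le_trans S2)// ler_wpM2l ?mulr_ge0//.
  by rewrite lerDl.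
have -> : x1 * E1 - cos b = (x1 * E1 - x0 * E0) + (x0 * E0 - cos b) by ring.
rewrite (le_trans (ler_normD _ _))// (le_trans (lerD D IH))//.
have D' : expR (L * K) * (K5 + e1 * K + e1) * eps <= K6 L * eps.
  by rewrite ler_wpM2r// /K6 lerDr addr_ge0// mulr_ge0// expR_ge0.
rewrite (le_trans (lerD D' (lexx _)))// -mulrDr.
rewrite harmonic_sumS /eps -[n.+1%:R * kap ^+ 3]/(n.+1%:R * _) -natr1 le_eqVlt.
by apply/orP; left; apply/eqP; congr (_ * _); rewrite natr1; rewrite -[X in _ = _ + X * _]natr1; ring.
Qed.

Let z (n : nat) : R := (Num.sqrt n%:R)^-1.
Let z_ge0 n : 0 <= z n. Proof. by rewrite invr_ge0 sqrtr_ge0. Qed.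

(** The scaled bound on absolute moments; n + 1 is at most 4 n for positive n, and the
    scale factor is 0 for n = 0. *)
Lemma scaled_moment_bounded p i :
  exists B, forall n, Ex n (fun G => (z n * Y n G 0 i) ^+ (2 * p)) <= B.
Proof.
exists ((2 * p)`!%:R * (M1 + M1) * K ^+ (2 * p) * 2 ^+ (2 * p)) => n.
have z2 : z n * sqrtn n <= 2.
  case: n => [|n]; first by rewrite /z sqrtr0 invr0 mul0r.
  have s0 : 0 < Num.sqrt n.+1%:R :> R by rewrite sqrtr_gt0 ltr0Sn.
  rewrite /z mulrC ler_pdivrMr// /sqrtn -[X in X * _](_ : Num.sqrt (2 ^+ 2) = 2).
    rewrite -sqrtrM ?sqr_ge0// ler_sqrt ?mulr_ge0 ?sqr_ge0 ?ler0n//.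
    rewrite -natrX -natrM ler_nat. by rewrite -[X in (X < _)%N]mul1n ltn_mul2r.
  by rewrite sqrtr_sqr ger0_norm.
have -> : Ex n (fun G => (z n * Y n G 0 i) ^+ (2 * p)) =
    z n ^+ (2 * p) * Ex n (fun G => `|Y n G 0 i| ^+ (2 * p)).
  rewrite -ExZ; congr (Ex n _); apply/funext => G; rewrite exprMn; congr (_ * _).
  by rewrite !exprM real_normK// num_real.
rewrite (le_trans (ler_wpM2l (exprn_ge0 _ (z_ge0 n)) (abs_moment n i _)))//.
rewrite mulrCA -exprMn ler_wpM2l//.
  by rewrite !mulr_ge0// ?addr_ge0 ?expR_ge0 ?exprn_ge0.
by rewrite lerXn2r// nnegrE// mulr_ge0// ltW.
Qed.

Lemma scaled_mean_cvg0 i : z n * Ex n (fun G => Y n G 0 i) @[n --> \oo] --> (0 : R).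
Proof.
pose B := K0 + 4 * K.
have B0 : 0 <= B by rewrite addr_ge0// mulr_ge0.
apply: (@cvg0_le_sqrt4 _ _ B); near=> n.
have n0' : (0 < n)%N by near: n; exact: nbhs_infty_gt.
set w := Num.sqrt (Num.sqrt n%:R).
have w1 : 1 <= w.
  by rewrite /w -[X in X <= _]sqrtr1 ler_sqrt ?sqrtr_ge0// -[X in X <= _]sqrtr1 ler_sqrt ?ler0n// ler1n.
have w0 : 0 < w by exact: lt_le_trans w1.
have zw : z n = w^-1 ^+ 2 by rewrite /z exprVn sqr_sqrtr ?sqrtr_ge0.
have de : entries_le 1 (delta_mx 0 i : 'rV[R]_r).
  by move=> j; rewrite !mxE eqxx/=; case: (_ == _); rewrite ?normr0 ?normr1.
have := mean_le n ler01 de; rewrite mul1r.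
have -> : Ex n (fun G => dot (delta_mx 0 i) (Y n G)) = Ex n (fun G => Y n G 0 i).
  congr (Ex n _); apply/funext => G; rewrite /dot (bigD1 i)//= big1 ?addr0 => [|j ij].
    by rewrite !mxE !eqxx mul1r.
  by rewrite !mxE (negbTE ij) andbF mul0r.
move=> H; rewrite normrM (ger0_norm (z_ge0 n)) (le_trans (ler_wpM2l (z_ge0 n) H))//.
rewrite zw expr2 -mulrA mulrC ler_wpM2r ?invr_ge0 ?(ltW w0)//.
rewrite ler_pdivrMl// mulrDr lerD//; first by rewrite ler_peMl.
rewrite (_ : w * (4 * K) = K * (4 * w)); last by ring.
by rewrite ler_wpM2l// harmonic_sum_le.
Unshelve. all: by end_near. Qed.

(** The previous estimate for the form a / sqrt n, of size kap = O(1 / sqrt n): its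
    error is of the order of the inverse fourth root of n. *)
Lemma scaled_char_cvg a b :
  Ex n (fun G => cos (dot a (z n *: Y n G) + b)) @[n --> \oo] -->
  cos b * expR (- (sigma a / 2)).
Proof.
pose A := \sum_i `|a 0 i|; have A0 : 0 <= A by apply: sumr_ge0.
have aA i : `|a 0 i| <= A by rewrite /A (bigD1 i)//= lerDl sumr_ge0.
pose B := K6 (A ^+ 2) * (5 * A + A ^+ 3).
suff H : Ex n (fun G => cos (dot a (z n *: Y n G) + b)) * expR (sigma a / 2)
    @[n --> \oo] --> cos b.
  rewrite (_ : (fun n => _) = (fun n =>
    Ex n (fun G => cos (dot a (z n *: Y n G) + b)) * expR (sigma a / 2) *
    expR (- (sigma a / 2)))); first exact: (cvgM H (cvg_cst _)).
  apply/funext => n.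
  by rewrite -mulrA -expRD subrr expR0 mulr1.
apply/subr_cvg0; apply: (@cvg0_le_sqrt4 _ _ B); near=> n.
have n0' : (0 < n)%N by near: n; exact: nbhs_infty_gt.
set w := Num.sqrt (Num.sqrt n%:R).
have w1 : 1 <= w.
  by rewrite /w -[X in X <= _]sqrtr1 ler_sqrt ?sqrtr_ge0// -[X in X <= _]sqrtr1 ler_sqrt ?ler0n// ler1n.
have w0 : 0 < w by exact: lt_le_trans w1.
have w4 : n%:R = w ^+ 4 by rewrite (exprM w 2 2) !sqr_sqrtr// sqrtr_ge0.
have zw : z n = w^-1 ^+ 2 by rewrite /z exprVn sqr_sqrtr ?sqrtr_ge0.
have nz : n%:R * z n ^+ 2 = 1.
  by rewrite zw w4 -exprM -exprMn mulfV ?expr1n// gt_eqF.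
have wV : 0 <= w^-1 by rewrite invr_ge0 ltW.
have wV1 : w^-1 <= 1 by rewrite invf_le1.
have kK : z n * A * K <= 1.
  rewrite zw -mulrA (@le_trans _ _ (w^-1 * (A * K)))//.
    by rewrite ler_wpM2r ?mulr_ge0// expr2 ler_piMl.
  by rewrite mulrC ler_pdivrMr// mul1r /w; near: n; exact: near_sqrt4.
have k0 : 0 <= z n * A by rewrite mulr_ge0.
have kL : n%:R * (z n * A) ^+ 2 <= A ^+ 2 by rewrite exprMn mulrA nz mul1r.
have ak : entries_le (z n * A) (z n *: a).
  by move=> i; rewrite mxE normrM (ger0_norm (z_ge0 n)) ler_wpM2l.
have := char_le b k0 kK kL ak.
rewrite sigmaZ mulrA nz mul1r /ncos.
have -> : Ex n (fun G => cos (dot (z n *: a) (Y n G) + b)) =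
    Ex n (fun G => cos (dot a (z n *: Y n G) + b)).
  congr (Ex n _); apply/funext => G; congr (cos (_ + b)).
  by rewrite /dot; apply: eq_bigr => i _; rewrite !mxE mulrCA -mulrA.
move=> /le_trans; apply.
rewrite /B -[leRHS]mulrA ler_wpM2l//.
  have K5_ge0 : 0 <= K5.
    by rewrite /K5 !addr_ge0// !mulr_ge0// ?exprn_ge0// addr_ge0// mulr_ge0.
  apply: addr_ge0; first by apply: addr_ge0 => //; rewrite mulr_ge0 ?expR_ge0.
  rewrite mulr_ge0 ?expR_ge0//; apply: addr_ge0 => //; apply: addr_ge0 => //.
  exact: mulr_ge0.
have -> : n%:R * (z n * A) ^+ 3 = A ^+ 3 * z n.
  by rewrite -[RHS]mulr1 -[X in _ = _ * X]nz; ring.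
have zw1 : z n <= w^-1 by rewrite zw expr2 ler_piMl.
have h1 : z n * A * @harmonic_sum R n <= 4 * A * w^-1.
  rewrite (le_trans (ler_wpM2l k0 (harmonic_sum_le _)))// -/w zw.
  have -> : w^-1 ^+ 2 * A * (4 * w) = 4 * A * (w^-1 * (w^-1 * w)) by ring.
  by rewrite mulVf ?gt_eqF// mulr1.
have h2 : z n * A <= A * w^-1 by rewrite mulrC ler_wpM2l.
have h3 : A ^+ 3 * z n <= A ^+ 3 * w^-1 by rewrite ler_wpM2l// exprn_ge0.
rewrite (le_trans (lerD (lerD h2 h1) h3))// le_eqVlt; apply/orP; left; apply/eqP.
by ring.
Unshelve. all: by end_near. Qed.

(** The limit variance is nonnegative since the modulus of a characteristic
    function is at most 1. *)
Lemma sigma_ge0 a : 0 <= sigma a.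
Proof.
have H := @scaled_char_cvg a 0; rewrite cos0 mul1r in H.
have : expR (- (sigma a / 2)) <= 1.
  rewrite -(cvg_lim _ H)//; apply: limr_le; first by apply/cvg_ex; eexists; exact: H.
  near=> n; rewrite -(Ex_cst n 1); apply: Ex_le => G _; exact: cos_le1.
rewrite -[X in _ <= X]expR0 ler_expR; lra.
Unshelve. all: by end_near. Qed.

(** All that the limit law requires: bounded moments, a vanishing mean, the
    characteristic functions, and the positivity of the limit variance. *)
Theorem process_limits :
  [/\ forall p i, exists B, forall n, Ex n (fun G => (z n * Y n G 0 i) ^+ (2 * p)) <= B,
      forall i, z n * Ex n (fun G => Y n G 0 i) @[n --> \oo] --> (0 : R),
      forall a b, Ex n (fun G => cos (dot a (z n *: Y n G) + b)) @[n --> \oo] -->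
        cos b * expR (- (sigma a / 2)) &
      forall a, 0 <= sigma a].
Proof.
split; [exact: scaled_moment_bounded|exact: scaled_mean_cvg0|
  exact: scaled_char_cvg|exact: sigma_ge0].
Qed.

End AbstractClt.

(** * Networks of positive probability *)

Section MeanGain.
Context {R : realType} (m : nat) (C : 'I_m -> block) (p : 'I_m -> R) (chi rho : R).

Definition hook_deg (i : 'I_m) : nat := deg (C i) (hook (C i)).

Lemma hook_deg_gt0 i : (0 < hook_deg i)%N.
Proof. by apply: block_deg_gt0; exact: hook_vertex. Qed.

Definition new_count (i : 'I_m) (l : nat) : R := newsum (fun d => (d == l)%:R) (C i).

Lemma fcoefE l : fcoef C p l = \sum_i p i * new_count i l.
Proof. by apply: eq_bigr => i _; rewrite card_newsum. Qed.

Lemma gcoefE l : gcoef C p l = \sum_i p i * (hook_deg i == l)%:R.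
Proof.
rewrite /gcoef big_mkcond/=; apply: eq_bigr => i _; rewrite /hook_deg.
by case: eqP; rewrite ?mulr1 ?mulr0.
Qed.

Lemma new_count_le i l : 0 <= new_count i l <= (nvert (C i))%:R.
Proof.
rewrite /new_count -card_newsum ler0n ler_nat.
by rewrite (leq_trans (max_card _))// card_ord.
Qed.

Lemma sum_indic (F : nat -> R) n j : (0 < j < n)%N ->
  \sum_(1 <= l < n) F l * (j == l)%:R = F j.
Proof.
move=> jn; rewrite (bigD1_seq j) ?iota_uniq ?mem_index_iota//=.
rewrite eqxx mulr1 big1 ?addr0// => l lj.
by rewrite eq_sym (negbTE lj) mulr0.
Qed.

(** The series groups the new weight by degrees. The hook adds only [chi] times its
    degree, because [rho] is already counted at the latch. *)
Lemma lambda1_mean_gain :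
  lambda1 C p chi rho = \sum_i p i * block_gain C chi rho i.
Proof.
pose N := (\sum_i (hook_deg i + \sum_(u < nvert (C i)) deg (C i) u)).+1%N.
have N_hook i : (hook_deg i < N)%N.
  by rewrite ltnS (bigD1 i)//= -addnA leq_addr.
have N_deg i (u : 'I_(nvert (C i))) : (deg (C i) u < N)%N.
  rewrite ltnS (bigD1 i)//= addnC addnA (bigD1 u)//=.
  by rewrite addnCA addnA -addnA leq_addr.
apply: lim_near_cst => //; exists N => // n /= Nn.
under eq_bigr do rewrite fcoefE gcoefE !mulr_sumr -big_split/=.
rewrite exchange_big/=; apply: eq_bigr => i _.
rewrite /block_gain -/(degsum _ _) degsum_block.
transitivity (p i * (\sum_(1 <= l < n) weight chi rho l * new_count i l) +
    p i * \sum_(1 <= l < n) chi * l%:R * (hook_deg i == l)%:R).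
  by rewrite !mulr_sumr -big_split/=; apply: eq_bigr => l _; ring.
rewrite sum_indic ?hook_deg_gt0 ?(leq_trans (N_hook i))//.
have -> : \sum_(1 <= l < n) weight chi rho l * new_count i l =
    newsum (weight chi rho) (C i).
  rewrite /new_count /newsum; under eq_bigr do rewrite mulr_sumr.
  rewrite exchange_big/=; apply: eq_bigr => u _; apply: sum_indic.
  by rewrite block_deg_gt0//= (leq_trans (N_deg i u)).
by rewrite -mulrDr /hook_deg {2}/weight; congr (p i * _); ring.
Qed.

End MeanGain.

Section ReachableNetworks.
Context {R : realType} (chi rho : R) (m : nat) (C : 'I_m -> block) (p : 'I_m -> R).
Context d (T : measurableType d) (P : probability T R).
Variable H : hooking_networks P C p chi rho.
Hypotheses (chi_ge0 : 0 <= chi) (chi_rho_gt0 : 0 < chi + rho).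
Variable s : R.
Hypothesis s_const : forall i, block_gain C chi rho i = s.

Lemma reach_sound n G : reach H n G -> sound G.
Proof.
elim: n G => [|n IH] G; first by move=> /reach0[i ->]; exact: block_sound.
by move=> /reachS[G' [v [i [/IH sG' vG' ->]]]]; exact: attach_sound.
Qed.

(** The equal gains of the blocks make the total weight deterministic. *)
Lemma reach_weight n G : reach H n G ->
  degsum (weight chi rho) G = n.+1%:R * s + rho.
Proof.
elim: n G => [|n IH] G; first by move=> /reach0[i ->]; rewrite weight_block s_const mul1r.
move=> /reachS[G' [v [i [rG' vG' ->]]]].
rewrite weight_attach ?(reach_sound rG').1// s_const (IH _ rG') -[in RHS]natr1; ring.
Qed.

Lemma reach_size n G : reach H n G ->
  (nvert G <= n.+1 * \sum_i nvert (C i))%N.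
Proof.
elim: n G => [|n IH] G.
  by move=> /reach0[i ->]; rewrite mul1n (bigD1 i)//= leq_addr.
move=> /reachS[G' [v [i [/IH sG' vG' ->]]]] /=.
rewrite mulSn addnC leq_add//.
by rewrite (leq_trans (leq_pred _))// (bigD1 i)//= leq_addr.
Qed.

Lemma total_weight_gt0 (i : 'I_m) n : 0 < n.+1%:R * s + rho.
Proof.
have s0 : 0 < s by rewrite -(s_const i) block_gain_gt0.
have sr0 : 0 < s + rho.
  rewrite -(s_const i) -weight_block degsum_block ltr_wpDr//.
    by apply: sumr_ge0 => u _; rewrite ltW// weight_gt0// block_deg_gt0.
  by rewrite weight_gt0// hook_deg_gt0.
by rewrite -natr1 mulrDl mul1r -addrA ltr_wpDl// mulr_ge0// ltW.
Qed.

Lemma reach_mass1 (i : 'I_m) n G : reach H n G ->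
  \sum_(v < nvert G) latch_prob chi rho G v = 1.
Proof.
move=> rG; have W0 := total_weight_gt0 i n.
rewrite /latch_prob; under eq_bigr do rewrite ltn_ord.
by rewrite -mulr_suml divff// -/(degsum _ _) (reach_weight rG) gt_eqF.
Qed.

(** Otherwise the degree would be essential by [reach_essential]. *)
Lemma reach_rare (r : nat) (k : 'I_r -> nat) n G l : first_essentials H k ->
  reach H n G -> (0 < l)%N -> (exists i, (l <= k i)%N) -> (forall j, l != k j) ->
  (ndeg G l <= 1)%N.
Proof.
move=> [_ _ kf] rG l0 [i li] lk; rewrite leqNgt; apply/negP => Gl.
have [[j lj]|/(_ i)] := kf _ (reach_essential rG l0 Gl).
  by have := lk j; rewrite lj eqxx.
by rewrite ltnNge li.
Qed.

End ReachableNetworks.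

(** * One step of the degree counts *)

Section QuadraticForms.
Context {R : realType} {r : nat}.
Implicit Types (x y : 'rV[R]_r) (S : 'M[R]_r).

Definition qform x S y : R := (x *m S *m y^T) 0 0.

Lemma qformE x S y : qform x S y = \sum_j \sum_l x 0 j * S j l * y 0 l.
Proof.
rewrite /qform mxE exchange_big/=; apply: eq_bigr => l _.
by rewrite !mxE mulr_suml.
Qed.

Lemma qform_le x S y kx ky : 0 <= kx -> 0 <= ky -> entries_le kx x -> entries_le ky y ->
  `|qform x S y| <= kx * ky * \sum_j \sum_l `|S j l|.
Proof.
move=> kx0 ky0 xk yk; rewrite qformE (le_trans (ler_norm_sum _ _ _))// mulr_sumr.
apply: ler_sum => j _; rewrite (le_trans (ler_norm_sum _ _ _))// mulr_sumr.
apply: ler_sum => l _; rewrite !normrM [leRHS]mulrAC ler_pM// ?mulr_ge0//.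
by rewrite ler_wpM2r.
Qed.

Lemma qform_sym x S y : S^T = S -> qform x S y = qform y S x.
Proof.
move=> sS; rewrite !qformE exchange_big/=; apply: eq_bigr => j _.
by apply: eq_bigr => l _; rewrite -[in LHS]sS mxE; ring.
Qed.

Lemma qformDl x x' S y : qform (x + x') S y = qform x S y + qform x' S y.
Proof. by rewrite /qform !mulmxDl mxE. Qed.

Lemma qformZl c x S y : qform (c *: x) S y = c * qform x S y.
Proof. by rewrite /qform -!scalemxAl mxE. Qed.

Lemma qformZ c x S : qform (c *: x) S (c *: x) = c ^+ 2 * qform x S x.
Proof. by rewrite qformZl /qform linearZ/= -scalemxAr mxE expr2 mulrA. Qed.

Lemma dotDr a x y : dot a (x + y) = dot a x + dot a y.
Proof. by rewrite /dot -big_split/=; apply: eq_bigr => i _; rewrite mxE mulrDr. Qed.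

Lemma dot_norm_le a x (ka kx : R) : entries_le ka a -> entries_le kx x ->
  `|dot a x| <= ka * (r%:R * kx).
Proof.
move=> ak xk; rewrite (le_trans (ler_norm_sum _ _ _))//.
apply: (@le_trans _ _ (\sum_(i < r) ka * kx)).
  by apply: ler_sum => i _; rewrite normrM ler_pM.
by rewrite sumr_const card_ord -[X in X <= _]mulr_natl mulrCA.
Qed.

End QuadraticForms.

Section OneStep.
Context {R : realType} (chi rho : R) (m : nat) (C : 'I_m -> block) (p : 'I_m -> R).
Context (r : nat) (k : 'I_r -> nat) (kmax : nat) (nu : 'rV[R]_r) (s : R).
Variable good : nat -> mgraph -> Prop.
Local Notation w l := (weight chi rho (k l)).
Local Notation h := (hook_deg C).
Let W n : R := n.+1%:R * s + rho.
Variables (c D0 : R).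
Hypotheses (p_ge0 : forall i, 0 <= p i) (p_sum1 : \sum_i p i = 1).
Hypothesis k_mono : forall i j : 'I_r, (i < j)%N -> (k i < k j)%N.
Hypothesis weight_pos : forall dg, (0 < dg)%N -> 0 <= weight chi rho dg.
Hypotheses (k_le : forall i, (k i <= kmax)%N) (w_gt0 : forall i, 0 < w i).
Hypotheses (s_gt0 : 0 < s) (lambda_s : lambda1 C p chi rho = s).
Hypothesis nu_rec : nu_recursion C p chi rho k nu.
Hypothesis W_gt0 : forall n, 0 < W n.
Hypothesis W_ge : forall n, (W n)^-1 <= c / n.+1%:R.
Hypothesis good_sound : forall n G, good n G -> sound G.
Hypothesis good_weight : forall n G, good n G -> degsum (weight chi rho) G = W n.
Hypothesis good_size : forall n G, good n G -> (nvert G)%:R <= D0 * n.+1%:R.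
Hypothesis good_rare : forall n G l, good n G -> (0 < l <= kmax)%N ->
  (forall j, l != k j) -> (ndeg G l <= 1)%N.
Implicit Types (a : 'rV[R]_r) (psi : nat -> R) (n : nat) (G : mgraph).

Definition centred n G : 'rV[R]_r :=
  \row_l ((ndeg G (k l))%:R - (n%:R * s) * nu 0 l).

(** The change of [centred] when a latch of degree [dg] receives the block [i]. *)
Definition increment (dg : nat) (i : 'I_m) : 'rV[R]_r :=
  \row_j ((dg + h i == k j)%N%:R - (dg == k j)%:R + new_count C i (k j) - s * nu 0 j).

Lemma centred_attach n G v i : good n G -> (v < nvert G)%N ->
  centred n.+1 (attach G v (C i)) = centred n G + increment (deg G v) i.
Proof.
move=> /good_sound[wG _] vG; apply/rowP => j; rewrite !mxE.
by rewrite !ndegE degsum_attach// -/(new_count C i (k j)) -[in LHS]natr1 /hook_deg; ring.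
Qed.

Definition avg psi G : R := \sum_(v < nvert G) latch_prob chi rho G v * psi (deg G v).

(** The mean of [psi] over a latch degree that equals [k l] with probability
    [w l * nu 0 l] and otherwise exceeds [kmax], where [psi] will be constant. *)
Definition limit_avg psi : R :=
  psi kmax.+1 + \sum_l w l * nu 0 l * (psi (k l) - psi kmax.+1).

Definition tail_constant psi := forall dg, (kmax < dg)%N -> psi dg = psi kmax.+1.

Lemma avgE n psi G : good n G ->
  avg psi G = degsum (fun dg => weight chi rho dg * psi dg) G / W n.
Proof.
move=> gG; rewrite /avg /degsum mulr_suml; apply: eq_bigr => v _.
by rewrite /latch_prob ltn_ord -(good_weight gG) mulrAC.
Qed.

Lemma avg1 n G : good n G -> avg (fun=> 1) G = 1.
Proof.
move=> gG; rewrite (avgE _ gG); under [X in degsum X]eq_fun do rewrite mulr1.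
by rewrite (good_weight gG) divff// gt_eqF.
Qed.

(** Vertices of nonessential degree at most [kmax] contribute a bounded amount,
    since there is at most one of each such degree. *)
Lemma degsum_essential n G (F : nat -> R) : good n G ->
  (forall dg, (kmax < dg)%N -> F dg = 0) ->
  `|degsum F G - \sum_l F (k l) * (ndeg G (k l))%:R| <= \sum_(dg < kmax.+1) `|F dg|.
Proof.
move=> gG F0; have kI : injective k.
  move=> i j kij; apply/eqP; rewrite -val_eqE; case: ltngtP => // /k_mono.
    by rewrite kij ltnn.
  by rewrite kij ltnn.
pose F' dg := if [exists l, dg == k l] then 0 else F dg.
have -> : degsum F G - \sum_l F (k l) * (ndeg G (k l))%:R = degsum F' G.
  under eq_bigr do rewrite ndegE /degsum mulr_sumr.
  rewrite exchange_big/= /degsum -sumrB; apply: eq_bigr => u _; rewrite /F'.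
  case: existsP => [[l /eqP ul]|ne].
    rewrite (bigD1 l)//= ul eqxx mulr1 big1 ?addr0 ?subrr// => l' ll'.
    by rewrite (inj_eq kI) eq_sym (negbTE ll') mulr0.
  rewrite big1 ?subr0// => l _; case: eqP => [ul|]; last by rewrite mulr0.
  by case: ne; exists l; rewrite ul.
rewrite /degsum (le_trans (ler_norm_sum _ _ _))//.
have [_ pG] := good_sound gG.
apply: (@le_trans _ _ (\sum_(dg < kmax.+1) `|F' dg| * (ndeg G dg)%:R)).
  under [leRHS]eq_bigr do rewrite ndegE /degsum mulr_sumr.
  rewrite exchange_big/=; apply: ler_sum => u _.
  have [uk|ku] := ltnP (deg G u) kmax.+1.
    rewrite (bigD1 (Ordinal uk))//= eqxx mulr1 lerDl.
    by apply: sumr_ge0 => j _; rewrite mulr_ge0.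
  rewrite (_ : F' _ = 0) ?normr0; last by rewrite /F'; case: ifP => // _; exact: F0.
  by apply: sumr_ge0 => j _; rewrite mulr_ge0.
apply: ler_sum => dg _; rewrite /F'.
case: existsP => [_|ne]; first by rewrite normr0 mul0r.
rewrite -[leRHS]mulr1 ler_wpM2l//.
have [d0|d0] := posnP dg.
  rewrite (_ : ndeg G dg = 0)%N//; apply/eqP; rewrite /ndeg; apply/pred0P => u /=.
  by rewrite d0 gtn_eqF// pG.
rewrite lern1 (good_rare gG)//.
  by rewrite d0 -ltnS ltn_ord.
by move=> j; apply/eqP => dj; apply: ne; exists j; rewrite dj.
Qed.

Let Cw : R := \sum_(dg < kmax.+1) `|weight chi rho dg| +
  `|s + rho| * \sum_l w l * `|nu 0 l|.

Let Cw_ge0 : 0 <= Cw.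
Proof.
rewrite addr_ge0 ?sumr_ge0// mulr_ge0// sumr_ge0// => l _.
by rewrite mulr_ge0// ltW.
Qed.

(** An average over the latch is a degree sum weighted by degrees, which
    [degsum_essential] reduces to the essential counts; moreover n s / W is
    1 + O(1 / n). *)
Lemma averaging n G psi M : good n G -> tail_constant psi ->
  (forall dg, `|psi dg - psi kmax.+1| <= M) ->
  `|avg psi G - (limit_avg psi +
     (\sum_l w l * centred n G 0 l * (psi (k l) - psi kmax.+1)) / W n)| <= M * Cw / W n.
Proof.
move=> gG pt pM; have W0 := W_gt0 n.
pose F dg := weight chi rho dg * (psi dg - psi kmax.+1).
have F0 dg : (kmax < dg)%N -> F dg = 0 by move=> /pt; rewrite /F => ->; rewrite subrr mulr0.
have := degsum_essential gG F0; set dF := degsum F G; set E := \sum_l _ => H.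
have -> : avg psi G = psi kmax.+1 + dF / W n.
  rewrite (avgE _ gG) -[X in _ = X + _](mulfK (lt0r_neq0 W0)) -mulrDl; congr (_ / _).
  rewrite -(good_weight gG) /dF /degsum mulr_sumr -big_split/=.
  by apply: eq_bigr => u _; rewrite /F; ring.
pose Q := \sum_l w l * nu 0 l * (psi (k l) - psi kmax.+1).
have EE : E = \sum_l w l * centred n G 0 l * (psi (k l) - psi kmax.+1) + n%:R * s * Q.
  rewrite /Q mulr_sumr -big_split/=; apply: eq_bigr => l _.
  by rewrite /F mxE; ring.
rewrite /limit_avg -/Q; move: EE; set L := \sum_l _ => EE.
have -> : psi kmax.+1 + dF / W n - (psi kmax.+1 + Q + L / W n) =
    ((dF - E) - (s + rho) * Q) / W n.
  rewrite EE; have : W n != 0 by rewrite gt_eqF.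
  have : W n = n.+1%:R * s + rho by []; rewrite -natr1.
  by move: (W n) => Wn -> Wn0; field.
rewrite normrM normfV (gtr0_norm W0) ler_wpM2r ?invr_ge0 ?(ltW W0)//.
rewrite (le_trans (ler_normB _ _))// /Cw mulrDr lerD//.
  rewrite (le_trans H)// mulr_sumr; apply: ler_sum => dg _.
  by rewrite normrM mulrC ler_wpM2r.
rewrite normrM mulrCA ler_wpM2l// (le_trans (ler_norm_sum _ _ _))// mulr_sumr.
apply: ler_sum => l _; rewrite !normrM (gtr0_norm (w_gt0 l)) mulrC.
by rewrite ler_wpM2r// mulr_ge0// ltW.
Qed.

(** The probability that a vertex of degree [k l] has degree [k j] after it was
    chosen as latch. *)
Definition hits (l j : 'I_r) : R := \sum_i p i * (k l + h i == k j)%N%:R.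

(** The mean effect on the linear form [a] of choosing a latch of degree [k l], relative
    to a latch of large degree. *)
Definition drift a l : R := \sum_j a 0 j * hits l j - a 0 l.

Let hits_ge0 l j : 0 <= hits l j.
Proof. by apply: sumr_ge0 => i _; rewrite mulr_ge0. Qed.

(** At most one [k j] equals the new degree. *)
Let hits_row l : \sum_j hits l j <= 1.
Proof.
have kI : injective k.
  move=> i j kij; apply/eqP; rewrite -val_eqE; case: ltngtP => // /k_mono.
    by rewrite kij ltnn.
  by rewrite kij ltnn.
rewrite exchange_big/= -[leRHS]p_sum1; apply: ler_sum => i _; rewrite -mulr_sumr.
rewrite -[leRHS]mulr1 ler_wpM2l//.
have [[j lj]|ne] := pselect (exists j, (k l + h i)%N = k j).
  rewrite lj (bigD1 j)//= eqxx [X in _ + X]big1 ?addr0// => j' jj'.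
  by rewrite (inj_eq kI) eq_sym (negbTE jj').
rewrite big1 ?ler01// => j _; case: eqP => // E.
by case: ne; exists j.
Qed.

Lemma hits_gcoef l j : hits l j = if (l < j)%N then gcoef C p (k j - k l) else 0.
Proof.
case: ltnP => lj.
  rewrite gcoefE; apply: eq_bigr => i _; congr (_ * _%:R).
  by rewrite -[in LHS](subnKC (ltnW (k_mono lj))) eqn_add2l.
rewrite /hits big1// => i _; rewrite gtn_eqF ?mulr0//.
have kjl : (k j <= k l)%N.
  move: lj; rewrite leq_eqVlt => /predU1P[/val_inj -> //|/k_mono/ltnW//].
by rewrite (leq_ltn_trans kjl)// -[X in (X < _)%N]addn0 ltn_add2l hook_deg_gt0.
Qed.

Let hits_le a kap l : 0 <= kap -> entries_le kap a ->
  `|\sum_j a 0 j * hits l j| <= kap.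
Proof.
move=> k0 ak; rewrite (le_trans (ler_norm_sum _ _ _))//.
apply: (@le_trans _ _ (kap * \sum_j hits l j)).
  rewrite mulr_sumr; apply: ler_sum => j _.
  by rewrite normrM (ger0_norm (hits_ge0 _ _)) ler_wpM2r.
by rewrite ler_piMr.
Qed.

Let drift_le a kap l : 0 <= kap -> entries_le kap a -> `|drift a l| <= 2 * kap.
Proof.
move=> k0 ak; rewrite (le_trans (ler_normB _ _))// mulrDl !mul1r lerD//.
exact: hits_le.
Qed.

(** The linear form [a] after the part of the mean increment that is linear in the
    centred counts has been absorbed in it. *)
Definition pulled n a : 'rV[R]_r := \row_l (a 0 l + w l / W n * drift a l).

(** An entry of the image is a convex combination of the old entry and of an average,
    with total mass at most 1, of all entries. *)
Lemma pulled_le n a kap : 0 <= kap -> (forall l, w l <= W n) ->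
  entries_le kap a -> entries_le kap (pulled n a).
Proof.
move=> k0 wW ak l; rewrite mxE /drift.
set x := \sum_j _; have xk : `|x| <= kap by exact: hits_le.
have t0 : 0 <= w l / W n by rewrite divr_ge0// ltW.
have t1 : w l / W n <= 1 by rewrite ler_pdivrMr// mul1r.
move: t0 t1; set t := _ / _ => t0 t1.
have -> : a 0 l + t * (x - a 0 l) = (1 - t) * a 0 l + t * x by ring.
rewrite (le_trans (ler_normD _ _))// (normrM (1 - t)) (normrM t) (ger0_norm t0) ger0_norm ?subr_ge0//.
have -> : kap = (1 - t) * kap + t * kap by ring.
by rewrite lerD// ler_wpM2l// subr_ge0.
Qed.

Definition correction n G a : R := (\sum_l w l * centred n G 0 l * drift a l) / W n.

Lemma dot_pulled n G a :
  dot (pulled n a) (centred n G) = dot a (centred n G) + correction n G a.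
Proof.
rewrite /dot /correction mulr_suml -big_split/=; apply: eq_bigr => l _.
by rewrite [pulled _ _ _ _]mxE; ring.
Qed.

Definition jump_law n G a (f : R -> R) : R :=
  \sum_(v < nvert G) latch_prob chi rho G v *
    \sum_i p i * f (dot a (increment (deg G v) i) - correction n G a).

Lemma jump_lawD n G a f g :
  jump_law n G a (fun v => f v + g v) = jump_law n G a f + jump_law n G a g.
Proof.
rewrite /jump_law -big_split/=; apply: eq_bigr => v _; rewrite -mulrDr -big_split/=.
by congr (_ * _); apply: eq_bigr => i _; rewrite mulrDr.
Qed.

Lemma jump_lawZ n G a b f : jump_law n G a (fun v => b * f v) = b * jump_law n G a f.
Proof.
rewrite /jump_law mulr_sumr; apply: eq_bigr => v _; rewrite mulrCA; congr (_ * _).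
by rewrite mulr_sumr; apply: eq_bigr => i _; rewrite mulrCA.
Qed.

Lemma jump_law1 n G a : good n G -> jump_law n G a (fun=> 1) = 1.
Proof.
move=> gG; rewrite -[RHS](avg1 gG); apply: eq_bigr => v _; congr (_ * _).
by under eq_bigr do rewrite mulr1.
Qed.

Let D1 : R := 2 + \sum_i (nvert (C i))%:R + s * \sum_j `|nu 0 j|.
Let D : R := r%:R * D1.

Let sum_nu_ge0 : 0 <= \sum_j `|nu 0 j|. Proof. exact: sumr_ge0. Qed.
Let sum_nvert_ge0 : 0 <= \sum_i (nvert (C i))%:R :> R. Proof. exact: sumr_ge0. Qed.
Let nu_le j : `|nu 0 j| <= \sum_j `|nu 0 j|.
Proof. by rewrite (bigD1 j)//= lerDl sumr_ge0. Qed.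

Let D1_ge0 : 0 <= D1.
Proof. by rewrite !addr_ge0// mulr_ge0// ltW. Qed.

Let D_ge0 : 0 <= D. Proof. exact: mulr_ge0. Qed.

Let increment_le dg i : entries_le D1 (increment dg i).
Proof.
move=> j; rewrite mxE.
have /andP[n0 n1] := @new_count_le R _ C i (k j).
have nS : (nvert (C i))%:R <= \sum_i (nvert (C i))%:R :> R.
  by rewrite (bigD1 i)//= lerDl sumr_ge0.
have b01 (b : bool) : 0 <= (b%:R : R) <= 1 by case: b; rewrite ?ler01 ?lexx.
have /andP[x0 x1] := b01 (dg + h i == k j)%N; have /andP[y0 y1] := b01 (dg == k j).
have : `|s * nu 0 j| <= s * \sum_j `|nu 0 j|.
  by rewrite normrM gtr0_norm// ler_wpM2l// ltW.
rewrite /D1; move: x0 x1 y0 y1 n0 n1 nS.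
move: (s * nu 0 j) (s * \sum_j _) (\sum_i _) (new_count _ _ _) => q Q S N.
move: ((dg + h i == k j)%N%:R : R) ((dg == k j)%:R : R) ((nvert (C i))%:R : R) => x y z.
rewrite !ler_norml => x0 x1 y0 y1 n0 n1 nS /andP[q0 q1].
apply/andP; split; lra.
Qed.

Let dot_increment_le a kap dg i : entries_le kap a ->
  `|dot a (increment dg i)| <= kap * D.
Proof. by move=> ak; exact: dot_norm_le ak (@increment_le dg i). Qed.

Lemma increment_tail dg i : (kmax < dg)%N -> increment dg i = increment kmax.+1 i.
Proof.
move=> kd; apply/rowP => j; rewrite !mxE.
have kj := k_le j.
by rewrite !gtn_eqF// ?(leq_trans _ (leq_addr _ _)) ?ltnS// (leq_ltn_trans kj).
Qed.

Let Sw : R := \sum_l w l.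
Let Sw_ge0 : 0 <= Sw. Proof. by apply: sumr_ge0 => l _; rewrite ltW. Qed.
Let Y1 n G : R := \sum_l `|centred n G 0 l|.
Let Y1_ge0 n G : 0 <= Y1 n G. Proof. exact: sumr_ge0. Qed.
Let c_ge0 : 0 <= c.
Proof. by have := W_ge 0; rewrite divr1; apply: le_trans; rewrite invr_ge0 ltW. Qed.

Let linear_le n G (b : 'I_r -> R) B : 0 <= B -> (forall l, `|b l| <= B) ->
  `|(\sum_l w l * centred n G 0 l * b l) / W n| <= B * (c * Sw) * Y1 n G / n.+1%:R.
Proof.
move=> B0 bB; rewrite normrM normfV (gtr0_norm (W_gt0 n)).
have H : `|\sum_l w l * centred n G 0 l * b l| <= B * Sw * Y1 n G.
  rewrite (le_trans (ler_norm_sum _ _ _))// mulr_sumr; apply: ler_sum => l _.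
  rewrite !normrM (gtr0_norm (w_gt0 l)) mulrC mulrA ler_wpM2r//.
  rewrite ler_pM// ?(ltW (w_gt0 l))// /Sw (bigD1 l)//= lerDl sumr_ge0// => j _.
  exact: ltW.
rewrite (le_trans (ler_pM _ _ H (W_ge n)))// ?invr_ge0 ?(ltW (W_gt0 n))//.
by rewrite le_eqVlt; apply/orP; left; apply/eqP; ring.
Qed.

Let D2 : R := D0 + s * \sum_j `|nu 0 j|.

Lemma centred_le n G l : good n G -> `|centred n G 0 l| <= D2 * n.+1%:R.
Proof.
move=> gG; rewrite mxE /D2 mulrDl (le_trans (ler_normB _ _))// lerD//.
  rewrite ger0_norm// (le_trans _ (good_size gG))// ler_nat.
  by rewrite (leq_trans (max_card _))// card_ord.
rewrite !normrM (gtr0_norm s_gt0) ger0_norm// -mulrA mulrC ler_pM ?mulr_ge0 ?(ltW s_gt0)//.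
  by rewrite ler_wpM2l// ltW.
by rewrite ler_nat.
Qed.

Let Y1_le n G : good n G -> Y1 n G <= r%:R * D2 * n.+1%:R.
Proof.
move=> gG; apply: (@le_trans _ _ (\sum_(l < r) D2 * n.+1%:R)).
  by apply: ler_sum => l _; exact: centred_le.
by rewrite sumr_const card_ord -[X in X <= _]mulr_natl mulrA.
Qed.

Let Ce : R := 2 * (c * Sw).
Let Ce_ge0 : 0 <= Ce. Proof. by rewrite !mulr_ge0. Qed.

Let correction_le n G a kap : 0 <= kap -> entries_le kap a ->
  `|correction n G a| <= kap * Ce * Y1 n G / n.+1%:R.
Proof.
move=> k0 ak; have k2 : 0 <= 2 * kap by rewrite mulr_ge0.
apply: (le_trans (linear_le n G k2 (fun l => drift_le l k0 ak))).
by rewrite /Ce le_eqVlt; apply/orP; left; apply/eqP; ring.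
Qed.

Let correction_le2 n G a kap : 0 <= kap -> good n G -> entries_le kap a ->
  `|correction n G a| <= kap * (Ce * (r%:R * D2)).
Proof.
move=> k0 gG ak; rewrite (le_trans (correction_le _ _ k0 ak))//.
rewrite ler_pdivrMr ?ltr0Sn//.
have H := ler_wpM2l (mulr_ge0 k0 Ce_ge0) (Y1_le gG); rewrite (le_trans H)//.
by rewrite le_eqVlt; apply/orP; left; apply/eqP; ring.
Qed.

Let CJ : R := D + Ce * (r%:R * D2).

Lemma jump_law_le n G a kap f g : 0 <= kap -> good n G -> entries_le kap a ->
  (forall v, `|v| <= kap * CJ -> f v <= g v) ->
  jump_law n G a f <= jump_law n G a g.
Proof.
move=> k0 gG ak fg; apply: ler_sum => v _; rewrite ler_wpM2l//.
  rewrite /latch_prob ltn_ord divr_ge0//; last first.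
    by rewrite -/(degsum _ _) (good_weight gG) ltW.
  have [_ /(_ _ (ltn_ord v))] := good_sound gG; exact: weight_pos.
apply: ler_sum => i _; rewrite ler_wpM2l//; apply: fg.
rewrite (le_trans (ler_normB _ _))// /CJ mulrDr lerD//; first exact: dot_increment_le.
exact: correction_le2.
Qed.

Let psi1 a dg : R := \sum_i p i * dot a (increment dg i).
Let psi2 a dg : R := \sum_i p i * dot a (increment dg i) ^+ 2.

Let psi1_le a kap dg : entries_le kap a -> `|psi1 a dg| <= kap * D.
Proof.
move=> ak; rewrite -[leRHS]mul1r -[X in _ <= X * _]p_sum1 mulr_suml (le_trans (ler_norm_sum _ _ _))//.
apply: ler_sum => i _; rewrite normrM ger0_norm// ler_wpM2l//; exact: dot_increment_le.
Qed.

Let psi2_le a kap dg : entries_le kap a -> 0 <= psi2 a dg <= (kap * D) ^+ 2.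
Proof.
move=> ak; apply/andP; split.
  by apply: sumr_ge0 => i _; rewrite mulr_ge0// sqr_ge0.
rewrite -[leRHS]mul1r -[X in _ <= X * _]p_sum1 mulr_suml; apply: ler_sum => i _; rewrite ler_wpM2l//.
have H := dot_increment_le dg i ak; rewrite -real_normK ?num_real// lerXn2r ?nnegrE//.
exact: le_trans H.
Qed.

(** Increments for degrees above [kmax] do not see the latch, so the difference is the
    effect of the latch alone. *)
Let psi1_drift a l : psi1 a (k l) - psi1 a kmax.+1 = drift a l.
Proof.
rewrite /psi1 -sumrB /drift.
have -> : a 0 l = \sum_i p i * a 0 l by rewrite -mulr_suml p_sum1 mul1r.
under [X in _ = X - _]eq_bigr do rewrite /hits mulr_sumr.
rewrite exchange_big/= -sumrB; apply: eq_bigr => i _.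
rewrite -mulrBr -[X in _ = _ - _ * X](_ : \sum_j a 0 j * (k l == k j)%:R = a 0 l); last first.
  rewrite (bigD1 l)//= eqxx mulr1 big1 ?addr0// => j jl.
  case: eqP => [E|_]; last by rewrite mulr0.
  have : (l < j)%N || (j < l)%N by rewrite -neq_ltn eq_sym.
  by case/orP => /k_mono; rewrite E ltnn.
rewrite mulr_sumr -sumrB /dot -sumrB mulr_sumr; apply: eq_bigr => j _; rewrite !mxE.
have kj := k_le j.
rewrite ![(kmax.+1 + _ == _)%N]gtn_eqF ?[(kmax.+1 == _)%N]gtn_eqF//.
  by ring.
by rewrite (leq_trans _ (leq_addr _ _)).
Qed.

(** The recursion for [nu] says precisely that the linear statistics have no
    drift in the limit. *)
Lemma limit_avg_psi1 a : limit_avg (psi1 a) = 0.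
Proof.
rewrite /limit_avg; under eq_bigr do rewrite psi1_drift /drift mulrBr mulr_sumr.
rewrite sumrB exchange_big/=.
have -> : psi1 a kmax.+1 = \sum_j a 0 j * (fcoef C p (k j) - s * nu 0 j).
  rewrite /psi1 /dot; under eq_bigr do rewrite mulr_sumr.
  rewrite exchange_big/=; apply: eq_bigr => j _.
  have kj := k_le j.
  under eq_bigr => i _.
    rewrite mxE ![(kmax.+1 + _ == _)%N]gtn_eqF ?[(kmax.+1 == _)%N]gtn_eqF//; last first.
      by rewrite (leq_trans _ (leq_addr _ _)).
    rewrite subrr add0r mulrCA mulrBr; over.
  rewrite -mulr_sumr sumrB -mulr_suml p_sum1 mul1r fcoefE.
  by [].
rewrite -sumrB -big_split/=; apply: big1 => j _.
have sw0 : s + w j != 0 by rewrite gt_eqF// addr_gt0.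
have := nu_rec j; rewrite lambda_s => nj.
have {nj} : (s + w j) * nu 0 j = fcoef C p (k j) +
    \sum_(i < r | (i < j)%N) w i * gcoef C p (k j - k i) * nu 0 i.
  by rewrite {1}nj mulVKf.
have -> : \sum_(i < r | (i < j)%N) w i * gcoef C p (k j - k i) * nu 0 i =
    \sum_i w i * nu 0 i * hits i j.
  rewrite big_mkcond/=; apply: eq_bigr => i _; rewrite hits_gcoef.
  by case: ifP; rewrite ?mulr0// mulrAC.
have -> : \sum_i w i * nu 0 i * (a 0 j * hits i j) =
    a 0 j * \sum_i w i * nu 0 i * hits i j.
  by rewrite mulr_sumr; apply: eq_bigr => i _; ring.
move: (\sum_i _) (fcoef _ _ _) => S F E.
have -> : F = (s + w j) * nu 0 j - S by rewrite E addrK.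
by ring.
Qed.

Let psi1_tail a : tail_constant (psi1 a).
Proof. by move=> dg kd; rewrite /psi1; apply: eq_bigr => i _; rewrite increment_tail. Qed.

Let psi2_tail a : tail_constant (psi2 a).
Proof. by move=> dg kd; rewrite /psi2; apply: eq_bigr => i _; rewrite increment_tail. Qed.

Let jump_meanE n G a : good n G ->
  jump_law n G a id = avg (psi1 a) G - correction n G a.
Proof.
move=> gG; rewrite -[X in _ - X]mulr1 -[X in _ - _ * X](avg1 gG) /avg mulr_sumr -sumrB.
apply: eq_bigr => v _; rewrite mulr1 [X in _ - X]mulrC -mulrBr; congr (_ * _).
rewrite -[X in _ - X]mul1r -[X in _ - X * _]p_sum1 mulr_suml -sumrB.
by apply: eq_bigr => i _; rewrite mulrBr.
Qed.

Let Cm : R := 2 * D * Cw * c.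
Let Cm_ge0 : 0 <= Cm. Proof. by rewrite !mulr_ge0. Qed.

Lemma jump_mean_le n G a kap : 0 <= kap -> good n G -> entries_le kap a ->
  `|jump_law n G a id| <= kap * Cm / n.+1%:R.
Proof.
move=> k0 gG ak; rewrite jump_meanE//.
have H dg : `|psi1 a dg - psi1 a kmax.+1| <= 2 * (kap * D).
  by rewrite (le_trans (ler_normB _ _))// mulrDl mul1r lerD// psi1_le.
have := averaging gG (psi1_tail a) H; rewrite limit_avg_psi1 add0r.
have -> : \sum_l w l * centred n G 0 l * (psi1 a (k l) - psi1 a kmax.+1) =
    \sum_l w l * centred n G 0 l * drift a l.
  by apply: eq_bigr => l _; rewrite psi1_drift.
rewrite -/(correction n G a) => /le_trans; apply.
have kD : 0 <= 2 * (kap * D) * Cw by rewrite !mulr_ge0.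
rewrite (le_trans (ler_wpM2l kD (W_ge n)))//.
by rewrite /Cm le_eqVlt; apply/orP; left; apply/eqP; ring.
Qed.

(** The limit of the second moments of the increments. *)
Definition jump_cov : 'M[R]_r := \matrix_(j, l)
  limit_avg (fun dg => \sum_i p i * (increment dg i 0 j * increment dg i 0 l)).

Lemma jump_cov_sym : jump_cov^T = jump_cov.
Proof.
apply/matrixP => j l; rewrite !mxE; congr limit_avg; apply/funext => dg.
by apply: eq_bigr => i _; rewrite [X in _ * X]mulrC.
Qed.

Let limit_avg_sum (I : Type) (q : seq I) (f : I -> nat -> R) :
  limit_avg (fun dg => \sum_(x <- q) f x dg) = \sum_(x <- q) limit_avg (f x).
Proof.
rewrite /limit_avg big_split/= exchange_big/=; congr (_ + _).
by apply: eq_bigr => l _; rewrite -sumrB mulr_sumr.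
Qed.

Let limit_avgZ b psi : limit_avg (fun dg => b * psi dg) = b * limit_avg psi.
Proof.
rewrite /limit_avg mulrDr mulr_sumr; congr (_ + _).
by apply: eq_bigr => l _; ring.
Qed.

Let limit_avg_psi2 a : limit_avg (psi2 a) = qform a jump_cov a.
Proof.
rewrite qformE; transitivity (limit_avg (fun dg => \sum_j \sum_l (a 0 j * a 0 l) *
    \sum_i p i * (increment dg i 0 j * increment dg i 0 l))).
  congr limit_avg; apply/funext => dg; rewrite /psi2 /dot.
  under [RHS]eq_bigr do under eq_bigr do rewrite mulr_sumr.
  under [RHS]eq_bigr do rewrite exchange_big/=.
  rewrite [RHS]exchange_big/=; apply: eq_bigr => i _.
  rewrite expr2 mulr_suml mulr_sumr; apply: eq_bigr => j _.
  rewrite mulr_sumr mulr_sumr; apply: eq_bigr => l _.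
  by move: (increment dg i 0 j) (increment dg i 0 l) => x y; ring.
rewrite limit_avg_sum; apply: eq_bigr => j _; rewrite limit_avg_sum; apply: eq_bigr => l _.
by rewrite limit_avgZ [jump_cov _ _]mxE; ring.
Qed.

(** The square is expanded; the mean of the increment is the mean of the jump plus the
    correction. *)
Let jump_varE n G a : good n G -> jump_law n G a (fun v => v ^+ 2) =
  avg (psi2 a) G - 2 * correction n G a * jump_law n G a id - correction n G a ^+ 2.
Proof.
move=> gG; set eta := correction n G a.
have E1 : avg (psi1 a) G = jump_law n G a id + eta by rewrite jump_meanE// subrK.
have -> : jump_law n G a (fun v => v ^+ 2) =
    avg (psi2 a) G - 2 * eta * avg (psi1 a) G + eta ^+ 2 * avg (fun=> 1) G.
  rewrite /avg !mulr_sumr -sumrB -big_split/=; apply: eq_bigr => v _.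
  rewrite [2 * eta * _]mulrCA [eta ^+ 2 * _]mulrCA -mulrBr -mulrDr; congr (_ * _).
  rewrite mulr1 -[eta ^+ 2]mul1r -[X in _ + X * _]p_sum1 mulr_sumr mulr_suml.
  rewrite -sumrB -big_split/=; apply: eq_bigr => i _; rewrite -/eta.
  by move: (dot _ _) => x; ring.
rewrite E1 (avg1 gG); ring.
Qed.

Let Cv : R := D ^+ 2 * (c * Sw) + D ^+ 2 * (Cw * c) + 2 * (Ce * (r%:R * D2)) * Cm +
  Ce ^+ 2 * (r%:R * D2).

Let D2_ge0 : 0 <= D0 -> 0 <= D2.
Proof. by move=> d0; rewrite addr_ge0// mulr_ge0// ltW. Qed.

(** Besides the error of [averaging] there is the square of the correction, a bounded
    factor times one of order |Y| / n. *)
Lemma jump_var_le n G a kap : 0 <= D0 -> 0 <= kap -> good n G -> entries_le kap a ->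
  `|jump_law n G a (fun v => v ^+ 2) - qform a jump_cov a| <=
  kap ^+ 2 * Cv * (1 + \sum_l `|centred n G 0 l|) / n.+1%:R.
Proof.
move=> d0 k0 gG ak; have D2' := D2_ge0 d0.
have N0 : 0 <= (n.+1%:R^-1 : R) by rewrite invr_ge0.
rewrite jump_varE// -/(Y1 n G) -limit_avg_psi2.
have H dg : `|psi2 a dg - psi2 a kmax.+1| <= (kap * D) ^+ 2.
  have /andP[x0 x1] := psi2_le dg ak; have /andP[y0 y1] := psi2_le kmax.+1 ak.
  by rewrite ler_norml; apply/andP; split; lra.
have A1 := averaging gG (psi2_tail a) H.
have A2 := linear_le n G (sqr_ge0 (kap * D)) (fun l => H (k l)).
have A3 := jump_mean_le k0 gG ak.
have A4 := correction_le n G k0 ak; have A5 := correction_le2 k0 gG ak.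
move: A1 A2 A3 A4 A5; set L := (\sum_l _) / W n; set eta := correction _ _ _.
set j := jump_law _ _ _ _; set x := avg _ _; set y := limit_avg _ => A1 A2 A3 A4 A5.
have A1' : `|x - (y + L)| <= kap ^+ 2 * (D ^+ 2 * (Cw * c)) / n.+1%:R.
  have kD : 0 <= (kap * D) ^+ 2 * Cw by rewrite mulr_ge0// sqr_ge0.
  rewrite (le_trans A1)// (le_trans (ler_wpM2l kD (W_ge n)))//.
  by rewrite le_eqVlt; apply/orP; left; apply/eqP; ring.
have A6 : `|2 * eta * j| <= kap ^+ 2 * (2 * (Ce * (r%:R * D2)) * Cm) / n.+1%:R.
  rewrite normrM normrM [`|2|]ger0_norm//.
  apply: (@le_trans _ _ (2 * (kap * (Ce * (r%:R * D2))) * (kap * Cm / n.+1%:R))).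
    by rewrite ler_pM ?mulr_ge0// ler_wpM2l.
  by rewrite le_eqVlt; apply/orP; left; apply/eqP; ring.
have A7 : `|eta ^+ 2| <= kap ^+ 2 * (Ce ^+ 2 * (r%:R * D2)) * Y1 n G / n.+1%:R.
  rewrite expr2 normrM (le_trans (ler_pM _ _ A5 A4))//.
  by rewrite le_eqVlt; apply/orP; left; apply/eqP; ring.
have -> : x - 2 * eta * j - eta ^+ 2 - y = (x - (y + L)) + L - 2 * eta * j - eta ^+ 2.
  by ring.
rewrite (le_trans (ler_normB _ _))//.
rewrite (le_trans (lerD (le_trans (ler_normB _ _) (lerD (le_trans (ler_normD _ _)
  (lerD A1' A2)) A6)) A7))//.
have kk : 0 <= kap ^+ 2 by exact: sqr_ge0.
rewrite -subr_ge0 [X in 0 <= X](_ : _ = kap ^+ 2 * n.+1%:R^-1 *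
  (D ^+ 2 * (c * Sw) + Ce ^+ 2 * (r%:R * D2) +
   (D ^+ 2 * (Cw * c) + 2 * (Ce * (r%:R * D2)) * Cm) * Y1 n G)).
  apply: mulr_ge0; first exact: mulr_ge0.
  have rD : 0 <= r%:R * D2 by exact: mulr_ge0.
  have p1 : 0 <= D ^+ 2 * (c * Sw) by rewrite mulr_ge0 ?sqr_ge0// mulr_ge0.
  have p2 : 0 <= Ce ^+ 2 * (r%:R * D2) by rewrite mulr_ge0 ?sqr_ge0.
  have p3 : 0 <= D ^+ 2 * (Cw * c) by rewrite mulr_ge0 ?sqr_ge0// mulr_ge0.
  have p4 : 0 <= 2 * (Ce * (r%:R * D2)) * Cm.
    by apply: mulr_ge0 => //; apply: mulr_ge0 => //; exact: mulr_ge0.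
  by apply: addr_ge0; [exact: addr_ge0|apply: mulr_ge0 => //; exact: addr_ge0].
by rewrite /Cv; ring.
Qed.

(** With A the matrix of [drift] scaled by the weights, one step maps [a] to
    a + a A / W with W = n s + O(1). Stationarity of the variance n S in first order
    is the equation s B = M S + S M^T with M = s / 2 - A and B the covariance of a
    jump. Degrees only increase, so A is triangular with negative diagonal and the
    equation is solvable; the remaining terms have order 1 / n. *)
Lemma limit_covariance : exists S : 'M[R]_r, S^T = S /\
  exists B, forall n a kap, 0 <= kap -> entries_le kap a ->
  `|n%:R * qform (pulled n a) S (pulled n a) + qform a jump_cov a -
    n.+1%:R * qform a S a| <= kap ^+ 2 * B / n.+1%:R.
Proof.
pose A : 'M[R]_r := \matrix_(j, l) (w l * (hits l j - (j == l)%:R)).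
have aA a : a *m A = \row_l (w l * drift a l).
  apply/rowP => l; rewrite !mxE /drift mulrBr mulr_sumr.
  transitivity (\sum_j (w l * (a 0 j * hits l j) - w l * (a 0 j * (j == l)%:R))).
    by apply: eq_bigr => j _; rewrite !mxE; ring.
  rewrite sumrB; congr (_ - _); rewrite (bigD1 l)//= eqxx mulr1 big1 ?addr0// => j jl.
  by rewrite (negbTE jl) mulr0 mulr0.
have pE n a : pulled n a = a + (W n)^-1 *: (a *m A).
  by apply/rowP => l; rewrite aA !mxE; ring.
pose M : 'M[R]_r := (s / 2)%:M - A.
have [||| S [sS MS]] := @lyapunov_exists R r M (s *: jump_cov).
- move=> i j ij; rewrite !mxE hits_gcoef -!val_eqE/= ltn_eqF// ltnNge (ltnW ij)/=.
  by rewrite mulr0n !subrr mulr0 subr0.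
- move=> i; rewrite !mxE eqxx hits_gcoef ltnn mulr1n sub0r mulrN1 opprK.
  by rewrite addr_gt0// divr_gt0.
- by rewrite linearZ/= jump_cov_sym.
exists S; split=> //.
pose N := \sum_j \sum_l `|S j l|; have N0 : 0 <= N by apply: sumr_ge0 => j _; exact: sumr_ge0.
pose BA := 2 * Sw; have BA0 : 0 <= BA by rewrite mulr_ge0.
have aA_le a kap : 0 <= kap -> entries_le kap a -> entries_le (kap * BA) (a *m A).
  move=> k0 ak l; rewrite aA mxE normrM (gtr0_norm (w_gt0 l)) mulrC.
  have -> : kap * BA = 2 * kap * Sw by rewrite /BA; ring.
  rewrite ler_pM// ?(ltW (w_gt0 l))// ?drift_le//.
  by rewrite /Sw (bigD1 l)//= lerDl sumr_ge0// => j _; exact: ltW.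
exists (2 * (`|s + rho| / s * c) * (BA * N) + c ^+ 2 * (BA ^+ 2 * N)) => n a kap k0 ak.
have W0 := W_gt0 n; have Wn := W_ge n.
set x := qform a S a; pose y := qform (a *m A) S a; pose z := qform (a *m A) S (a *m A).
have lyap : s * qform a jump_cov a = s * x - 2 * y.
  have : (a *m (M *m S + S *m M^T) *m a^T) 0 0 = s * qform a jump_cov a.
    by rewrite MS -scalemxAr -scalemxAl mxE.
  move=> <-; rewrite mulmxDr mulmxDl mxE.
  have E1 : (a *m (M *m S) *m a^T) 0 0 = s / 2 * x - y.
    rewrite /M mulmxBl mulmxBr mulmxBl mul_scalar_mx -scalemxAr -scalemxAl.
    by rewrite mxE [X in X + _]mxE [X in _ + X]mxE /x /y /qform mulmxA.
  have E2 : (a *m (S *m M^T) *m a^T) 0 0 = s / 2 * x - y.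
    rewrite -E1 -[LHS]/((_ : 'M[R]_1) 0 0) -[RHS](_ : (((a *m (M *m S) *m a^T)^T) 0 0) = _).
      by rewrite !trmx_mul sS trmxK !mulmxA.
    by rewrite mxE.
  by rewrite E1 E2; field.
have sx : qform (pulled n a) S (pulled n a) = x + 2 * (W n)^-1 * y + (W n)^-1 ^+ 2 * z.
  rewrite pE qformDl [qform a _ _]qform_sym// qformDl -/x !qformZl.
  rewrite [qform (a *m A) S (a + _)]qform_sym// qformDl qformZl.
  by rewrite [qform a S (a *m A)]qform_sym// -/y -/z; ring.
have bE : qform a jump_cov a = x - 2 * y / s.
  apply: (mulfI (lt0r_neq0 s_gt0)); rewrite lyap; field; exact: lt0r_neq0.
have -> : n%:R * qform (pulled n a) S (pulled n a) + qform a jump_cov a -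
    n.+1%:R * x = - (2 * ((s + rho) / s / W n) * y) + n%:R * (W n)^-1 ^+ 2 * z.
  rewrite sx bE -natr1.
  have : W n = n.+1%:R * s + rho by []; rewrite -natr1.
  move: (lt0r_neq0 W0) (lt0r_neq0 s_gt0); move: (W n) => Wx Wx0 sx0 WE.
  have -> : rho = Wx - (n%:R + 1) * s by rewrite WE; ring.
  by field; rewrite Wx0.
have y_le : `|y| <= kap ^+ 2 * (BA * N).
  rewrite (le_trans (qform_le S (mulr_ge0 k0 BA0) k0 (aA_le _ _ k0 ak) ak))//.
  by rewrite -/N le_eqVlt; apply/orP; left; apply/eqP; ring.
have z_le : `|z| <= kap ^+ 2 * (BA ^+ 2 * N).
  have kB := mulr_ge0 k0 BA0; have e := aA_le _ _ k0 ak.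
  rewrite (le_trans (qform_le S kB kB e e))//.
  by rewrite -/N le_eqVlt; apply/orP; left; apply/eqP; ring.
have Wi0 : 0 <= (W n)^-1 by rewrite invr_ge0 ltW.
rewrite (le_trans (ler_normD _ _))//.
have T1 : `|- (2 * ((s + rho) / s / W n) * y)| <=
    kap ^+ 2 * (2 * (`|s + rho| / s * c) * (BA * N)) / n.+1%:R.
  rewrite normrN !normrM [`|2|]ger0_norm// !normfV (gtr0_norm W0) (gtr0_norm s_gt0).
  apply: (@le_trans _ _ (2 * (`|s + rho| / s * (c / n.+1%:R)) * (kap ^+ 2 * (BA * N)))).
    have q0 : 0 <= `|s + rho| / s by rewrite divr_ge0// ltW.
    apply: ler_pM => //; first by rewrite mulr_ge0// mulr_ge0.
    by do 2!apply: ler_wpM2l => //.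
  by rewrite le_eqVlt; apply/orP; left; apply/eqP; ring.
have T2 : `|n%:R * (W n)^-1 ^+ 2 * z| <= kap ^+ 2 * (c ^+ 2 * (BA ^+ 2 * N)) / n.+1%:R.
  rewrite normrM ger0_norm ?mulr_ge0 ?sqr_ge0//.
  have N1 : 0 < n.+1%:R :> R by rewrite ltr0Sn.
  have H : n%:R * (W n)^-1 ^+ 2 <= c ^+ 2 / n.+1%:R.
    apply: (@le_trans _ _ (n.+1%:R * (c / n.+1%:R) ^+ 2)).
      by rewrite ler_pM ?sqr_ge0 ?ler_nat// lerXn2r// nnegrE// divr_ge0// ltW.
    by rewrite le_eqVlt; apply/orP; left; apply/eqP; field; rewrite gt_eqF.
  rewrite (le_trans (ler_pM _ _ H z_le))// ?mulr_ge0 ?sqr_ge0//.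
  by rewrite le_eqVlt; apply/orP; left; apply/eqP; ring.
rewrite (le_trans (lerD T1 T2))//.
by rewrite le_eqVlt; apply/orP; left; apply/eqP; ring.
Qed.

Lemma jump_cov_le a kap : 0 <= kap -> entries_le kap a ->
  `|qform a jump_cov a| <= kap ^+ 2 * \sum_j \sum_l `|jump_cov j l|.
Proof. by move=> k0 ak; rewrite expr2; exact: qform_le. Qed.

Variable Ex : nat -> (mgraph -> R) -> R.
Hypothesis Ex1 : forall n, Ex n (fun=> 1) = 1.
Hypothesis ExD : forall n f g, Ex n (fun G => f G + g G) = Ex n f + Ex n g.
Hypothesis ExZ : forall n b f, Ex n (fun G => b * f G) = b * Ex n f.
Hypothesis Ex_le : forall n f g,
  (forall G, good n G -> f G <= g G) -> Ex n f <= Ex n g.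
Hypothesis ExS : forall n f, Ex n.+1 f = Ex n (fun G =>
  \sum_(v < nvert G) latch_prob chi rho G v * \sum_i p i * f (attach G v (C i))).

Let step n a (f : R -> R) :
  Ex n.+1 (fun G => f (dot a (centred n.+1 G))) =
  Ex n (fun G => jump_law n G a (fun v => f (dot (pulled n a) (centred n G) + v))).
Proof.
have E G : good n G ->
    \sum_(v < nvert G) latch_prob chi rho G v *
      \sum_i p i * f (dot a (centred n.+1 (attach G v (C i)))) =
    jump_law n G a (fun v => f (dot (pulled n a) (centred n G) + v)).
  move=> gG; apply: eq_bigr => v _; congr (_ * _); apply: eq_bigr => i _.
  rewrite centred_attach// dotDr dot_pulled; congr (_ * f _).
  by move: (dot _ _) (dot _ _) (correction _ _ _) => x y z; ring.
by rewrite ExS; apply/eqP; rewrite eq_le; apply/andP; split; apply: Ex_le => G /E ->.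
Qed.

(** One constant [K] serves all estimates of one step. *)
Theorem centred_limits : (0 < r)%N -> 0 <= D0 -> exists S : 'M[R]_r, S^T = S /\
  [/\ forall q i, exists B, forall n,
        Ex n (fun G => ((Num.sqrt n%:R)^-1 * centred n G 0 i) ^+ (2 * q)) <= B,
      forall i, (Num.sqrt n%:R)^-1 * Ex n (fun G => centred n G 0 i)
        @[n --> \oo] --> (0 : R),
      forall a b, Ex n (fun G => cos (dot a ((Num.sqrt n%:R)^-1 *: centred n G) + b))
        @[n --> \oo] --> cos b * expR (- (qform a S a / 2)) &
      forall a, 0 <= qform a S a].
Proof.
move=> r0 d0; have [S [sS [B lyap]]] := limit_covariance.
exists S; split=> //.
have D2' := D2_ge0 d0.
have rD : 0 <= r%:R * D2 by exact: mulr_ge0.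
pose N (Q : 'M[R]_r) := \sum_j \sum_l `|Q j l|.
have N0 Q : 0 <= N Q by apply: sumr_ge0 => j _; exact: sumr_ge0.
pose K := 1 + CJ + Cm + Cv + D2 + N jump_cov + N S + `|B|.
have CJ0 : 0 <= CJ by apply: addr_ge0 => //; exact: mulr_ge0.
have Cv0 : 0 <= Cv.
  have p1 : 0 <= D ^+ 2 * (c * Sw) by rewrite mulr_ge0 ?sqr_ge0// mulr_ge0.
  have p2 : 0 <= Ce ^+ 2 * (r%:R * D2) by rewrite mulr_ge0 ?sqr_ge0.
  have p3 : 0 <= D ^+ 2 * (Cw * c) by rewrite mulr_ge0 ?sqr_ge0// mulr_ge0.
  have p4 : 0 <= 2 * (Ce * (r%:R * D2)) * Cm.
    by apply: mulr_ge0 => //; apply: mulr_ge0 => //; exact: mulr_ge0.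
  by rewrite /Cv !addr_ge0.
have [K1 KJ Km Kv [KY Kj KS KB]] : [/\ 1 <= K, CJ <= K, Cm <= K, Cv <= K &
    [/\ D2 <= K, N jump_cov <= K, N S <= K & B <= K]].
  have := N0 jump_cov; have := N0 S; have := normr_ge0 B; have := ler_norm B.
  move: CJ0 Cm_ge0 Cv0 D2'; rewrite /K.
  move: CJ Cm Cv D2 (N jump_cov) (N S) `|B| => x1 x2 x3 x4 x5 x6 x7.
  by split; [lra|lra|lra|lra|split; lra].
have [n0 n0W] : exists n0, forall n, (n0 <= n)%N -> forall l, w l <= W n.
  exists (Num.Def.archi_bound `|(Sw - rho) / s|) => n nn l.
  have wS : w l <= Sw by rewrite /Sw (bigD1 l)//= lerDl sumr_ge0// => j _; exact: ltW.
  rewrite (le_trans wS)// /W -lerBlDr -ler_pdivrMr//.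
  rewrite (le_trans (ler_norm _))// ltW// (lt_le_trans (archi_boundP _))//.
  by rewrite ler_nat (leq_trans nn).
have kap0 a kap := @entries_le_ge0 R r kap a r0.
have up (x y z : R) (n : nat) : 0 <= x -> y <= K -> x * y / n.+1%:R <= x * K / n.+1%:R.
  by move=> x0 yK; rewrite ler_wpM2r ?invr_ge0// ler_wpM2l.
apply: (@process_limits R r mgraph Ex good centred pulled jump_law
  (fun a => qform a jump_cov a) (fun a => qform a S a) K n0) => //.
- by move=> n G a gG; exact: jump_law1.
- exact: jump_lawD.
- exact: jump_lawZ.
- move=> n G a kap f g gG ak fg; apply: (jump_law_le (kap0 _ _ ak) gG ak) => v vk.
  by apply: fg; rewrite (le_trans vk)// ler_wpM2l// (kap0 _ _ ak).
- move=> n G a kap gG ak; rewrite (le_trans (jump_mean_le (kap0 _ _ ak) gG ak))//.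
  by rewrite up// (kap0 _ _ ak).
- move=> n G a kap gG ak; rewrite (le_trans (jump_var_le d0 (kap0 _ _ ak) gG ak))//.
  rewrite ler_wpM2r ?invr_ge0// ler_wpM2r ?addr_ge0 ?sumr_ge0//.
  by rewrite ler_wpM2l ?sqr_ge0.
- by move=> n a kap nn ak; apply: pulled_le => //; [exact: kap0 ak|exact: n0W].
- by move=> n G l gG; rewrite (le_trans (centred_le l gG))// ler_wpM2r.
- move=> a kap ak; rewrite (le_trans (jump_cov_le (kap0 _ _ ak) ak))//.
  by rewrite ler_wpM2l ?sqr_ge0.
- move=> a kap ak; have k0 := kap0 _ _ ak.
  by rewrite (le_trans (qform_le S k0 k0 ak ak))// -expr2 ler_wpM2l ?sqr_ge0.
- by move=> a b; exact: qformZ.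
- move=> n a kap _ ak; rewrite (le_trans (lyap n a kap (kap0 _ _ ak) ak))//.
  by rewrite up// sqr_ge0.
Qed.

End OneStep.

(** * The limit theorem *)

Section Assembly.
Context {R : realType} {r : nat}.

Lemma cvg_rV0 (u : nat -> 'rV[R]_r) :
  (forall i, u n 0 i @[n --> \oo] --> (0 : R)) -> u n @[n --> \oo] --> (0 : 'rV[R]_r).
Proof.
move=> u0; apply/cvgr0Pnorm_le => e e0.
have : \forall n \near \oo, forall i, `|u n 0 i| <= e.
  apply: filter_forall => i; move: (u0 i) => /cvgr0Pnorm_le; exact.
apply: filterS => n un.
rewrite /Num.Def.normr/= mx_normrE; apply: bigmax_le; first exact: ltW.
by move=> [i j] _ /=; rewrite ord1.
Qed.

Lemma bounded_of_cvg (u : nat -> R) : u n @[n --> \oo] --> (0 : R) ->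
  exists B, forall n, `|u n| <= B.
Proof.
move=> u0; have /cvg_seq_bounded[M [_ Mu]] : cvgn u by apply/cvg_ex; exists 0.
by exists (M + 1) => n; apply: Mu => //; rewrite ltrDl.
Qed.

(** Twice the larger of the two absolute values bounds the difference. *)
Lemma even_power_le (x y : R) q : (x - y) ^+ (2 * q) <=
  2 ^+ (2 * q) * (x ^+ (2 * q) + y ^+ (2 * q)).
Proof.
have ev (t : R) : t ^+ (2 * q) = `|t| ^+ (2 * q).
  by rewrite !exprM real_normK// num_real.
wlog xy : x y / `|x| <= `|y|.
  move=> H; have [|/ltW yx] := leP `|x| `|y|; first exact: H.
  have -> : (x - y) ^+ (2 * q) = (y - x) ^+ (2 * q) by rewrite ev distrC -ev.
  by rewrite [X in _ * X]addrC; exact: H.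
apply: (@le_trans _ _ ((2 * `|y|) ^+ (2 * q))).
  rewrite ev lerXn2r ?nnegrE ?mulr_ge0//.
  by rewrite (le_trans (ler_normB _ _))// mulrDl mul1r lerD2r.
rewrite exprMn -ev ler_wpM2l ?exprn_ge0// lerDr ev; exact: exprn_ge0.
Qed.

(** A deterministic shift tending to 0 affects neither the characteristic
    functions nor the boundedness of moments. *)
Lemma cvg_normal_moments_shift d (T : measurableType d) (P : probability T R)
    (X : nat -> T -> 'rV[R]_r) (E : nat -> ('rV[R]_r -> R) -> R) (S : 'M[R]_r)
    (u : nat -> 'rV[R]_r) :
  (forall n, mean_functional (E n)) ->
  (forall n F, 'E_P[fun t => F (X n t)] = (E n F)%:E)%E ->
  (forall a b, E n (fun x => cos (dot a x + b)) @[n --> \oo] -->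
               cos b * expR (- ((a *m S *m a^T) 0 0 / 2))) ->
  (forall (p : nat) i, exists K, forall n, E n (fun x => x 0 i ^+ (2 * p)) <= K) ->
  (forall i, u n 0 i @[n --> \oo] --> (0 : R)) ->
  covariance_matrix S -> cvg_normal_moments P (fun n t => X n t - u n) S.
Proof.
move=> mE linkE chE momE u0 covS.
apply: (@cvg_normal_moments_of_char _ _ _ _ P _
  (fun n F => E n (fun x => F (x - u n)))) => //.
- move=> n; have [E1 ED EZ Ele] := mE n.
  by split=> [//|F G|c F|F G FG]; [exact: ED|exact: EZ|apply: Ele => x; exact: FG].
- by move=> n F; exact: (linkE n (fun x => F (x - u n))).
- move=> a b; have dotu : dot a (u n) @[n --> \oo] --> (0 : R).
    rewrite /dot; elim: (index_enum _) => [|i q IH].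
      by under eq_fun do rewrite big_nil; exact: cvg_cst.
    under eq_fun do rewrite big_cons.
    have Hq := cvgD (cvgM (cvg_cst (a 0 i)) (u0 i)) IH; rewrite mulr0 addr0 in Hq.
    exact: Hq.
  have D : E n (fun x => cos (dot a (x - u n) + b)) - E n (fun x => cos (dot a x + b))
      @[n --> \oo] --> (0 : R).
    apply/norm_cvg0P; apply: (@squeeze_cvgr _ _ _ _ (fun=> 0) (fun n => `|dot a (u n)|)).
    - near=> n; rewrite normr_ge0/= -(mean_cst `|dot a (u n)| (mE n)).
      apply: (mean_dist (mE n)) => x; rewrite dotDr.
      have -> : dot a (- u n) = - dot a (u n).
        by rewrite /dot -sumrN; apply: eq_bigr => i _; rewrite mxE mulrN.
      have -> : dot a x - dot a (u n) + b = - dot a (u n) + (dot a x + b) by ring.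
      by rewrite (le_trans (norm_cosD_le _ _))// normrN.
    - exact: cvg_cst.
    - by apply/norm_cvg0P.
  have Hq := cvgD D (chE a b); rewrite add0r in Hq.
  rewrite (_ : (fun n => _) = (fun n =>
    E n (fun x => cos (dot a (x - u n) + b)) - E n (fun x => cos (dot a x + b)) +
    E n (fun x => cos (dot a x + b)))); first exact: Hq.
  by apply/funext => n; rewrite subrK.
- move=> p i; have [K EK] := momE p i; have [B uB] := bounded_of_cvg (u0 i).
  exists (2 ^+ (2 * p) * (K + B ^+ (2 * p))) => n.
  have [E1 ED EZ Ele] := mE n.
  apply: (@le_trans _ _ (E n (fun x =>
      2 ^+ (2 * p) * (x 0 i ^+ (2 * p) + B ^+ (2 * p))))).
    apply: Ele => x; rewrite !mxE (le_trans (even_power_le _ _ _))//.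
    rewrite ler_wpM2l ?exprn_ge0// lerD2l -[leLHS]ger0_norm; last first.
      by rewrite exprM exprn_ge0// sqr_ge0.
    rewrite normrX lerXn2r ?nnegrE// (le_trans _ (uB n))//.
  rewrite EZ ED mean_cst// ler_wpM2l ?exprn_ge0// lerD2r; exact: EK.
Unshelve. all: by end_near. Qed.

End Assembly.

Theorem corollary1p5 (R : realType) (chi rho : R)
    (chi_ge0 : 0 <= chi) (chi_rho_gt0 : 0 < chi + rho)
    (m : nat) (C : 'I_m -> block) (p : 'I_m -> R)
    (p_gt0 : forall i, 0 < p i) (p_sum1 : \sum_(i < m) p i = 1)
    (d : measure_display) (T : measurableType d) (P : probability T R)
    (H : hooking_networks P C p chi rho)
    (r : nat) (r_gt0 : (0 < r)%N) (k : 'I_r -> nat)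
    (k_first : first_essentials H k)
    (nu : 'rV[R]_r) (nu_rec : nu_recursion C p chi rho k nu)
    (s : R) (s_const : forall i, block_gain C chi rho i = s) :
  let X := degree_vector H k in
  let lambda := lambda1 C p chi rho in
  exists Sigma : 'M[R]_r,
    [/\ covariance_matrix Sigma,
        cvg_normal_moments P
          (fun n t => (Num.sqrt n%:R)^-1 *: (X n t - (n%:R * lambda) *: nu))
          Sigma,
        (Num.sqrt n%:R)^-1 *: (mean_vector P (X n) - (n%:R * lambda) *: nu)
          @[n --> \oo] --> (0 : 'rV[R]_r) &
        cvg_normal_moments P
          (fun n t => (Num.sqrt n%:R)^-1 *: (X n t - mean_vector P (X n)))
          Sigma].
Proof.
move=> X lambda.
have [i0 _] : exists i0 : 'I_m, true.
  case: m C p p_gt0 p_sum1 H k_first nu_rec s_const {X lambda} => [|m'] ? p'.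
    by move=> _; rewrite big_ord0 => /eqP; rewrite eq_sym oner_eq0.
  by exists ord0.
have s_gt0 : 0 < s by rewrite -(s_const i0) block_gain_gt0.
have W_gt0 n : 0 < n.+1%:R * s + rho by exact: (total_weight_gt0 chi_ge0 chi_rho_gt0 s_const i0 n).
have lambda_s : lambda = s.
  rewrite /lambda lambda1_mean_gain; under eq_bigr do rewrite s_const.
  by rewrite -mulr_suml p_sum1 mul1r.
have p_ge0 i : 0 <= p i by exact: ltW.
have mass n G : reach H n G -> \sum_(v < nvert G) latch_prob chi rho G v = 1.
  exact: reach_mass1.
have [k_mono k_ess k_min] := k_first.
have r1 : (r.-1 < r)%N by rewrite prednK.
pose kmax := k (Ordinal r1).
have k_le i : (k i <= kmax)%N.
  have : (i <= r.-1)%N by rewrite -ltnS prednK.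
  rewrite leq_eqVlt => /predU1P[ir|ir]; last by rewrite ltnW// k_mono.
  by rewrite /kmax (_ : i = Ordinal r1)//; exact: val_inj.
have k_gt0 i : (0 < k i)%N by have [] := k_ess i.
(* the total weight is at least (n + 1) min (s, s + rho) *)
pose c := (Num.min s (s + rho))^-1.
have c_gt0 : 0 < Num.min s (s + rho).
  by rewrite lt_min s_gt0/=; have := W_gt0 0; rewrite mul1r.
have W_ge n : (n.+1%:R * s + rho)^-1 <= c / n.+1%:R.
  rewrite /c -invfM lef_pV2 ?posrE ?mulr_gt0//.
  rewrite -natr1 mulrDr mulrDl mulr1 mul1r -addrA lerD//.
    by rewrite mulrC ler_wpM2l// ge_min lexx.
  by rewrite ge_min lexx orbT.
pose D0 : R := (\sum_i nvert (C i))%:R.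
have ExS n f : Ex H n.+1 f = Ex H n (fun G =>
    \sum_(v < nvert G) latch_prob chi rho G v * \sum_i p i * f (attach G v (C i))).
  exact: ExS.
have Ex1' n : Ex H n (fun=> 1) = 1 by exact: Ex1.
have [S [sS [momS meanS charS posS]]] : exists S : 'M[R]_r, S^T = S /\
  [/\ forall q i, exists B, forall n,
        Ex H n (fun G => ((Num.sqrt n%:R)^-1 * centred k nu s n G 0 i) ^+ (2 * q)) <= B,
      forall i, (Num.sqrt n%:R)^-1 * Ex H n (fun G => centred k nu s n G 0 i)
        @[n --> \oo] --> (0 : R),
      forall a b, Ex H n (fun G => cos (dot a ((Num.sqrt n%:R)^-1 *: centred k nu s n G) + b))
        @[n --> \oo] --> cos b * expR (- (qform a S a / 2)) &
      forall a, 0 <= qform a S a].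
  apply: (@centred_limits R chi rho m C p r k kmax nu s (reach H) c D0) => //.
  - by move=> dg d0; rewrite ltW// weight_gt0.
  - by move=> i; exact: weight_gt0.
  - exact: reach_sound.
  - by move=> n G; exact: reach_weight.
  - by move=> n G /reach_size; rewrite /D0 -natrM ler_nat mulnC.
  - move=> n G l rG /andP[l0 lk] lne; apply: (reach_rare k_first rG l0) => //.
    by exists (Ordinal r1).
  - exact: ExD.
  - exact: ExZ.
  - exact: Ex_le.
have XE n t : X n t - (n%:R * lambda) *: nu = centred k nu s n (hn_graph H n t).
  by rewrite lambda_s; apply/rowP => i; rewrite !mxE.
pose z n : R := (Num.sqrt n%:R)^-1.
pose E n (F : 'rV[R]_r -> R) := Ex H n (fun G => F (z n *: centred k nu s n G)).
have mE n : mean_functional (E n).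
  split=> [|F G|b F|F G FG]; rewrite /E; [exact: Ex1'|exact: ExD|exact: ExZ|].
  by apply: Ex_le => G' _; exact: FG.
have linkE n F : ('E_P[fun t => F (z n *: (X n t - (n%:R * lambda) *: nu))] =
    (E n F)%:E)%E.
  rewrite /E -(expectation_graph p_sum1 mass n (fun G => F (z n *: centred k nu s n G))).
  by congr ('E_P[_])%E; apply/funext => t; rewrite XE.
have covS : covariance_matrix S by split.
have momE q i : exists K, forall n, E n (fun x => x 0 i ^+ (2 * q)) <= K.
  have [B HB] := momS q i; exists B => n; apply: le_trans (HB n).
  by apply: Ex_le => G _; rewrite mxE.
have meanE n i : (mean_vector P (X n) - (n%:R * lambda) *: nu) 0 i =
    Ex H n (fun G => centred k nu s n G 0 i).
  rewrite !mxE.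
  have -> : ('E_P[fun t => X n t 0%R i] = (Ex H n (fun G => ((ndeg G (k i))%:R)%R))%:E)%E.
    rewrite -(expectation_graph p_sum1 mass n (fun G => (ndeg G (k i))%:R)).
    by congr ('E_P[_])%E; apply/funext => t; rewrite mxE.
  rewrite /= lambda_s; set q := n%:R * s * nu 0 i.
  have -> : - q = Ex H n (fun=> - q * 1) by rewrite ExZ Ex1' mulr1.
  by rewrite -ExD; congr (Ex H n _); apply/funext => G; rewrite mxE mulr1.
have cvg_mean i : (z n *: (mean_vector P (X n) - (n%:R * lambda) *: nu)) 0 i
    @[n --> \oo] --> (0 : R).
  by under eq_fun do rewrite mxE meanE; exact: meanS.
exists S; split=> //.
- exact: (@cvg_normal_moments_of_char _ _ _ _ _ _ E).
- exact: cvg_rV0.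
- have := cvg_normal_moments_shift mE linkE charS momE cvg_mean covS.
  congr (cvg_normal_moments P _ S); apply/funext => n; apply/funext => t.
  by rewrite -scalerBr opprB addrA subrK.
Qed.
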